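(* Let $d$ be a real number with $0<d<\pi$, and let $\mu,\nu$ be positive numbers satisfying $\mu/2<\nu<\mu/2+1$. Let $\tilde f_{\nu,N}$ be the approximation formula defined in the context, built from the modified Ganelius sampling points with parameter $r=d\mu/\pi$. Then there is a positive number $C$, independent of $N$, such that $$\sup_{\substack{f\in \boldsymbol{H}^{\infty}(\Lambda_d,w_\mu)\\ \|f\|\le 1}}\left(\sup_{x\in(-1,1)}\left|f(x)-\tilde f_{\nu,N}(x)\right|\right)\le C\exp\left(-\sqrt{\pi d\mu N}\right)$$ for every positive integer $N$ for which $\tilde f_{\nu,N}$ is defined (that is, $N_0\ge 1$ and the points $a_1,\dots,a_N$ are pairwise distinct).
   Context: **Region and space.** $\mathcal{D}_d=\{\zeta\in\mathbf{C}: |\operatorname{Im}\zeta|<d\}$ and $\Lambda_d=\{\tanh(\zeta/2):\zeta\in\mathcal{D}_d\}=\{z\in\mathbf{C}: |\arg((1+z)/(1-z))|<d\}$, so that $\Lambda_d\cap\mathbf{R}=(-1,1)$. Let $w_\mu(z)=(1-z^2)^{\mu/2}$ (principal branch, positive on $(-1,1)$). $\boldsymbol{H}^\infty(\Lambda_d,w_\mu)$ is the space of analytic functions $f:\Lambda_d\to\mathbf{C}$ with $\|f\|:=\sup_{z\in\Lambda_d}|f(z)/w_\mu(z)|<\infty$. **Modified Ganelius sampling points with parameter $r>0$.** For a positive integer $N$ put $N_0=N-\lceil \frac{\pi}{4}\sqrt{Nr}\rceil$ and $\varphi(x)=\exp(\pi\sqrt{x/r})$ for $x\ge0$. Define $a_k=\varphi(k-1)/\varphi(N_0)$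 for $k=1,\dots,N_0$; $a_{N_0+1}=\varphi(N_0-1/2)/\varphi(N_0)$; and $a_k=1-\frac{k-N_0-1}{5(N-N_0-1)}$ for $k=N_0+2,\dots,N$. These lie in $(0,1)$. **Derived quantities.** $b_k=\sqrt{(1-a_k)/(1+a_k)}$ and $b_{-k}=-b_k$ for $k=1,\dots,N$; $\beta_k=\tanh\left(\frac{2d}{\pi}\operatorname{arctanh} b_k\right)$ for $k=\pm1,\dots,\pm N$. A prime on a sum or product over indices from $-N$ to $N$ means that the index $0$ is excluded. Let $$\sigma_k=\prod_{\substack{\ell=-N\\ \ell\ne k}}^{N}{}^{\prime}\ \frac{1-b_\ell b_k}{b_k-b_\ell},\qquad B_N(z;\boldsymbol\beta,d)=\prod_{k=-N}^{N}{}^{\prime}\ \tanh\left[\frac{\pi}{2d}(\operatorname{arctanh} z-\operatorname{arctanh}\beta_k)\right].$$ **Formula.** For $f\in \boldsymbol{H}^\infty(\Lambda_d,w_\mu)$ and $x\in(-1,1)$, $$\tilde f_{\nu,N}(x)=\sum_{k=-N}^{N}{}^{\prime}\ f(\beta_k)\,\frac{2d\sigma_k}{\pi}\,\frac{(1-x^2)^\nu}{(1-\beta_k^2)^{\nu-1}}\,\frac{B_N(x;\boldsymbol\beta,d)}{x-\beta_k},$$ where $B_N(x;\boldsymbol\beta,d)/(x-\beta_k)$ is extended by continuity to $x=\beta_k$. *)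

(* Defs.v *)
From Stdlib Require Import Reals ZArith List.
From Coquelicot Require Export Coquelicot.

Open Scope R_scope.

Definition Cexp (z : C) : C :=
  (exp (Re z) * cos (Im z), exp (Re z) * sin (Im z)).

Definition Ctanh (z : C) : C :=
  ((Cexp z - Cexp (- z)) / (Cexp z + Cexp (- z)))%C.

(* Principal argument, in (-PI, PI]. *)
Definition Carg (z : C) : R :=
  if Rle_dec 0 (Im z) then acos (Re z / Cmod z) else - acos (Re z / Cmod z).

Definition Cln (z : C) : C := (ln (Cmod z), Carg z).

(* Principal branch of z^s, meaningful for z <> 0. *)
Definition Crpower (z : C) (s : R) : C := Cexp (RtoC s * Cln z)%C.

(* Meaningful for -1 < x < 1. *)
Definition arctanh (x : R) : R := / 2 * ln ((1 + x) / (1 - x)).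

Definition strip (d : R) (zeta : C) : Prop := Rabs (Im zeta) < d.

Definition Lambda (d : R) (z : C) : Prop :=
  exists zeta : C, strip d zeta /\ z = Ctanh (zeta / RtoC 2)%C.

Definition weight (mu : R) (z : C) : C := Crpower (RtoC 1 - z * z)%C (mu / 2).

(* Lambda d is open, so this complex differentiability only involves the values
   of f on Lambda d. *)
Definition analytic_on (D : C -> Prop) (f : C -> C) : Prop :=
  forall z : C, D z -> ex_derive (K := C_AbsRing) (V := C_NormedModule) f z.

Definition Hinf_norm (d mu : R) (f : C -> C) : Rbar :=
  Lub_Rbar (fun v => exists z : C, Lambda d z /\ v = Cmod (f z / weight mu z)%C).

(* A function on Lambda d is represented by a total function on C, whose values
   outside Lambda d play no role. *)
Definition Hinf (d mu : R) (f : C -> C) : Prop :=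
  analytic_on (Lambda d) f /\ Rbar_lt (Hinf_norm d mu f) p_infty.

(* Computed in Z, so that it is negative, rather than truncated to 0, when the
   ceiling exceeds N. *)
Definition N0 (r : R) (N : nat) : Z :=
  (Z.of_nat N - Zceil (PI / 4 * sqrt (INR N * r)))%Z.

Definition phi (r x : R) : R := exp (PI * sqrt (x / r)).

(* The sampling points a_k, meaningful for 1 <= k <= N. *)
Definition ganelius (r : R) (N : nat) (k : Z) : R :=
  if (k <=? N0 r N)%Z then phi r (IZR (k - 1)) / phi r (IZR (N0 r N))
  else if (k =? N0 r N + 1)%Z then
    phi r (IZR (N0 r N) - / 2) / phi r (IZR (N0 r N))
  else 1 - IZR (k - N0 r N - 1) / (5 * IZR (Z.of_nat N - N0 r N - 1)).

Definition node_b (r : R) (N : nat) (k : Z) : R :=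
  let b j := sqrt ((1 - ganelius r N j) / (1 + ganelius r N j)) in
  if (0 <? k)%Z then b k else - b (- k)%Z.

Definition node_beta (d r : R) (N : nat) (k : Z) : R :=
  tanh (2 * d / PI * arctanh (node_b r N k)).

(* The indices -N, ..., -1, 1, ..., N of a primed sum or product. *)
Definition indices (N : nat) : list Z :=
  remove Z.eq_dec 0%Z
    (map (fun i => (Z.of_nat i - Z.of_nat N)%Z) (seq 0 (2 * N + 1))).

Definition Csum_over (l : list Z) (F : Z -> C) : C :=
  fold_right (fun k s => (F k + s)%C) (RtoC 0) l.

Definition Rprod_over (l : list Z) (F : Z -> R) : R :=
  fold_right (fun k p => F k * p) 1 l.

Definition sigma (r : R) (N : nat) (k : Z) : R :=
  Rprod_over (remove Z.eq_dec k (indices N))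
    (fun l => (1 - node_b r N l * node_b r N k)
              / (node_b r N k - node_b r N l)).

(* B_N(x; beta, d) at the real points -1 < x < 1, where the formula uses it. *)
Definition blaschke (d r : R) (N : nat) (x : R) : R :=
  Rprod_over (indices N)
    (fun k => tanh (PI / (2 * d) * (arctanh x - arctanh (node_beta d r N k)))).

(* B_N(x; beta, d) / (x - beta_k), extended by continuity to x = beta_k. *)
Definition blaschke_quot (d r : R) (N : nat) (k : Z) (x : R) : R :=
  let q t := blaschke d r N t / (t - node_beta d r N k) in
  if Req_EM_T x (node_beta d r N k) then real (Lim q x) else q x.

Definition approx (d nu r : R) (N : nat) (f : C -> C) (x : R) : C :=
  Csum_over (indices N) (fun k =>
    (f (RtoC (node_beta d r N k)) *
     RtoC (2 * d * sigma r N k / PI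
           * (Rpower (1 - x ^ 2) nu
              / Rpower (1 - node_beta d r N k ^ 2) (nu - 1))
           * blaschke_quot d r N k x))%C).

Definition approx_defined (r : R) (N : nat) : Prop :=
  (1 <= N0 r N)%Z /\
  forall j k : Z, (1 <= j <= Z.of_nat N)%Z -> (1 <= k <= Z.of_nat N)%Z ->
    ganelius r N j = ganelius r N k -> j = k.

Definition sup_error (d nu r : R) (N : nat) (f : C -> C) : Rbar :=
  Lub_Rbar (fun v => exists x : R, -1 < x < 1 /\
    v = Cmod (f (RtoC x) - approx d nu r N f x)%C).

Definition worst_error (d mu nu r : R) (N : nat) : Rbar :=
  Rbar_lub (fun s => exists f : C -> C,
    Hinf d mu f /\ Rbar_le (Hinf_norm d mu f) 1 /\ s = sup_error d nu r N f).

(* Main.v *)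
(* Put x = tanh (xi/2) and z = tanh (zeta/2), which turns Lambda_d into the strip
   |Im zeta| < d.  With a = pi/(4d), the node beta_k sits at zeta_k = arctanh b_k / a
   and B_N(x) is the product of the tanh (a (xi - zeta_k)).  The error equals
   (1 - x^2)^nu B_N(x) times the sum of the residues of
     f(z) (1 - z^2)^(-nu) z'(zeta) / ((z - x) B_N(z))
   at xi and at the zeta_k, all simple poles on the real line.  Integrating over
   the boundary of [-X,X] x [-h,h] and letting X -> oo, then h -> d, where |B_N| -> 1,
   the bound |f| <= |w_mu| gives |error| <= C |B_N(x)| cosh(xi/2)^(-mu).

   With t = 1 / cosh (2 a xi) and r = d mu / pi this is at most
   C t^r prod_k |a_k - t| / (a_k + t).  Write t = phi(s)/phi(N_0) and c = pi/(2 sqrt r).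
   The logarithm of the product over the first N_0 + 1 points is a sum of values of
   g(y) = ln tanh (c |sqrt y - sqrt s|); g is concave on either side of s (away from 0),
   so the trapezoidal rule bounds the sum by the integral of g over [0, N_0] up to O(1).
   Over the whole u-line (y = u^2) that integral is -pi sqrt (r s), because
   int_0^oo ln tanh = - sum 1/(2j+1)^2 = - pi^2/8; what is lost beyond N_0 is
   regained from the points in [4/5, 1). *)

From Stdlib Require Import Reals Lra Lia Psatz List ZArith Permutation ClassicalEpsilon.
Require Import Defs.
From Coquelicot Require Import Coquelicot.
Local Open Scope R_scope.


(** * Finite sums and the sum of the inverse odd squares *)

(** The delicate place is the cell of the integer grid around [s]. There [g] is singular, and the
    adjacent nodes contribute about [ln (c / sqrt s)] each, which is unbounded; so the integral over
    that cell must be bounded below by the same term up to a constant. Integrals of [g] are never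
    computed: one integration by parts yields [FL] and [FR], whose derivatives are at least [g].

    The parameters fit together. With [r = d mu / pi], [t^r] decays at the rate of
    [cosh(xi/2)^(-mu)]. The sampling point at [N_0 - 1/2] closes the last cell of the rule. With
    [t = exp(-2y)], the loss beyond [N_0] is at most [(4/pi) sqrt(r N) chi2(y)]; each of about
    [(pi/4) sqrt(r N)] points in [[4/5, 1)] regains [(16/pi^2) chi2(y)], the same total.

    On the contour, [mu/2 < nu < mu/2 + 1] means [|2 nu - mu - 1| < 1]: exactly then
    [1/sinh((zeta - xi)/2)] outweighs the remaining power of [cosh(zeta/2)]. A point [x] that is
    itself a node would give a double pole and is treated separately. *)

Fixpoint sum_below (u : nat -> R) (n : nat) : R :=
  match n with O => 0 | S m => sum_below u m + u m end.

Lemma sum_below_ext (u v : nat -> R) (n : nat) :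
  (forall k, (k < n)%nat -> u k = v k) -> sum_below u n = sum_below v n.
Proof.
  induction n as [|n IH]; simpl; intros H; trivial.
  rewrite IH, H; auto with arith.
Qed.

Lemma sum_below_le (u v : nat -> R) (n : nat) :
  (forall k, (k < n)%nat -> u k <= v k) -> sum_below u n <= sum_below v n.
Proof.
  induction n as [|n IH]; simpl; intros H; [lra|].
  apply Rplus_le_compat; auto with arith.
Qed.

Lemma sum_below_plus (u v : nat -> R) (n : nat) :
  sum_below (fun k => u k + v k) n = sum_below u n + sum_below v n.
Proof. induction n as [|n IH]; simpl; [ring|rewrite IH; ring]. Qed.

Lemma sum_below_scal (c : R) (u : nat -> R) (n : nat) :
  sum_below (fun k => c * u k) n = c * sum_below u n.
Proof. induction n as [|n IH]; simpl; [ring|rewrite IH; ring]. Qed.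

Lemma sum_below_const (c : R) (n : nat) : sum_below (fun _ => c) n = INR n * c.
Proof. induction n as [|n IH]; [simpl; ring|]. rewrite S_INR. simpl. rewrite IH. ring. Qed.

Lemma sum_below_add (u : nat -> R) (n p : nat) :
  sum_below u (n + p) = sum_below u n + sum_below (fun k => u (n + k)%nat) p.
Proof.
  induction p as [|p IH]; simpl.
  - rewrite Nat.add_0_r. ring.
  - rewrite Nat.add_succ_r. simpl. rewrite IH. ring.
Qed.

Lemma sum_below_S_l (u : nat -> R) (n : nat) :
  sum_below u (S n) = u O + sum_below (fun k => u (S k)) n.
Proof. change (S n) with (1 + n)%nat. rewrite sum_below_add. simpl. ring. Qed.

Lemma sum_below_rev (u : nat -> R) (n : nat) :
  sum_below u n = sum_below (fun k => u (n - 1 - k)%nat) n.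
Proof.
  induction n as [|n IH]; trivial.
  rewrite (sum_below_S_l (fun k => u (S n - 1 - k)%nat)).
  replace (S n - 1 - 0)%nat with n by lia.
  simpl sum_below at 1. rewrite IH, Rplus_comm. f_equal.
  apply sum_below_ext. intros k Hk. f_equal. lia.
Qed.

Lemma sum_below_sum_n (u : nat -> R) (n : nat) :
  sum_n u n = sum_below u (S n).
Proof.
  induction n as [|n IH].
  - rewrite sum_O. simpl. ring.
  - rewrite sum_Sn, IH. reflexivity.
Qed.

(** * Monotonicity from the sign of a derivative *)

Ltac prove_continuity_pt :=
  repeat first
  [ assumption
  | apply continuity_pt_id
  | exact (continuity_pt_opp (fun z => z) _ (continuity_pt_id _))
  | match goal with |- continuity_pt (fun _ => _) _ =>
      apply continuity_pt_const; intros ? ?; reflexivity end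
  | match goal with |- continuity_pt (fun y => sqrt (@?f y)) _ =>
      apply (continuity_pt_comp f sqrt); [|apply continuity_pt_sqrt; lra] end
  | apply continuity_pt_plus | apply continuity_pt_minus | apply continuity_pt_mult
  | match goal with |- continuity_pt (fun z => - @?f z) _ => apply (continuity_pt_opp f) end ].

Lemma derive_nonneg_le (f f' : R -> R) (a b : R) : a <= b ->
  (forall x, a <= x <= b -> continuity_pt f x) ->
  (forall x, a < x < b -> is_derive f x (f' x)) ->
  (forall x, a < x < b -> 0 <= f' x) -> f a <= f b.
Proof.
  intros Hab Hc Hd Hp.
  destruct (Rle_lt_or_eq_dec _ _ Hab) as [Hlt|Heq]; [|subst; lra].
  (* The mean value point may be an endpoint, where nothing is known about [f']; truncating with
     [Rmax 0] keeps the derivative nonnegative there. *)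
  destruct (MVT_gen f a b (fun x => Rmax 0 (f' x))) as [x [Hx E]].
  - rewrite Rmin_left, Rmax_right by lra. intros x Hx.
    rewrite Rmax_right by (apply Hp; lra). now apply Hd.
  - rewrite Rmin_left, Rmax_right by lra. exact Hc.
  - assert (H := Rmax_l 0 (f' x)). nra.
Qed.

Lemma is_derive_continuity_pt (f : R -> R) (x l : R) :
  is_derive f x l -> continuity_pt f x.
Proof.
  intros H. apply continuity_pt_filterlim.
  apply (ex_derive_continuous f x). now exists l.
Qed.

Lemma derive_nonneg_le_closed (f f' : R -> R) (a b : R) : a <= b ->
  (forall x, a <= x <= b -> is_derive f x (f' x)) ->
  (forall x, a <= x <= b -> 0 <= f' x) -> f a <= f b.
Proof.
  intros Hab Hd Hp. apply (derive_nonneg_le f f'); auto.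
  - intros x Hx. eapply is_derive_continuity_pt, Hd, Hx.
  - intros x Hx. apply Hd. lra.
  - intros x Hx. apply Hp. lra.
Qed.

(** * The sum of the inverse odd squares, through sums of inverse squared sines *)

Lemma x_cos_le_sin (x : R) : 0 <= x <= PI -> x * cos x <= sin x.
Proof.
  intros Hx.
  assert (H := derive_nonneg_le_closed (fun y => sin y - y * cos y)
    (fun y => y * sin y) 0 x ltac:(lra)).
  cut (sin 0 - 0 * cos 0 <= sin x - x * cos x); [rewrite sin_0; lra|].
  apply H.
  - intros y _. auto_derive; trivial. ring.
  - intros y Hy. apply Rmult_le_pos; [lra|]. apply sin_ge_0; lra.
Qed.

(** Duplication of the angle replaces one term by two at half the angle and half the supplement;
    this drives the induction in [sum_inv_sin_sq]. *)
Lemma inv_sin_sq_half (x : R) : 0 < x < PI ->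
  / sin x ^ 2 = / 4 * (/ sin (x / 2) ^ 2 + / sin ((PI - x) / 2) ^ 2).
Proof.
  intros Hx.
  replace ((PI - x) / 2) with (PI / 2 - x / 2) by field.
  rewrite sin_shift.
  assert (0 < sin (x / 2)) by (apply sin_gt_0; lra).
  assert (0 < cos (x / 2)) by (apply cos_gt_0; lra).
  assert (E : sin x = 2 * sin (x / 2) * cos (x / 2)).
  { rewrite <- sin_2a. f_equal. field. }
  rewrite E.
  assert (E2 : sin (x / 2) ^ 2 + cos (x / 2) ^ 2 = 1).
  { rewrite <- (sin2_cos2 (x / 2)). unfold Rsqr. ring. }
  transitivity ((sin (x / 2) ^ 2 + cos (x / 2) ^ 2)
    / (4 * sin (x / 2) ^ 2 * cos (x / 2) ^ 2)).
  - rewrite E2. field. lra.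
  - field. lra.
Qed.

Lemma INR_pow2 (n : nat) : INR (2 ^ n) = 2 ^ n.
Proof. rewrite pow_INR. reflexivity. Qed.

Definition odd_angle (n k : nat) : R := (2 * INR k + 1) * PI / (4 * 2 ^ n).

Lemma odd_angle_range (n k : nat) : (k < 2 ^ n)%nat ->
  0 < odd_angle n k < PI / 2.
Proof.
  intros Hk. unfold odd_angle.
  assert (HP := PI_RGT_0).
  assert (H0 := pos_INR k).
  assert (H1 : INR k + 1 <= 2 ^ n).
  { rewrite <- S_INR, <- INR_pow2. apply le_INR. lia. }
  split.
  - apply Rdiv_lt_0_compat; nra.
  - apply Rmult_lt_reg_r with (4 * 2 ^ n); [lra|].
    unfold Rdiv at 1. rewrite Rmult_assoc, Rinv_l by lra. nra.
Qed.

Lemma sum_inv_sin_sq (n : nat) :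
  sum_below (fun k => / sin (odd_angle n k) ^ 2) (2 ^ n) = 2 * 4 ^ n.
Proof.
  induction n as [|n IH].
  - simpl. unfold odd_angle.
    replace ((2 * INR 0 + 1) * PI / (4 * 2 ^ 0)) with (PI / 4) by (simpl; field).
    rewrite sin_PI4.
    replace (1 / sqrt 2 * (1 / sqrt 2 * 1)) with (/ 2).
    + field.
    + assert (H := sqrt_sqrt 2 ltac:(lra)).
      assert (0 < sqrt 2) by (apply sqrt_lt_R0; lra).
      rewrite <- H at 1. field. lra.
  - replace (2 ^ S n)%nat with (2 ^ n + 2 ^ n)%nat
      by (rewrite Nat.pow_succ_r'; lia).
    rewrite sum_below_add.
    (* Reversing the second half pairs index [k] with [2^(n+1) - 1 - k]; the two angles are the
       halves of [odd_angle n k] and of its supplement. *)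
    rewrite (sum_below_rev (fun k => / sin (odd_angle (S n) (2 ^ n + k)) ^ 2)).
    rewrite <- sum_below_plus.
    rewrite (sum_below_ext _ (fun k => 4 * / sin (odd_angle n k) ^ 2)).
    + rewrite sum_below_scal, IH. simpl. ring.
    + intros k Hk.
      destruct (odd_angle_range n k Hk) as [H1 H2].
      rewrite (inv_sin_sq_half (odd_angle n k)) by lra.
      assert (H3 := pow_lt 2 n ltac:(lra)).
      replace (odd_angle n k / 2) with (odd_angle (S n) k)
        by (unfold odd_angle; simpl; field; lra).
      replace ((PI - odd_angle n k) / 2)
        with (odd_angle (S n) (2 ^ n + (2 ^ n - 1 - k))).
      * lra.
      * unfold odd_angle. rewrite plus_INR, !minus_INR by lia.
        rewrite INR_pow2. simpl. field. lra.
Qed.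

Definition inv_odd_sq (n : nat) : R := / (2 * INR n + 1) ^ 2.

(** On [(0, pi/2)] one has [1/sin^2 y - 1 <= 1/y^2 <= 1/sin^2 y], the first because
    [y cos y <= sin y]. Summed over the [2^n] angles, the error is at most [2^n], and rescaling by
    [c] turns it into [pi^2/16 * 2^(-n)]. *)
Lemma sum_inv_odd_sq_bounds (n : nat) :
  PI ^ 2 / 8 - PI ^ 2 / 16 * (/ 2) ^ n
  <= sum_below inv_odd_sq (2 ^ n) <= PI ^ 2 / 8.
Proof.
  assert (H := pow_lt 2 n ltac:(lra)).
  assert (HP := PI_RGT_0).
  assert (E4 : 4 ^ n = 2 ^ n * 2 ^ n).
  { rewrite <- Rpow_mult_distr. f_equal. }
  assert (S1 := sum_inv_sin_sq n).
  set (c := 16 * 4 ^ n / PI ^ 2).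
  assert (Hc : 0 < c).
  { unfold c. rewrite E4. apply Rdiv_lt_0_compat; nra. }
  assert (Ec : forall k, c * inv_odd_sq k = / odd_angle n k ^ 2).
  { intros k. unfold c, inv_odd_sq, odd_angle. rewrite E4.
    assert (H0 := pos_INR k). field. repeat split; lra. }
  assert (S2 : c * sum_below inv_odd_sq (2 ^ n)
      = sum_below (fun k => / odd_angle n k ^ 2) (2 ^ n)).
  { rewrite <- sum_below_scal. apply sum_below_ext. intros; apply Ec. }
  assert (U : c * sum_below inv_odd_sq (2 ^ n) <= 2 * 4 ^ n).
  { rewrite S2, <- S1. apply sum_below_le. intros k Hk.
    destruct (odd_angle_range n k Hk) as [H1 H2].
    assert (0 < sin (odd_angle n k)) by (apply sin_gt_0; lra).
    assert (sin (odd_angle n k) < odd_angle n k) by (apply sin_lt_x; lra).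
    apply Rinv_le_contravar; [apply pow_lt; lra|]. apply pow_incr. lra. }
  assert (L : 2 * 4 ^ n <= c * sum_below inv_odd_sq (2 ^ n) + 2 ^ n).
  { rewrite S2, <- S1. rewrite <- (Rmult_1_r (2 ^ n)).
    rewrite <- INR_pow2.
    rewrite <- (sum_below_const 1).
    rewrite <- sum_below_plus. apply sum_below_le. intros k Hk.
    destruct (odd_angle_range n k Hk) as [H1 H2].
    set (y := odd_angle n k) in *.
    assert (Hs : 0 < sin y) by (apply sin_gt_0; lra).
    assert (Hy := x_cos_le_sin y ltac:(lra)).
    assert (Hco : 0 < cos y) by (apply cos_gt_0; lra).
    assert (E2 : sin y ^ 2 + cos y ^ 2 = 1).
    { rewrite <- (sin2_cos2 y). unfold Rsqr. ring. }
    apply Rmult_le_reg_r with (sin y ^ 2 * y ^ 2).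
    { apply Rmult_lt_0_compat; apply pow_lt; lra. }
    replace (/ sin y ^ 2 * (sin y ^ 2 * y ^ 2)) with (y ^ 2) by (field; lra).
    replace ((/ y ^ 2 + 1) * (sin y ^ 2 * y ^ 2)) with (sin y ^ 2 + sin y ^ 2 * y ^ 2)
      by (field; lra).
    assert ((y * cos y) ^ 2 <= sin y ^ 2) by (apply pow_incr; nra).
    nra. }
  assert (Ei : 2 ^ n * (/ 2) ^ n = 1).
  { rewrite <- Rpow_mult_distr. replace (2 * / 2) with 1 by field. apply pow1. }
  assert (E1 : c * (PI ^ 2 / 8) = 2 * 4 ^ n) by (unfold c; field; lra).
  assert (E3 : c * (PI ^ 2 / 16 * (/ 2) ^ n) = 2 ^ n).
  { unfold c. rewrite E4. transitivity (2 ^ n * (2 ^ n * (/ 2) ^ n)).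
    - field. lra.
    - rewrite Ei. ring. }
  split; apply Rmult_le_reg_l with c; trivial; lra.
Qed.

(** * The integral of ln tanh *)

Lemma inv_odd_sq_pos (n : nat) : 0 < inv_odd_sq n.
Proof.
  unfold inv_odd_sq. assert (H := pos_INR n).
  apply Rinv_0_lt_compat, pow_lt. lra.
Qed.

Lemma is_series_inv_odd_sq : is_series inv_odd_sq (PI ^ 2 / 8).
Proof.
  assert (HP := PI_RGT_0).
  assert (Hmon : forall n p, sum_below inv_odd_sq n <= sum_below inv_odd_sq (n + p)).
  { intros n p. induction p as [|p IH].
    - rewrite Nat.add_0_r. lra.
    - rewrite Nat.add_succ_r. simpl. assert (H := inv_odd_sq_pos (n + p)). lra. }
  assert (Hub : forall n, sum_below inv_odd_sq n <= PI ^ 2 / 8).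
  { intros n. assert (Hn : (n < 2 ^ n)%nat) by (apply Nat.pow_gt_lin_r; lia).
    apply Rle_trans with (2 := proj2 (sum_inv_odd_sq_bounds n)).
    replace (2 ^ n)%nat with (n + (2 ^ n - n))%nat by lia. apply Hmon. }
  assert (H : is_lim_seq (sum_n inv_odd_sq) (PI ^ 2 / 8)); [|exact H].
  apply is_lim_seq_spec. intros eps.
  assert (He : 0 < eps / (PI ^ 2 / 16)).
  { apply Rdiv_lt_0_compat; [apply eps|]. nra. }
  destruct (pow_lt_1_zero (/ 2) ltac:(rewrite Rabs_pos_eq; lra) _ He) as [M HM].
  exists (2 ^ M)%nat. intros n Hn.
  rewrite sum_below_sum_n.
  assert (H1 := Hub (S n)).
  assert (H2 := proj1 (sum_inv_odd_sq_bounds M)).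
  assert (H3 := Hmon (2 ^ M)%nat (S n - 2 ^ M)%nat).
  replace (2 ^ M + (S n - 2 ^ M))%nat with (S n) in H3 by lia.
  specialize (HM M (le_n M)).
  rewrite Rabs_pos_eq in HM by (apply pow_le; lra).
  assert (H4 : PI ^ 2 / 16 * (/ 2) ^ M < eps).
  { apply Rmult_lt_compat_l with (r := PI ^ 2 / 16) in HM; [|nra].
    replace (PI ^ 2 / 16 * (eps / (PI ^ 2 / 16))) with (pos eps) in HM by (field; lra).
    exact HM. }
  rewrite Rabs_left1 by lra. lra.
Qed.

Lemma is_lim_seq_odd_ratio :
  is_lim_seq (fun n => (2 * INR n + 1) / (2 * INR n + 3)) 1.
Proof.
  apply is_lim_seq_ext with (fun n => 1 - 2 * / (2 * INR n + 3)).
  { intros n. assert (H := pos_INR n). field. lra. }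
  replace (Finite 1) with (Rbar_minus 1 (Rbar_mult 2 0)) by (simpl; f_equal; ring).
  apply is_lim_seq_minus'; [apply is_lim_seq_const|].
  apply (is_lim_seq_scal_l _ 2 0).
  replace (Finite 0) with (Rbar_inv p_infty) by reflexivity.
  apply is_lim_seq_inv; [|discriminate].
  apply is_lim_seq_le_p_loc with INR.
  - exists 0%nat. intros n _. assert (H := pos_INR n). lra.
  - apply is_lim_seq_INR.
Qed.

Lemma CV_radius_ratio_1 (a : nat -> R) : (forall n, 0 < a n) ->
  is_lim_seq (fun n => a (S n) / a n) 1 -> CV_radius a = 1.
Proof.
  intros Ha H. rewrite (CV_radius_finite_DAlembert a 1).
  - f_equal. field.
  - intros n. apply Rgt_not_eq, Ha.
  - lra.
  - revert H. apply is_lim_seq_ext. intros n. rewrite Rabs_pos_eq; trivial.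
    apply Rlt_le, Rdiv_lt_0_compat; apply Ha.
Qed.

Definition inv_odd (n : nat) : R := / (2 * INR n + 1).

Lemma inv_odd_pos (n : nat) : 0 < inv_odd n.
Proof. unfold inv_odd. assert (H := pos_INR n). apply Rinv_0_lt_compat. lra. Qed.

Lemma CV_radius_inv_odd : CV_radius inv_odd = 1.
Proof.
  apply CV_radius_ratio_1; [apply inv_odd_pos|].
  apply is_lim_seq_ext with (2 := is_lim_seq_odd_ratio).
  intros n. unfold inv_odd. rewrite S_INR. assert (H := pos_INR n). field. lra.
Qed.

Lemma CV_radius_inv_odd_sq : CV_radius inv_odd_sq = 1.
Proof.
  apply CV_radius_ratio_1; [apply inv_odd_sq_pos|].
  apply is_lim_seq_ext with
    (fun n => (2 * INR n + 1) / (2 * INR n + 3) * ((2 * INR n + 1) / (2 * INR n + 3))).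
  - intros n. unfold inv_odd_sq. rewrite S_INR. assert (H := pos_INR n). field. lra.
  - replace (Finite 1) with (Finite (1 * 1)) by (f_equal; ring).
    apply is_lim_seq_mult'; apply is_lim_seq_odd_ratio.
Qed.

(** An odd series is written [y * PSeries a (y^2)] to stay with ordinary power series. The weight
    [2 n + 1] cancels one factor of the denominators, taking [inv_odd_sq] to [inv_odd] and [inv_odd]
    to the geometric series. *)
Lemma is_derive_odd_series (a : nat -> R) (q : R) :
  Rbar_lt (Rabs (q ^ 2)) (CV_radius a) ->
  is_derive (fun y => y * PSeries a (y ^ 2)) q
    (PSeries (fun n => (2 * INR n + 1) * a n) (q ^ 2)).
Proof.
  intros Hq.
  assert (HD := is_derive_PSeries a (q ^ 2) Hq).
  assert (E : PSeries (fun n => (2 * INR n + 1) * a n) (q ^ 2)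
    = PSeries a (q ^ 2) + 2 * q ^ 2 * PSeries (PS_derive a) (q ^ 2)).
  { assert (X1 : ex_pseries a (q ^ 2)) by now apply CV_radius_inside.
    assert (X2 : ex_pseries (PS_incr_1 (PS_derive a)) (q ^ 2)).
    { apply ex_pseries_incr_1, CV_radius_inside. now rewrite CV_radius_derive. }
    assert (X3 : ex_pseries (PS_scal 2 (PS_incr_1 (PS_derive a))) (q ^ 2)).
    { apply ex_pseries_scal; trivial. apply Rmult_comm. }
    replace (2 * q ^ 2 * PSeries (PS_derive a) (q ^ 2))
      with (PSeries (PS_scal 2 (PS_incr_1 (PS_derive a))) (q ^ 2)).
    - rewrite <- PSeries_plus by trivial. apply PSeries_ext. intros n.
      unfold PS_plus, PS_scal, PS_incr_1, PS_derive.
      unfold plus, scal; simpl. unfold mult; simpl.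
      destruct n as [|n]; [simpl; unfold zero; simpl; ring|].
      change (match n with 0%nat => 1 | S _ => INR n + 1 end) with (INR (S n)). ring.
    - rewrite PSeries_scal, PSeries_incr_1. ring. }
  rewrite E.
  evar_last.
  - apply (is_derive_mult (fun y => y) (fun y => PSeries a (y ^ 2))).
    + apply is_derive_id.
    + apply (is_derive_comp (PSeries a) (fun y => y ^ 2)).
      * exact HD.
      * instantiate (1 := 2 * q). auto_derive; trivial. ring.
    + intros; apply Rmult_comm.
  - unfold plus, mult, scal, one; simpl. unfold mult; simpl. ring.
Qed.

Lemma PSeries_geom (x : R) : Rabs x < 1 -> PSeries (fun _ => 1) x = / (1 - x).
Proof.
  intros H. unfold PSeries. rewrite <- Series_geom by trivial.
  apply Series_ext. intros; ring.
Qed.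

Lemma artanh_series (q : R) : 0 <= q < 1 ->
  q * PSeries inv_odd (q ^ 2) = / 2 * ln ((1 + q) / (1 - q)).
Proof.
  intros Hq.
  assert (Hd : forall y, 0 <= y <= q -> is_derive
    (fun y => y * PSeries inv_odd (y ^ 2) - / 2 * ln ((1 + y) / (1 - y))) y 0).
  { intros y Hy.
    assert (Hy2 : Rabs (y ^ 2) < 1) by (rewrite Rabs_pos_eq; nra).
    replace 0 with (minus (/ (1 - y ^ 2)) (/ (1 - y ^ 2))) by (unfold minus, plus, opp; simpl; ring).
    apply (is_derive_minus (fun y => y * PSeries inv_odd (y ^ 2))
      (fun y => / 2 * ln ((1 + y) / (1 - y)))).
    - rewrite <- PSeries_geom by trivial.
      evar_last.
      + apply is_derive_odd_series. rewrite CV_radius_inv_odd. exact Hy2.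
      + apply PSeries_ext. intros n. unfold inv_odd.
        assert (H := pos_INR n). field. lra.
    - auto_derive.
      + repeat split; try lra. apply Rdiv_lt_0_compat; lra.
      + field. repeat split; nra. }
  (* A vanishing derivative makes the difference and its negative both nondecreasing; the two signs
     [s] give equality with the value at 0. *)
  assert (A : forall s, s = 1 \/ s = -1 ->
    s * (0 * PSeries inv_odd (0 ^ 2) - / 2 * ln ((1 + 0) / (1 - 0))) <=
    s * (q * PSeries inv_odd (q ^ 2) - / 2 * ln ((1 + q) / (1 - q)))).
  { intros s _.
    apply (derive_nonneg_le_closed
      (fun y => s * (y * PSeries inv_odd (y ^ 2) - / 2 * ln ((1 + y) / (1 - y))))
      (fun _ => s * 0)); [lra| |intros; lra].
    intros y Hy.
    apply (is_derive_scal (fun y => y * PSeries inv_odd (y ^ 2) - / 2 * ln ((1 + y) / (1 - y)))).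
    now apply Hd. }
  assert (A1 := A 1 (or_introl eq_refl)).
  assert (A2 := A (-1) (or_intror eq_refl)).
  replace ((1 + 0) / (1 - 0)) with 1 in * by field.
  rewrite ln_1 in *. lra.
Qed.

(* Legendre's chi function of order two at [exp (- 2 |x|)]; for [x > 0] it is
   the integral of [- ln tanh] over [x, +oo). *)
Definition chi2 (x : R) : R :=
  exp (- 2 * Rabs x) * PSeries inv_odd_sq (exp (- 2 * Rabs x) ^ 2).

Lemma exp_neg_abs_range (x : R) : 0 < exp (- 2 * Rabs x) <= 1.
Proof.
  split; [apply exp_pos|]. rewrite <- exp_0.
  assert (H := Rabs_pos x).
  destruct (Req_dec (Rabs x) 0) as [E|E].
  - rewrite E. right. f_equal. ring.
  - left. apply exp_increasing. lra.
Qed.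

Lemma PSeries_inv_odd_sq_bounds (p : R) : 0 <= p <= 1 ->
  0 <= PSeries inv_odd_sq p <= PI ^ 2 / 8.
Proof.
  intros Hp.
  assert (HS := is_series_inv_odd_sq).
  assert (Ht : forall n, 0 <= inv_odd_sq n * p ^ n <= inv_odd_sq n).
  { intros n. assert (H := inv_odd_sq_pos n).
    assert (0 <= p ^ n) by (apply pow_le; lra).
    assert (p ^ n <= 1) by (rewrite <- (pow1 n); apply pow_incr; lra). nra. }
  split.
  - unfold PSeries.
    replace 0 with (Series (fun n : nat => 0 * 0)) by (rewrite Series_scal_l; ring).
    apply Series_le.
    + intros n. specialize (Ht n). lra.
    + apply (ex_series_le (K := R_AbsRing) (V := R_CompleteNormedModule)) with inv_odd_sq.
      * intros n. unfold norm; simpl. unfold abs; simpl. specialize (Ht n).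
        rewrite Rabs_pos_eq; lra.
      * eexists; exact HS.
  - rewrite <- (is_series_unique _ _ HS). apply Series_le; trivial.
    eexists; exact HS.
Qed.

Lemma chi2_bounds (x : R) :
  0 <= chi2 x <= PI ^ 2 / 8 * exp (- 2 * Rabs x).
Proof.
  unfold chi2. assert (H := exp_neg_abs_range x).
  set (q := exp (- 2 * Rabs x)) in *.
  assert (H1 := PSeries_inv_odd_sq_bounds (q ^ 2) ltac:(nra)). nra.
Qed.

Lemma chi2_le (x : R) : chi2 x <= PI ^ 2 / 8.
Proof.
  assert (H := chi2_bounds x). assert (H1 := exp_neg_abs_range x).
  nra.
Qed.

Lemma PSeries_inv_odd_sq_1 : PSeries inv_odd_sq 1 = PI ^ 2 / 8.
Proof.
  unfold PSeries. rewrite (Series_ext _ inv_odd_sq).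
  - apply is_series_unique, is_series_inv_odd_sq.
  - intros n. rewrite pow1. ring.
Qed.

Lemma chi2_0 : chi2 0 = PI ^ 2 / 8.
Proof.
  unfold chi2. rewrite Rabs_R0, Rmult_0_r, exp_0, pow1, PSeries_inv_odd_sq_1. ring.
Qed.

(** With [q = exp(-2x)] the derivative in [q] is [sum q^(2n) / (2n+1)], so the chain rule gives
    [-2 artanh q], which is [ln (tanh x)]. *)
Lemma is_derive_chi2_pos (x : R) : 0 < x -> is_derive chi2 x (ln (tanh x)).
Proof.
  intros Hx.
  assert (Hq : 0 < exp (- 2 * x) < 1).
  { split; [apply exp_pos|]. rewrite <- exp_0. apply exp_increasing. lra. }
  apply is_derive_ext_loc with
    (fun y => exp (- 2 * y) * PSeries inv_odd_sq (exp (- 2 * y) ^ 2)).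
  { exists (mkposreal x Hx). intros y Hy. unfold chi2.
    change (Rabs (y - x) < x) in Hy. apply Rabs_def2 in Hy.
    rewrite (Rabs_pos_eq y) by lra. reflexivity. }
  evar_last.
  - apply (is_derive_comp (fun q => q * PSeries inv_odd_sq (q ^ 2)) (fun y => exp (- 2 * y))).
    + apply is_derive_odd_series. rewrite CV_radius_inv_odd_sq.
      simpl. rewrite Rabs_pos_eq; nra.
    + instantiate (1 := - 2 * exp (- 2 * x)). auto_derive; trivial. ring.
  - unfold scal; simpl. unfold mult; simpl.
    rewrite (PSeries_ext _ inv_odd).
    + assert (H := artanh_series (exp (-2 * x)) ltac:(lra)).
      transitivity (- 2 * (exp (- 2 * x) * PSeries inv_odd (exp (-2 * x) ^ 2))); [simpl; ring|].
      rewrite H. unfold tanh, sinh, cosh.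
      transitivity (- ln ((1 + exp (-2 * x)) / (1 - exp (-2 * x)))); [field|].
      rewrite <- ln_Rinv by (apply Rdiv_lt_0_compat; lra).
      f_equal. replace (-2 * x) with (- x + - x) by ring.
      assert (Hx3 : exp x * exp (- x) = 1) by (rewrite <- exp_plus, <- exp_0; f_equal; ring).
      replace (-2 * x) with (- x + - x) in Hq by ring.
      rewrite exp_plus in *.
      replace (1 + exp (- x) * exp (- x)) with (exp (- x) * (exp x + exp (- x))) by (rewrite <- Hx3; ring).
      replace (1 - exp (- x) * exp (- x)) with (exp (- x) * (exp x - exp (- x))) by (rewrite <- Hx3; ring).
      field. repeat split; nra.
    + intros n. unfold inv_odd_sq, inv_odd. assert (H := pos_INR n). field. lra.
Qed.

Lemma chi2_even (x : R) : chi2 (- x) = chi2 x.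
Proof. unfold chi2. now rewrite Rabs_Ropp. Qed.

(** At 0 the series is evaluated on its circle of convergence, so Abel's theorem has to supply the
    limit; evenness reduces negative arguments to positive ones. *)
Lemma chi2_continuous (x : R) : continuity_pt chi2 x.
Proof.
  destruct (Rtotal_order x 0) as [H|[H|H]].
  - apply continuity_pt_ext with (fun y => chi2 (- y)); [intros; apply chi2_even|].
    apply (continuity_pt_comp (fun y => - y) chi2).
    + apply continuity_pt_opp, continuity_pt_id.
    + eapply is_derive_continuity_pt, is_derive_chi2_pos. lra.
  - subst x.
    assert (HA := Abel inv_odd_sq).
    rewrite CV_radius_inv_odd_sq in HA.
    specialize (HA ltac:(simpl; lra) ltac:(simpl; trivial)).
    assert (Hex : ex_pseries inv_odd_sq 1).
    { exists (PI ^ 2 / 8). apply is_pseries_R.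
      apply is_series_ext with (2 := is_series_inv_odd_sq).
      intros n. now rewrite pow1, Rmult_1_r. }
    specialize (HA Hex).
    assert (Hc : forall eps, 0 < eps -> exists del, 0 < del /\
      forall p, 1 - del < p < 1 -> Rabs (PSeries inv_odd_sq p - PI ^ 2 / 8) < eps).
    { intros eps Heps.
      assert (HA' := HA (fun y => Rabs (y - PSeries inv_odd_sq 1) < eps)).
      destruct HA' as [del Hdel].
      { exists (mkposreal eps Heps). intros y Hy. exact Hy. }
      exists del. split; [apply cond_pos|]. intros p Hp.
      rewrite <- PSeries_inv_odd_sq_1. apply (Hdel p).
      - unfold ball; simpl. unfold AbsRing_ball, abs, minus, plus, opp; simpl.
        apply Rabs_def1; lra.
      - simpl; lra. }
    intros eps Heps.
    assert (HP := PI_RGT_0).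
    destruct (Hc (eps / 2) ltac:(lra)) as [d1 [Hd1 HH]].
    assert (Hq : continuity_pt (fun y => exp (- 2 * Rabs y)) 0).
    { apply (continuity_pt_comp (fun y => - 2 * Rabs y) exp).
      - apply continuity_pt_scal, Rcontinuity_abs.
      - apply derivable_continuous_pt, derivable_pt_exp. }
    (* With [S] the series at [q^2], [chi2 y - pi^2/8 = q (S - pi^2/8) - (1 - q) pi^2/8]. The first
       entry of the minimum puts [q^2] within [d1] of 1, the second makes the last term smaller than
       [eps / 2]. *)
    set (e1 := Rmin (d1 / 2) (eps / (2 * (PI ^ 2 / 8)))).
    assert (He1 : 0 < e1).
    { unfold e1. apply Rmin_glb_lt; [lra|]. apply Rdiv_lt_0_compat; nra. }
    destruct (Hq e1 He1) as [del [Hdel Hd]].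
    exists del. split; [trivial|].
    intros y [Hy1 Hy2]. specialize (Hd y (conj Hy1 Hy2)).
    simpl in Hd, Hy2 |- *. unfold Rdist in *. unfold D_x, no_cond in Hy1.
    rewrite Rabs_R0, Rmult_0_r, exp_0 in Hd. 
    rewrite chi2_0. unfold chi2.
    assert (R1 := exp_neg_abs_range y). set (q := exp (-2 * Rabs y)) in *.
    assert (Hql : q < 1).
    { unfold q. rewrite <- exp_0. apply exp_increasing.
      assert (0 < Rabs y) by (apply Rabs_pos_lt; lra). lra. }
    apply Rabs_def2 in Hd. unfold e1 in Hd.
    assert (M1 := Rmin_l (d1 / 2) (eps / (2 * (PI ^ 2 / 8)))).
    assert (M2 := Rmin_r (d1 / 2) (eps / (2 * (PI ^ 2 / 8)))).
    assert (HH' := HH (q ^ 2) ltac:(assert (0 <= (1 - q) ^ 2) by apply pow2_ge_0; split; nra)).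
    apply Rabs_def2 in HH'.
    assert (Hm : (1 - q) * (PI ^ 2 / 8) < eps / 2).
    { apply Rlt_le_trans with (eps / (2 * (PI ^ 2 / 8)) * (PI ^ 2 / 8)).
      - apply Rmult_lt_compat_r; nra.
      - right. field. lra. }
    apply Rabs_def1; nra.
  - eapply is_derive_continuity_pt, is_derive_chi2_pos, H.
Qed.

(** * Trapezoidal bounds for ln tanh (c |sqrt y - sqrt s|) *)

Lemma cosh_pos (x : R) : 0 < cosh x.
Proof. unfold cosh. assert (H := exp_pos x). assert (H1 := exp_pos (- x)). lra. Qed.

Lemma sinh_pos (x : R) : 0 < x -> 0 < sinh x.
Proof. intros H. unfold sinh. assert (H1 := exp_increasing (- x) x ltac:(lra)). lra. Qed.

Lemma cosh2_minus_sinh2 (x : R) : cosh x ^ 2 - sinh x ^ 2 = 1.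
Proof.
  unfold cosh, sinh.
  assert (H : exp x * exp (- x) = 1) by (rewrite <- exp_plus, <- exp_0; f_equal; ring).
  transitivity (exp x * exp (- x)); [field|exact H].
Qed.

Lemma tanh_pos (x : R) : 0 < x -> 0 < tanh x.
Proof. intros H. apply Rdiv_lt_0_compat; [now apply sinh_pos|apply cosh_pos]. Qed.

Lemma is_derive_tanh (x : R) : is_derive tanh x (/ cosh x ^ 2).
Proof.
  assert (H := cosh_pos x). assert (H1 := cosh2_minus_sinh2 x).
  evar_last.
  - apply (is_derive_div sinh cosh).
    + apply is_derive_Reals, derivable_pt_lim_sinh.
    + apply is_derive_Reals, derivable_pt_lim_cosh.
    + lra.
  - replace (/ cosh x ^ 2) with ((cosh x ^ 2 - sinh x ^ 2) / cosh x ^ 2)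
      by (rewrite H1; field; lra).
    field. lra.
Qed.

Lemma tanh_lt_1 (x : R) : tanh x < 1.
Proof.
  assert (H := cosh_pos x). unfold tanh. apply Rmult_lt_reg_r with (cosh x); trivial.
  unfold Rdiv. rewrite Rmult_assoc, Rinv_l by lra.
  unfold sinh, cosh in *. assert (H1 := exp_pos (- x)). lra.
Qed.

Lemma tanh_le (x y : R) : x <= y -> tanh x <= tanh y.
Proof.
  intros H. apply (derive_nonneg_le_closed tanh (fun x => / cosh x ^ 2)); trivial.
  - intros z _. apply is_derive_tanh.
  - intros z _. apply Rlt_le, Rinv_0_lt_compat, pow_lt, cosh_pos.
Qed.

Lemma tanh_0 : tanh 0 = 0.
Proof. unfold tanh, sinh. rewrite Ropp_0, exp_0. unfold Rdiv. ring. Qed.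

Lemma tanh_le_x (x : R) : 0 <= x -> tanh x <= x.
Proof.
  intros H.
  cut (0 - tanh 0 <= x - tanh x); [rewrite tanh_0; lra|].
  apply (derive_nonneg_le_closed (fun y => y - tanh y) (fun y => 1 - / cosh y ^ 2)); trivial.
  - intros z _. apply (is_derive_minus (fun y => y) tanh); [apply (is_derive_id (K := R_AbsRing))|apply is_derive_tanh].
  - intros z _. assert (H1 := cosh2_minus_sinh2 z).
    assert (H3 : 1 <= cosh z ^ 2) by (assert (0 <= sinh z ^ 2) by apply pow2_ge_0; lra).
    apply Rinv_le_contravar in H3; lra.
Qed.

Lemma tanh_exp (x : R) : tanh x = (exp (2 * x) - 1) / (exp (2 * x) + 1).
Proof.
  unfold tanh, sinh, cosh. replace (2 * x) with (x + x) by ring.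
  rewrite exp_plus, exp_Ropp. assert (H := exp_pos x). field. nra.
Qed.

Lemma tanh_ge (x : R) : 0 <= x -> x / (1 + x) <= tanh x.
Proof.
  intros H. rewrite tanh_exp.
  assert (H1 : 1 + 2 * x <= exp (2 * x)) by apply exp_ineq1_le.
  set (E := exp (2 * x)) in *.
  apply Rmult_le_reg_r with ((1 + x) * (E + 1)); [apply Rmult_lt_0_compat; lra|].
  replace (x / (1 + x) * ((1 + x) * (E + 1))) with (x * (E + 1)) by (field; lra).
  replace ((E - 1) / (E + 1) * ((1 + x) * (E + 1))) with ((E - 1) * (1 + x)) by (field; lra).
  lra.
Qed.

(** [ln] takes the value 0 at nonpositive arguments. Consequently [log_tanh c s s] is 0 instead of
    minus infinity: it respects upper bounds by 0, but finer bounds near [s] have to exclude it. *)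
Lemma ln_le_0 (x : R) : x <= 1 -> ln x <= 0.
Proof.
  intros H. destruct (Rlt_le_dec 0 x) as [H0|H0].
  - rewrite <- ln_1. now apply ln_le.
  - unfold ln. destruct (Rlt_dec 0 x) as [H1|H1]; [exfalso; lra|apply Rle_refl].
Qed.

Lemma ln_tanh_le_0 (x : R) : ln (tanh x) <= 0.
Proof. apply ln_le_0. left. apply tanh_lt_1. Qed.

Lemma is_derive_ln_tanh (x : R) : 0 < x ->
  is_derive (fun y => ln (tanh y)) x (/ (sinh x * cosh x)).
Proof.
  intros H. assert (H1 := tanh_pos x H).
  evar_last.
  - apply (is_derive_comp ln tanh).
    + apply is_derive_Reals. apply derivable_pt_lim_ln. exact H1.
    + apply is_derive_tanh.
  - unfold scal; simpl. unfold mult; simpl. unfold tanh.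
    assert (H2 := sinh_pos x H). assert (H3 := cosh_pos x). field. lra.
Qed.

(** Both sides are odd series in [exp(-2x)], with coefficients [1/(2n+1)^2] and [1/(2n+1)], compared
    termwise. *)
Lemma chi2_le_ln_tanh (x : R) : 0 < x -> chi2 x <= - / 2 * ln (tanh x).
Proof.
  intros Hx.
  assert (Hq : 0 < exp (- 2 * x) < 1).
  { split; [apply exp_pos|]. rewrite <- exp_0. apply exp_increasing. lra. }
  assert (E : ln (tanh x) = - ln ((1 + exp (- 2 * x)) / (1 - exp (- 2 * x)))).
  { rewrite <- ln_Rinv by (apply Rdiv_lt_0_compat; lra). f_equal.
    rewrite tanh_exp. replace (-2 * x) with (- (2 * x)) in * by ring.
    rewrite exp_Ropp in *.
    assert (1 < exp (2 * x)).
    { rewrite <- exp_0. apply exp_increasing. lra. }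
    field. lra. }
  rewrite E. 
  replace (- / 2 * - ln ((1 + exp (-2 * x)) / (1 - exp (-2 * x))))
    with (/ 2 * ln ((1 + exp (-2 * x)) / (1 - exp (-2 * x)))) by ring.
  rewrite <- artanh_series by lra.
  unfold chi2. rewrite Rabs_pos_eq by lra.
  apply Rmult_le_compat_l; [lra|].
  unfold PSeries. apply Series_le.
  - intros n. 
    assert (H : 0 <= (exp (-2 * x) ^ 2) ^ n) by (apply pow_le, pow_le; lra).
    assert (H1 := inv_odd_sq_pos n). split; [nra|].
    apply Rmult_le_compat_r; trivial.
    unfold inv_odd_sq, inv_odd. assert (H2 := pos_INR n).
    apply Rinv_le_contravar; nra.
  - apply ex_series_ext with (fun n => scal (pow_n (exp (-2 * x) ^ 2) n) (inv_odd n)).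
    + intros n. rewrite pow_n_pow. unfold scal; simpl. unfold mult; simpl. apply Rmult_comm.
    + apply (CV_radius_inside inv_odd). rewrite CV_radius_inv_odd. simpl.
      rewrite Rabs_pos_eq; nra.
Qed.

(** Concavity of [g] gives [(y - a) g'(y) <= g y - g a], which makes [F y] minus the trapezoid over
    [[a, y]] nondecreasing. Asking only [g <= F'] lets the explicit [FL] and [FR] take the place of
    an exact primitive. *)
Lemma trapezoid (F F' g g' : R -> R) (a b : R) : a <= b ->
  (forall y, a <= y <= b -> is_derive F y (F' y)) ->
  (forall y, a <= y <= b -> g y <= F' y) ->
  (forall y, a <= y <= b -> is_derive g y (g' y)) ->
  (forall y z, a <= y -> y <= z -> z <= b -> g' z <= g' y) ->
  (b - a) / 2 * (g a + g b) <= F b - F a.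
Proof.
  intros Hab HF HFg Hg Hmon.
  cut (F a - (a - a) / 2 * (g a + g a) <= F b - (b - a) / 2 * (g a + g b)).
  { replace (a - a) with 0 by ring. lra. }
  apply (derive_nonneg_le_closed (fun y => F y - (y - a) / 2 * (g a + g y))
    (fun y => F' y - (/ 2 * (g a + g y) + (y - a) / 2 * g' y))); trivial.
  - intros y Hy. apply (is_derive_minus F (fun y => (y - a) / 2 * (g a + g y))); auto.
    evar_last.
    + apply (is_derive_mult (fun y => (y - a) / 2) (fun y => g a + g y)).
      * instantiate (1 := / 2). auto_derive; trivial. field.
      * apply (is_derive_plus (fun _ => g a) g); [apply is_derive_const|apply Hg; lra].
      * intros; apply Rmult_comm.
    + unfold plus, mult, zero; simpl. unfold mult; simpl. ring.
  - intros y Hy. assert (H1 := HFg y Hy).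
    assert (H2 : (y - a) * g' y <= g y - g a).
    { cut (g a - a * g' y <= g y - y * g' y); [lra|].
      apply (derive_nonneg_le_closed (fun z => g z - z * g' y) (fun z => g' z - g' y)); [lra| |].
      - intros z Hz. apply (is_derive_minus g (fun z => z * g' y)).
        + apply Hg; lra.
        + auto_derive; trivial. ring.
      - intros z Hz. assert (H := Hmon z y ltac:(lra) ltac:(lra) ltac:(lra)). lra. }
    lra.
Qed.

Lemma trapezoid_sum (F g : R -> R) (n p : nat) :
  (forall k, (n <= k < n + p)%nat ->
     / 2 * (g (INR k) + g (INR (S k))) <= F (INR (S k)) - F (INR k)) ->
  sum_below (fun j => g (INR (n + j))) (S p)
  <= / 2 * g (INR n) + / 2 * g (INR (n + p)) + F (INR (n + p)) - F (INR n).
Proof.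
  induction p as [|p IH]; intros H.
  - simpl. rewrite Nat.add_0_r. lra.
  - cbn [sum_below]. cbn [sum_below] in IH. specialize (IH ltac:(intros k Hk; apply H; lia)).
    specialize (H (n + p)%nat ltac:(lia)). rewrite Nat.add_succ_r. lra.
Qed.

Section LogTanh.

Variables c q : R.
Hypothesis hc : 0 < c.

Definition gR (y : R) : R := ln (tanh (c * (sqrt y - q))).
Definition gL (y : R) : R := ln (tanh (c * (q - sqrt y))).
(** Put [y = u^2] and integrate [2 u ln(tanh(c (u - q)))] by parts: the boundary term is
    [(2/c) u chi2], and the remaining integral of [- (2/c) chi2] is nonpositive. Dropping it leaves
    a function whose derivative is at least [gR]. *)
Definition FR (y : R) : R := 2 / c * sqrt y * chi2 (c * (sqrt y - q)).
(** To the left of [s] the remaining integral of [chi2] has the opposite sign and cannot be dropped.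
    It is replaced by the integral of the larger function [pi^2/8 * exp(-2|x|)], which is the
    exponential term. *)
Definition FL (y : R) : R :=
  - (2 / c * sqrt y * chi2 (c * (sqrt y - q)))
  + PI ^ 2 / (8 * c ^ 2) * exp (- 2 * (c * (q - sqrt y))).

Definition gR' (y : R) : R :=
  c / (2 * (sqrt y * (sinh (c * (sqrt y - q)) * cosh (c * (sqrt y - q))))).
Definition gL' (y : R) : R :=
  - (c / (2 * (sqrt y * (sinh (c * (q - sqrt y)) * cosh (c * (q - sqrt y)))))).

Lemma is_derive_gR (y : R) : 0 < y -> q < sqrt y -> is_derive gR y (gR' y).
Proof.
  intros Hy Hq. assert (Hs := sqrt_lt_R0 y Hy).
  assert (Hp : 0 < c * (sqrt y - q)) by nra.
  evar_last.
  - apply (is_derive_comp (fun z => ln (tanh z)) (fun y => c * (sqrt y - q))).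
    + now apply is_derive_ln_tanh.
    + instantiate (1 := c * / (2 * sqrt y)). auto_derive; trivial. field. lra.
  - unfold scal; simpl. unfold mult; simpl. unfold gR'.
    assert (H1 := sinh_pos _ Hp). assert (H2 := cosh_pos (c * (sqrt y - q))).
    field. lra.
Qed.

Lemma is_derive_gL (y : R) : 0 < y -> sqrt y < q -> is_derive gL y (gL' y).
Proof.
  intros Hy Hq. assert (Hs := sqrt_lt_R0 y Hy).
  assert (Hp : 0 < c * (q - sqrt y)) by nra.
  evar_last.
  - apply (is_derive_comp (fun z => ln (tanh z)) (fun y => c * (q - sqrt y))).
    + now apply is_derive_ln_tanh.
    + instantiate (1 := - (c * / (2 * sqrt y))). auto_derive; trivial. field. lra.
  - unfold scal; simpl. unfold mult; simpl. unfold gL'.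
    assert (H1 := sinh_pos _ Hp). assert (H2 := cosh_pos (c * (q - sqrt y))).
    field. lra.
Qed.

Definition FR' (y : R) : R := gR y + / (c * sqrt y) * chi2 (c * (sqrt y - q)).
Definition FL' (y : R) : R := gL y + / (c * sqrt y) *
  (PI ^ 2 / 8 * exp (- 2 * (c * (q - sqrt y))) - chi2 (c * (sqrt y - q))).

Lemma is_derive_FR (y : R) : 0 < y -> q < sqrt y -> is_derive FR y (FR' y).
Proof.
  intros Hy Hq. assert (Hs := sqrt_lt_R0 y Hy).
  assert (Hp : 0 < c * (sqrt y - q)) by nra.
  evar_last.
  - apply (is_derive_mult (fun y => 2 / c * sqrt y) (fun y => chi2 (c * (sqrt y - q)))).
    + instantiate (1 := / (c * sqrt y)). auto_derive; trivial. field. lra.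
    + apply (is_derive_comp chi2 (fun y => c * (sqrt y - q))).
      * now apply is_derive_chi2_pos.
      * instantiate (1 := c * / (2 * sqrt y)). auto_derive; trivial. field. lra.
    + intros; apply Rmult_comm.
  - unfold scal, plus; simpl. unfold mult; simpl. unfold FR', gR. field. lra.
Qed.

Lemma is_derive_FL (y : R) : 0 < y -> sqrt y < q -> is_derive FL y (FL' y).
Proof.
  intros Hy Hq. assert (Hs := sqrt_lt_R0 y Hy).
  assert (Hp : 0 < c * (q - sqrt y)) by nra.
  apply is_derive_ext with (fun y => - (2 / c * sqrt y * chi2 (c * (q - sqrt y)))
    + PI ^ 2 / (8 * c ^ 2) * exp (- 2 * (c * (q - sqrt y)))).
  { intros t. unfold FL. rewrite <- chi2_even. do 4 f_equal. ring. }
  evar_last.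
  - apply (is_derive_plus (fun y => - (2 / c * sqrt y * chi2 (c * (q - sqrt y))))
      (fun y => PI ^ 2 / (8 * c ^ 2) * exp (- 2 * (c * (q - sqrt y))))).
    + apply (is_derive_opp (fun y => 2 / c * sqrt y * chi2 (c * (q - sqrt y)))).
      apply (is_derive_mult (fun y => 2 / c * sqrt y) (fun y => chi2 (c * (q - sqrt y)))).
      * instantiate (1 := / (c * sqrt y)). auto_derive; trivial. field. lra.
      * apply (is_derive_comp chi2 (fun y => c * (q - sqrt y))).
        -- now apply is_derive_chi2_pos.
        -- instantiate (1 := - (c * / (2 * sqrt y))). auto_derive; trivial. field. lra.
      * intros; apply Rmult_comm.
    + instantiate (1 := PI ^ 2 / (8 * c * sqrt y) * exp (- 2 * (c * (q - sqrt y)))).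
      auto_derive; trivial. unfold Rminus. field. lra.
  - unfold scal, plus, opp; simpl. unfold mult; simpl. unfold FL', gL.
    rewrite <- (chi2_even (c * (sqrt y - q))).
    replace (- (c * (sqrt y - q))) with (c * (q - sqrt y)) by ring.
    field. lra.
Qed.

Lemma gR_le_FR' (y : R) : 0 < y -> gR y <= FR' y.
Proof.
  intros Hy. assert (Hs := sqrt_lt_R0 y Hy). unfold FR'.
  assert (H := chi2_bounds (c * (sqrt y - q))).
  assert (0 < / (c * sqrt y)) by (apply Rinv_0_lt_compat; nra). nra.
Qed.

Lemma gL_le_FL' (y : R) : 0 < y -> sqrt y < q -> gL y <= FL' y.
Proof.
  intros Hy Hq. assert (Hs := sqrt_lt_R0 y Hy). unfold FL'.
  assert (H := chi2_bounds (c * (sqrt y - q))).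
  assert (0 < / (c * sqrt y)) by (apply Rinv_0_lt_compat; nra).
  rewrite Rabs_left in H by nra.
  replace (-2 * - (c * (sqrt y - q))) with (- 2 * (c * (q - sqrt y))) in H by ring.
  nra.
Qed.

Lemma sinh_le (x y : R) : x <= y -> sinh x <= sinh y.
Proof.
  intros H. apply (derive_nonneg_le_closed sinh cosh); trivial.
  - intros z _. apply is_derive_Reals, derivable_pt_lim_sinh.
  - intros z _. apply Rlt_le, cosh_pos.
Qed.

Lemma sinh_cosh (x : R) : sinh x * cosh x = / 2 * sinh (2 * x).
Proof.
  unfold sinh, cosh. replace (2 * x) with (x + x) by ring.
  replace (- (x + x)) with (- x + - x) by ring. rewrite !exp_plus. field.
Qed.

Lemma gR'_decr (y z : R) : 0 < y -> q < sqrt y -> y <= z -> gR' z <= gR' y.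
Proof.
  intros Hy Hq Hyz. unfold gR'. rewrite !sinh_cosh.
  assert (Hs := sqrt_lt_R0 y Hy). assert (Hs2 := sqrt_le_1_alt y z Hyz).
  assert (0 < sinh (2 * (c * (sqrt y - q)))) by (apply sinh_pos; nra).
  assert (sinh (2 * (c * (sqrt y - q))) <= sinh (2 * (c * (sqrt z - q)))) by (apply sinh_le; nra).
  apply Rmult_le_compat_l; [lra|].
  apply Rinv_le_contravar; [nra|].
  apply Rmult_le_compat_l; [lra|]. apply Rmult_le_compat; lra.
Qed.

(** In [gL'_decr] the growth of [sinh] must outweigh that of the square root: for
    [d = 2 c (sqrt z - sqrt y)] the factor [1 + d] is at least [sqrt z / sqrt y] once
    [2 c sqrt y >= 1]. *)
Lemma sinh_add_ge (x d : R) : 0 <= x -> 0 <= d -> sinh x * (1 + d) <= sinh (x + d).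
Proof.
  intros Hx Hd. unfold sinh. rewrite Ropp_plus_distr, !exp_plus.
  assert (H1 := exp_ineq1_le d). 
  assert (H2 : exp (- d) <= 1) by (rewrite <- exp_0; destruct Hd as [Hd|Hd]; [left; apply exp_increasing; lra|right; f_equal; lra]).
  assert (H3 : exp (- x) <= exp x) by (destruct Hx as [Hx|Hx]; [left; apply exp_increasing; lra|right; f_equal; lra]).
  assert (H4 := exp_pos (- x)). nra.
Qed.

(* The threshold [1 <= 2 c sqrt y] is where [gL] becomes concave. *)
Lemma gL'_decr (y z : R) : 0 < y -> 1 <= 2 * c * sqrt y -> y <= z -> sqrt z < q ->
  gL' z <= gL' y.
Proof.
  intros Hy Hc Hyz Hq. unfold gL'. rewrite !sinh_cosh.
  assert (Hs := sqrt_lt_R0 y Hy). assert (Hs2 := sqrt_le_1_alt y z Hyz).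
  set (A := 2 * (c * (q - sqrt z))).
  assert (HA : 0 < A) by (unfold A; nra).
  replace (2 * (c * (q - sqrt y))) with (A + 2 * c * (sqrt z - sqrt y)) by (unfold A; ring).
  assert (H1 := sinh_add_ge A (2 * c * (sqrt z - sqrt y)) ltac:(lra) ltac:(nra)).
  assert (H2 := sinh_pos A HA).
  apply Ropp_le_contravar, Rmult_le_compat_l; [lra|].
  apply Rinv_le_contravar; [nra|].
  apply Rmult_le_compat_l; [lra|].
  cut (sqrt z * sinh A <= sqrt y * sinh (A + 2 * c * (sqrt z - sqrt y))); [nra|].
  apply Rle_trans with (sqrt y * (sinh A * (1 + 2 * c * (sqrt z - sqrt y)))); [|nra].
  assert (sqrt z <= sqrt y * (1 + 2 * c * (sqrt z - sqrt y))) by nra. nra.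
Qed.

Lemma trapezoid_gR (a b : R) : 0 < a -> a <= b -> q < sqrt a ->
  (b - a) / 2 * (gR a + gR b) <= FR b - FR a.
Proof.
  intros Ha Hab Hq.
  assert (Hm : forall y, a <= y -> 0 < y /\ q < sqrt y).
  { intros y Hy. assert (H := sqrt_le_1_alt a y Hy). lra. }
  apply (trapezoid FR FR' gR gR'); trivial.
  - intros y Hy. apply is_derive_FR; apply Hm; lra.
  - intros y Hy. apply gR_le_FR'. lra.
  - intros y Hy. apply is_derive_gR; apply Hm; lra.
  - intros y z H1 H2 H3. apply gR'_decr; try apply Hm; lra.
Qed.

Lemma trapezoid_gL (a b : R) : 0 < a -> a <= b -> 1 <= 2 * c * sqrt a -> sqrt b < q ->
  (b - a) / 2 * (gL a + gL b) <= FL b - FL a.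
Proof.
  intros Ha Hab Hc Hq.
  assert (Hm : forall y, a <= y <= b -> 0 < y /\ sqrt y < q /\ 1 <= 2 * c * sqrt y).
  { intros y Hy. assert (H := sqrt_le_1_alt y b (proj2 Hy)).
    assert (H1 := sqrt_le_1_alt a y (proj1 Hy)). repeat split; nra. }
  apply (trapezoid FL FL' gL gL'); trivial.
  - intros y Hy. apply is_derive_FL; apply Hm; lra.
  - intros y Hy. apply gL_le_FL'; apply Hm; lra.
  - intros y Hy. apply is_derive_gL; apply Hm; lra.
  - intros y z H1 H2 H3. apply gL'_decr; trivial; apply Hm; lra.
Qed.

Lemma continuity_pt_sqrt_chi2 (y : R) : 0 <= y ->
  continuity_pt (fun y => 2 / c * sqrt y * chi2 (c * (sqrt y - q))) y.
Proof.
  intros Hy.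
  assert (Hs : continuity_pt sqrt y) by now apply continuity_pt_sqrt.
  apply continuity_pt_mult.
  - now apply continuity_pt_scal.
  - apply (continuity_pt_comp (fun y => c * (sqrt y - q)) chi2); [|apply chi2_continuous].
    apply continuity_pt_scal, continuity_pt_minus; trivial.
    apply continuity_pt_const. intros u v. reflexivity.
Qed.

Lemma FR_continuity_pt (y : R) : 0 <= y -> continuity_pt FR y.
Proof. apply continuity_pt_sqrt_chi2. Qed.

Lemma FL_continuity_pt (y : R) : 0 <= y -> continuity_pt FL y.
Proof.
  intros Hy.
  assert (Hs : continuity_pt sqrt y) by now apply continuity_pt_sqrt.
  apply continuity_pt_plus.
  - apply continuity_pt_opp. now apply continuity_pt_sqrt_chi2.
  - apply continuity_pt_scal.
    apply (continuity_pt_comp (fun y => - 2 * (c * (q - sqrt y))) exp).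
    + do 2 apply continuity_pt_scal. apply continuity_pt_minus; trivial.
      apply continuity_pt_const. intros u v. reflexivity.
    + apply derivable_continuous_pt, derivable_pt_exp.
Qed.

End LogTanh.

(** * The cell of the integer grid that contains [s] *)

Definition log_tanh (c s y : R) : R := ln (tanh (c * Rabs (sqrt y - sqrt s))).

(** [|y - s| = |sqrt y - sqrt s| (sqrt y + sqrt s)], and the last factor lies between [sqrt s] and
    [3 sqrt s] because [y <= s + 1 <= 4 s]. *)
Lemma sqrt_diff_bounds (s y : R) : 1 <= s -> 0 <= y -> Rabs (y - s) <= 1 ->
  Rabs (y - s) / (3 * sqrt s) <= Rabs (sqrt y - sqrt s) <= Rabs (y - s) / sqrt s
  /\ Rabs (sqrt y - sqrt s) <= 1.
Proof.
  intros Hs Hy H.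
  assert (H1 : 1 <= sqrt s) by (rewrite <- sqrt_1; now apply sqrt_le_1_alt).
  assert (H2 := sqrt_pos y).
  assert (E : y - s = (sqrt y - sqrt s) * (sqrt y + sqrt s)).
  { rewrite <- (sqrt_sqrt y) at 1 by trivial. rewrite <- (sqrt_sqrt s) at 1 by lra. ring. }
  assert (E2 : Rabs (y - s) = Rabs (sqrt y - sqrt s) * (sqrt y + sqrt s)).
  { rewrite E, Rabs_mult. f_equal. apply Rabs_pos_eq. lra. }
  assert (H3 : sqrt y <= 2 * sqrt s).
  { replace (2 * sqrt s) with (sqrt (4 * s)).
    - apply sqrt_le_1_alt. apply Rabs_le_between in H. lra.
    - rewrite sqrt_mult by lra. f_equal. replace 4 with (2 * 2) by ring.
      apply sqrt_square. lra. }
  assert (H4 := Rabs_pos (sqrt y - sqrt s)).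
  set (v := Rabs (sqrt y - sqrt s)) in *.
  rewrite E2 in *.
  repeat split.
  - apply Rmult_le_reg_r with (3 * sqrt s); [lra|].
    unfold Rdiv. rewrite Rmult_assoc, Rinv_l by lra. nra.
  - apply Rmult_le_reg_r with (sqrt s); [lra|].
    unfold Rdiv. rewrite Rmult_assoc, Rinv_l by lra. nra.
  - nra.
Qed.

(** From [tanh x <= x]. A node within distance 1 of [s] thus contributes at most [ln (c / sqrt s)],
    the quantity that the integral over the cell has to match. *)
Lemma log_tanh_upper (c s y : R) : 0 < c -> 1 <= s -> 0 <= y -> y <> s ->
  Rabs (y - s) <= 1 -> log_tanh c s y <= ln (c / sqrt s).
Proof.
  intros Hc Hs Hy Hne H.
  destruct (sqrt_diff_bounds s y Hs Hy H) as [[H1 H2] H3].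
  assert (H4 : 1 <= sqrt s) by (rewrite <- sqrt_1; now apply sqrt_le_1_alt).
  assert (H5 : 0 < Rabs (y - s)) by (apply Rabs_pos_lt; lra).
  assert (H6 : 0 < Rabs (y - s) / (3 * sqrt s)) by (apply Rdiv_lt_0_compat; lra).
  unfold log_tanh. set (v := Rabs (sqrt y - sqrt s)) in *.
  apply ln_le; [apply tanh_pos; nra|].
  apply Rle_trans with (1 := tanh_le_x (c * v) ltac:(nra)).
  unfold Rdiv. apply Rmult_le_compat_l; [lra|].
  apply Rle_trans with (1 := H2). unfold Rdiv.
  nra.
Qed.

(** From [tanh x >= x / (1 + x)] with [x <= c]. The term [ln (c / sqrt s)] of the upper bound
    reappears up to a constant, next to an integrable singularity. *)
Lemma log_tanh_lower (c s y : R) : 0 < c -> 1 <= s -> 0 <= y -> y <> s ->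
  Rabs (y - s) <= 1 ->
  ln (c / (3 * (1 + c) * sqrt s)) + ln (Rabs (y - s)) <= log_tanh c s y.
Proof.
  intros Hc Hs Hy Hne H.
  destruct (sqrt_diff_bounds s y Hs Hy H) as [[H1 H2] H3].
  assert (H4 : 1 <= sqrt s) by (rewrite <- sqrt_1; now apply sqrt_le_1_alt).
  assert (H5 : 0 < Rabs (y - s)) by (apply Rabs_pos_lt; lra).
  assert (H6 : 0 < Rabs (y - s) / (3 * sqrt s)) by (apply Rdiv_lt_0_compat; lra).
  unfold log_tanh. set (v := Rabs (sqrt y - sqrt s)) in *.
  assert (H7 : 0 < c / (3 * (1 + c) * sqrt s)) by (apply Rdiv_lt_0_compat; nra).
  rewrite <- ln_mult by lra.
  apply ln_le; [nra|].
  apply Rle_trans with (2 := tanh_ge (c * v) ltac:(nra)).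
  apply Rle_trans with (c * v / (1 + c)).
  - replace (c / (3 * (1 + c) * sqrt s) * Rabs (y - s))
      with (c / (1 + c) * (Rabs (y - s) / (3 * sqrt s))) by (field; lra).
    replace (c * v / (1 + c)) with (c / (1 + c) * v) by (field; lra).
    apply Rmult_le_compat_l; trivial. apply Rlt_le, Rdiv_lt_0_compat; lra.
  - unfold Rdiv. apply Rmult_le_compat_l; [nra|].
    apply Rinv_le_contravar; nra.
Qed.

Lemma log_tanh_gR (c s y : R) : s <= y -> log_tanh c s y = gR c (sqrt s) y.
Proof.
  intros H. unfold log_tanh, gR. rewrite Rabs_pos_eq; trivial.
  assert (H1 := sqrt_le_1_alt s y H). lra.
Qed.

Lemma log_tanh_gL (c s y : R) : y <= s -> log_tanh c s y = gL c (sqrt s) y.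
Proof.
  intros H. unfold log_tanh, gL. rewrite Rabs_left1; [f_equal; f_equal; ring|].
  assert (H1 := sqrt_le_1_alt y s H). lra.
Qed.

Lemma log_tanh_le_0 (c s y : R) : log_tanh c s y <= 0.
Proof. apply ln_tanh_le_0. Qed.

(** This is [exp x >= 1 + x] at [x = - ln (sqrt v)]. *)
Lemma ln_ge_inv_sqrt (v : R) : 0 < v -> 2 - 2 / sqrt v <= ln v.
Proof.
  intros Hv. assert (Hs := sqrt_lt_R0 v Hv).
  rewrite <- (sqrt_sqrt v) at 2 by lra. rewrite ln_mult by trivial.
  assert (H := exp_ineq1_le (- ln (sqrt v))).
  rewrite exp_Ropp, exp_ln in H by trivial.
  unfold Rdiv. lra.
Qed.

(* [ln v >= 2 - 2 / sqrt v] replaces the logarithmic singularity at [s] by one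
   with the continuous primitive [2 v - 4 sqrt v]. *)
Lemma FL_cell (c s m : R) : 0 < c -> 1 <= s -> 0 < m -> s - 1 <= m <= s ->
  (s - m) * ln (c / (3 * (1 + c) * sqrt s)) - 4 * sqrt (s - m)
  <= FL c (sqrt s) s - FL c (sqrt s) m.
Proof.
  intros Hc Hs Hm0 Hm.
  set (k := ln (c / (3 * (1 + c) * sqrt s))).
  cut (FL c (sqrt s) m - (m * k + (2 * m + 4 * sqrt (s - m)))
    <= FL c (sqrt s) s - (s * k + (2 * s + 4 * sqrt (s - s)))).
  { rewrite Rminus_diag, sqrt_0. lra. }
  (* [sqrt (s - y)] is continuous but not differentiable at [y = s], so the derivative is only used
     in the open interval. *)
  apply (derive_nonneg_le
    (fun y => FL c (sqrt s) y - (y * k + (2 * y + 4 * sqrt (s - y))))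
    (fun y => FL' c (sqrt s) y - (k + (2 - 2 / sqrt (s - y))))); [lra| | |].
  - intros y Hy. apply continuity_pt_minus; [apply FL_continuity_pt; lra|].
    prove_continuity_pt.
  - intros y Hy.
    apply (is_derive_minus (FL c (sqrt s)) (fun y => y * k + (2 * y + 4 * sqrt (s - y)))).
    + apply is_derive_FL; trivial; [lra|]. apply sqrt_lt_1_alt. lra.
    + assert (0 < sqrt (s - y)) by (apply sqrt_lt_R0; lra).
      auto_derive; [lra|]. unfold Rminus in *. field. lra.
  - intros y Hy.
    assert (H1 := gL_le_FL' c (sqrt s) Hc y ltac:(lra) ltac:(apply sqrt_lt_1_alt; lra)).
    rewrite <- log_tanh_gL in H1 by lra.
    assert (H2 := log_tanh_lower c s y Hc Hs ltac:(lra) ltac:(lra)).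
    rewrite Rabs_left in H2 by lra. specialize (H2 ltac:(lra)).
    assert (H3 := ln_ge_inv_sqrt (s - y) ltac:(lra)).
    replace (- (y - s)) with (s - y) in H2 by ring. fold k in H2. lra.
Qed.

Lemma FR_cell (c s m : R) : 0 < c -> 1 <= s -> s <= m <= s + 1 ->
  (m - s) * ln (c / (3 * (1 + c) * sqrt s)) - 4 * sqrt (m - s)
  <= FR c (sqrt s) m - FR c (sqrt s) s.
Proof.
  intros Hc Hs Hm.
  set (k := ln (c / (3 * (1 + c) * sqrt s))).
  cut (FR c (sqrt s) s - (s * k + (2 * s - 4 * sqrt (s - s)))
    <= FR c (sqrt s) m - (m * k + (2 * m - 4 * sqrt (m - s)))).
  { rewrite Rminus_diag, sqrt_0. lra. }
  apply (derive_nonneg_le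
    (fun y => FR c (sqrt s) y - (y * k + (2 * y - 4 * sqrt (y - s))))
    (fun y => FR' c (sqrt s) y - (k + (2 - 2 / sqrt (y - s))))); [lra| | |].
  - intros y Hy. apply continuity_pt_minus; [apply FR_continuity_pt; lra|].
    prove_continuity_pt.
  - intros y Hy.
    apply (is_derive_minus (FR c (sqrt s)) (fun y => y * k + (2 * y - 4 * sqrt (y - s)))).
    + apply is_derive_FR; trivial; [lra|]. apply sqrt_lt_1_alt. lra.
    + assert (0 < sqrt (y - s)) by (apply sqrt_lt_R0; lra).
      auto_derive; [lra|]. unfold Rminus in *. field. lra.
  - intros y Hy.
    assert (H1 := gR_le_FR' c (sqrt s) Hc y ltac:(lra)).
    rewrite <- log_tanh_gR in H1 by lra.
    assert (H2 := log_tanh_lower c s y Hc Hs ltac:(lra) ltac:(lra)).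
    rewrite Rabs_pos_eq in H2 by lra. specialize (H2 ltac:(lra)).
    assert (H3 := ln_ge_inv_sqrt (y - s) ltac:(lra)).
    fold k in H2. lra.
Qed.

Lemma sqrt_le_one (x : R) : x <= 1 -> sqrt x <= 1.
Proof. intros H. rewrite <- sqrt_1. now apply sqrt_le_1_alt. Qed.

(** The two parts of the cell have lengths with sum 1, so their logarithms combine into one
    [ln (c / sqrt s)], which is what two nodes of weight 1/2 contribute at most. The 8 bounds the
    two [4 sqrt] terms. *)
Lemma cell_bound (c s m : R) : 0 < c -> 1 <= s -> 0 < m -> m <= s <= m + 1 ->
  ln (c / sqrt s) - (ln (3 * (1 + c)) + 8)
  <= FL c (sqrt s) s - FL c (sqrt s) m
     + (FR c (sqrt s) (m + 1) - FR c (sqrt s) s).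
Proof.
  intros Hc Hs Hm0 Hm.
  assert (H1 := FL_cell c s m Hc Hs Hm0 ltac:(lra)).
  assert (H2 := FR_cell c s (m + 1) Hc Hs ltac:(lra)).
  assert (H3 := sqrt_le_one (s - m) ltac:(lra)).
  assert (H4 := sqrt_le_one (m + 1 - s) ltac:(lra)).
  assert (H5 : 1 <= sqrt s) by (rewrite <- sqrt_1; now apply sqrt_le_1_alt).
  assert (E : ln (c / (3 * (1 + c) * sqrt s)) = ln (c / sqrt s) - ln (3 * (1 + c))).
  { replace (c / (3 * (1 + c) * sqrt s)) with (c / sqrt s / (3 * (1 + c))) by (field; lra).
    unfold Rdiv at 1. rewrite ln_mult, ln_Rinv; try lra.
    - apply Rdiv_lt_0_compat; lra.
    - apply Rinv_0_lt_compat; lra. }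
  rewrite E in *. lra.
Qed.

Lemma log_tanh_incr (c s y z : R) : 0 < c -> 0 <= s < y -> y <= z ->
  log_tanh c s y <= log_tanh c s z.
Proof.
  intros Hc Hy Hyz. unfold log_tanh.
  assert (H1 := sqrt_lt_1_alt s y Hy). assert (H2 := sqrt_le_1_alt y z Hyz).
  rewrite !Rabs_pos_eq by lra. apply ln_le.
  - apply tanh_pos. nra.
  - apply tanh_le. nra.
Qed.

Lemma sum_below_nonpos (u : nat -> R) (n : nat) : (forall k, u k <= 0) -> sum_below u n <= 0.
Proof. intros H. induction n as [|n IH]; simpl; [lra|]. specialize (H n). lra. Qed.

Lemma nat_between (s : R) : 0 < s -> exists m : nat, INR m < s <= INR m + 1.
Proof.
  intros Hs. destruct (nfloor_ex s ltac:(lra)) as [n Hn].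
  destruct (Req_dec (INR n) s) as [E|E].
  - destruct n as [|n]; [simpl in E; lra|]. exists n. rewrite S_INR in E. lra.
  - exists n. lra.
Qed.

(** With [e = N_0 - 1] this is the use of the sampling point at [N_0 - 1/2]. Two trapezoids of width
    1/2 have weights 1/4, 1/2, 1/4; monotonicity moves the last one to [e], and the nonpositive
    value in the middle may be counted with weight 1. *)
Lemma right_end (c s e : R) : 0 < c -> 0 <= s < e ->
  / 2 * log_tanh c s e + log_tanh c s (e + / 2)
  <= FR c (sqrt s) (e + 1) - FR c (sqrt s) e.
Proof.
  intros Hc Hs.
  assert (Hq : sqrt s < sqrt e) by (apply sqrt_lt_1_alt; lra).
  assert (Hq2 : sqrt s < sqrt (e + / 2)) by (apply sqrt_lt_1_alt; lra).
  assert (T1 := trapezoid_gR c (sqrt s) Hc e (e + / 2) ltac:(lra) ltac:(lra) Hq).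
  assert (T2 := trapezoid_gR c (sqrt s) Hc (e + / 2) (e + 1) ltac:(lra) ltac:(lra) Hq2).
  rewrite <- !log_tanh_gR in T1, T2 by lra.
  assert (H1 := log_tanh_incr c s e (e + 1) Hc ltac:(lra) ltac:(lra)).
  assert (H2 := log_tanh_le_0 c s (e + / 2)).
  lra.
Qed.

(** The trapezoidal rule covers the nodes from [K0] to the one below [s] and those above [s],
    [cell_bound] the gap. The primitives telescope to [FL s - FR s + FR n - FL K0]: the difference
    at [s] is the main term, [FR n] stands for what is lost beyond [n]. *)
Lemma nodes_sum_bound (c : R) : 0 < c -> exists K : R, forall (n : nat) (s : R),
  0 <= s <= INR n -> (0 < n)%nat ->
  (forall k : nat, (k < n)%nat -> INR k <> s) -> s <> INR n - / 2 ->
  sum_below (fun k => log_tanh c s (INR k)) n + log_tanh c s (INR n - / 2)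
  <= K - PI ^ 2 / (2 * c) * sqrt s + FR c (sqrt s) (INR n).
Proof.
  intros Hc. assert (HP := PI_RGT_0).
  (* From [K0] on, [gL] is concave; the earlier terms are nonpositive and are dropped. *)
  destruct (INR_unbounded (/ (2 * c) ^ 2)) as [K1 HK1].
  set (K0 := S K1).
  assert (HK0 : 1 <= 2 * c * sqrt (INR K0)).
  { apply Rle_trans with (2 * c * sqrt ((/ (2 * c)) ^ 2)).
    - rewrite sqrt_pow2; [right; field; lra|].
      apply Rlt_le, Rinv_0_lt_compat; lra.
    - apply Rmult_le_compat_l; [lra|]. apply sqrt_le_1_alt.
      unfold K0. rewrite S_INR, pow_inv. lra. }
  (* For [s > S0] the node below [s] is at least [K0], and [c <= sqrt s], so that
     [ln (c / sqrt s) <= 0]. For [s <= S0] the main term is at most the constant [K2]. *)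
  set (S0 := INR K0 + 1 + c ^ 2).
  assert (HK0' : 1 <= INR K0) by (apply (le_INR 1); unfold K0; lia).
  set (K2 := PI ^ 2 / (2 * c) * sqrt S0).
  set (K3 := PI ^ 2 / (8 * c ^ 2) + 2 / c * sqrt (INR K0) * (PI ^ 2 / 8)
    + (ln (3 * (1 + c)) + 8)).
  exists (Rmax K2 K3). intros n s Hs Hn Hne Hne2.
  assert (HFR : 0 <= FR c (sqrt s) (INR n)).
  { unfold FR. assert (H := chi2_bounds (c * (sqrt (INR n) - sqrt s))).
    assert (H1 := sqrt_pos (INR n)).
    assert (0 < / c) by now apply Rinv_0_lt_compat.
    apply Rmult_le_pos; [|lra]. apply Rmult_le_pos; trivial. unfold Rdiv. lra. }
  destruct (Rle_lt_dec s S0) as [Hs0|Hs0].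
  { assert (H1 := sum_below_nonpos (fun k => log_tanh c s (INR k)) n
      (fun k => log_tanh_le_0 c s (INR k))).
    assert (H2 := log_tanh_le_0 c s (INR n - / 2)).
    assert (H3 : PI ^ 2 / (2 * c) * sqrt s <= K2).
    { apply Rmult_le_compat_l; [|now apply sqrt_le_1_alt].
      apply Rlt_le, Rdiv_lt_0_compat; nra. }
    assert (H4 := Rmax_l K2 K3). lra. }
  assert (Hs1 : 1 <= s) by (unfold S0 in Hs0; nra).
  assert (Hs2 : c <= sqrt s).
  { rewrite <- (sqrt_pow2 c) by lra. apply sqrt_le_1_alt. unfold S0 in Hs0. lra. }
  destruct (nat_between s ltac:(lra)) as [m Hm].
  assert (HmK : (K0 <= m)%nat).
  { apply INR_le. unfold S0 in Hs0. assert (0 <= c ^ 2) by apply pow2_ge_0. lra. }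
  assert (Hmn : (m < n)%nat) by (apply INR_lt; lra).
  assert (HmK' := le_INR _ _ HmK).
  assert (Hsplit : sum_below (fun k => log_tanh c s (INR k)) n
    = sum_below (fun k => log_tanh c s (INR k)) K0
      + sum_below (fun j => log_tanh c s (INR (K0 + j))) (S (m - K0))
      + sum_below (fun j => log_tanh c s (INR (S m + j))) (n - S m)).
  { replace n with (S m + (n - S m))%nat at 1 by lia. rewrite sum_below_add. f_equal.
    replace (S m) with (K0 + S (m - K0))%nat at 1 by lia. apply sum_below_add. }
  assert (HL : sum_below (fun j => log_tanh c s (INR (K0 + j))) (S (m - K0))
    <= / 2 * log_tanh c s (INR m) + FL c (sqrt s) (INR m) - FL c (sqrt s) (INR K0)).
  { assert (T := trapezoid_sum (FL c (sqrt s)) (log_tanh c s) K0 (m - K0)).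
    replace (K0 + (m - K0))%nat with m in T by lia.
    assert (H0 := log_tanh_le_0 c s (INR K0)).
    refine (Rle_trans _ _ _ (T _) _); [|lra].
    intros k Hk. assert (Hk1 := le_INR K0 k ltac:(lia)).
    assert (Hk2 := le_INR (S k) m ltac:(lia)). rewrite S_INR in *.
    assert (Hk3 := sqrt_le_1_alt (INR K0) (INR k) Hk1).
    rewrite !log_tanh_gL by lra.
    assert (T2 := trapezoid_gL c (sqrt s) Hc (INR k) (INR k + 1) ltac:(lra) ltac:(lra) ltac:(nra)
      ltac:(apply sqrt_lt_1_alt; lra)). lra. }
  assert (Hu1 : log_tanh c s (INR m) <= ln (c / sqrt s)).
  { apply log_tanh_upper; try lra. rewrite Rabs_left; lra. }
  assert (Hl0 : ln (c / sqrt s) <= 0).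
  { apply ln_le_0. apply Rmult_le_reg_r with (sqrt s); [lra|].
    unfold Rdiv. rewrite Rmult_assoc, Rinv_l by lra. lra. }
  assert (HC := cell_bound c s (INR m) Hc Hs1 ltac:(lra) ltac:(lra)).
  assert (HFLK : - (2 / c * sqrt (INR K0) * (PI ^ 2 / 8)) <= FL c (sqrt s) (INR K0)).
  { unfold FL. assert (H := chi2_le (c * (sqrt (INR K0) - sqrt s))).
    assert (0 < 2 / c) by (apply Rdiv_lt_0_compat; lra).
    assert (H2 : 0 < PI ^ 2 / (8 * c ^ 2)) by (apply Rdiv_lt_0_compat; nra).
    assert (H3 := exp_pos (-2 * (c * (sqrt s - sqrt (INR K0))))).
    assert (0 <= PI ^ 2 / (8 * c ^ 2) * exp (-2 * (c * (sqrt s - sqrt (INR K0))))) by nra.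
    assert (2 / c * sqrt (INR K0) * chi2 (c * (sqrt (INR K0) - sqrt s))
      <= 2 / c * sqrt (INR K0) * (PI ^ 2 / 8)).
    { apply Rmult_le_compat_l; trivial. nra. }
    lra. }
  (* The two primitives contain [chi2 0 = pi^2/8] with opposite signs, so the difference doubles
     it. *)
  assert (HFs : FL c (sqrt s) s - FR c (sqrt s) s
    = PI ^ 2 / (8 * c ^ 2) - PI ^ 2 / (2 * c) * sqrt s).
  { unfold FL, FR. rewrite Rminus_diag, Rmult_0_r, Rmult_0_r, exp_0, chi2_0. field. lra. }
  assert (HS0 := sum_below_nonpos (fun k => log_tanh c s (INR k)) K0
      (fun k => log_tanh_le_0 c s (INR k))).
  assert (HM := Rmax_r K2 K3). unfold K3 in HM at 1.
  rewrite Hsplit.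
  (* If [s] lies in the last cell there is no node above it, and the point [n - 1/2] replaces it;
     weight 1 instead of 1/2 is harmless because [ln (c / sqrt s) <= 0]. *)
  destruct (Nat.eq_dec (S m) n) as [En|En].
  - replace (n - S m)%nat with 0%nat by lia. simpl (sum_below _ 0).
    assert (EI : INR n = INR m + 1) by (rewrite <- En; apply S_INR).
    rewrite EI in *.
    assert (Hu2 : log_tanh c s (INR m + 1 - / 2) <= ln (c / sqrt s)).
    { apply log_tanh_upper; try lra. apply Rabs_le; lra. }
    lra.
  - assert (Hsm : s < INR m + 1).
    { assert (H := Hne (S m) ltac:(lia)). rewrite S_INR in H. lra. }
    assert (Hu2 : log_tanh c s (INR m + 1) <= ln (c / sqrt s)).
    { apply log_tanh_upper; try lra. rewrite Rabs_pos_eq; lra. }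
    assert (HR := trapezoid_sum (FR c (sqrt s)) (log_tanh c s) (S m) (n - S m - 1)).
    replace (S (n - S m - 1)) with (n - S m)%nat in HR by lia.
    replace (S m + (n - S m - 1))%nat with (n - 1)%nat in HR by lia.
    assert (En1 : INR (n - 1) = INR n - 1) by (rewrite minus_INR by lia; reflexivity).
    assert (Hmn2 := le_INR (S m) (n - 1) ltac:(lia)).
    rewrite S_INR in *.
    assert (HE := right_end c s (INR n - 1) Hc ltac:(lra)).
    replace (INR n - 1 + / 2) with (INR n - / 2) in HE by field.
    replace (INR n - 1 + 1) with (INR n) in HE by ring.
    assert (HR' : sum_below (fun j : nat => log_tanh c s (INR (S m + j))) (n - S m) <=
     / 2 * log_tanh c s (INR m + 1) + / 2 * log_tanh c s (INR (n - 1)) +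
     FR c (sqrt s) (INR (n - 1)) - FR c (sqrt s) (INR m + 1)).
    { apply HR. intros k Hk. assert (Hk1 := le_INR (S m) k ltac:(lia)).
      rewrite S_INR in *. rewrite !log_tanh_gR by lra.
      assert (T := trapezoid_gR c (sqrt s) Hc (INR k) (INR k + 1) ltac:(lra) ltac:(lra)
        ltac:(apply sqrt_lt_1_alt; lra)). lra. }
    rewrite En1 in *. lra.
Qed.

(** * The Ganelius product *)

Fixpoint prod_below (u : nat -> R) (n : nat) : R :=
  match n with O => 1 | S m => prod_below u m * u m end.

Lemma prod_below_range (u : nat -> R) (n : nat) :
  (forall k, (k < n)%nat -> 0 <= u k <= 1) -> 0 <= prod_below u n <= 1.
Proof.
  induction n as [|n IH]; simpl; intros H; [lra|].
  assert (H1 := IH ltac:(auto with arith)). assert (H2 := H n ltac:(lia)). nra.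
Qed.

Lemma prod_below_zero (u : nat -> R) (n k : nat) :
  (k < n)%nat -> u k = 0 -> prod_below u n = 0.
Proof.
  induction n as [|n IH]; simpl; intros H E; [lia|].
  destruct (Nat.eq_dec k n) as [->|Hk]; [rewrite E; ring|].
  rewrite IH; trivial; [ring|lia].
Qed.

Lemma prod_below_exp (u : nat -> R) (n : nat) : (forall k, (k < n)%nat -> 0 < u k) ->
  prod_below u n = exp (sum_below (fun k => ln (u k)) n).
Proof.
  induction n as [|n IH]; simpl; intros H; [now rewrite exp_0|].
  rewrite IH, exp_plus, exp_ln; auto with arith.
Qed.

Definition ratio (a t : R) : R := Rabs (a - t) / (a + t).

Lemma ratio_range (a t : R) : 0 < a -> 0 < t -> 0 <= ratio a t <= 1.
Proof.
  intros Ha Ht. unfold ratio. split.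
  - apply Rmult_le_pos; [apply Rabs_pos|]. apply Rlt_le, Rinv_0_lt_compat. lra.
  - apply Rmult_le_reg_r with (a + t); [lra|].
    unfold Rdiv. rewrite Rmult_assoc, Rinv_l by lra.
    rewrite Rmult_1_l, Rmult_1_r. apply Rabs_le. lra.
Qed.

Lemma ratio_exp (A B : R) : ratio (exp (2 * A)) (exp (2 * B)) = tanh (Rabs (A - B)).
Proof.
  unfold ratio.
  assert (H : forall x y, y <= x ->
    (exp (2 * x) - exp (2 * y)) / (exp (2 * x) + exp (2 * y)) = tanh (x - y)).
  { intros x y Hxy. rewrite tanh_exp.
    replace (2 * x) with (2 * (x - y) + 2 * y) by ring. rewrite exp_plus.
    assert (H1 := exp_pos (2 * (x - y))). assert (H2 := exp_pos (2 * y)).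
    field. split; nra. }
  destruct (Rle_lt_dec B A) as [HAB|HAB].
  - assert (exp (2 * B) <= exp (2 * A)).
    { destruct HAB as [HAB|HAB]; [left; apply exp_increasing; lra|right; now rewrite HAB]. }
    rewrite !Rabs_pos_eq by lra. now apply H.
  - assert (exp (2 * A) < exp (2 * B)) by (apply exp_increasing; lra).
    rewrite !Rabs_left by lra.
    replace (- (A - B)) with (B - A) by ring. rewrite <- H by lra.
    f_equal; ring.
Qed.

(** Origin of [c = pi / (2 sqrt r)]: through [ratio_exp], the Ganelius factor of two values of [phi]
    becomes [tanh (c |sqrt x - sqrt s|)]. *)
Lemma phi_exp (r x : R) : 0 < r -> 0 <= x ->
  phi r x = exp (2 * (PI / (2 * sqrt r) * sqrt x)).
Proof.
  intros Hr Hx. unfold phi. f_equal. assert (H := sqrt_lt_R0 r Hr).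
  rewrite sqrt_div by trivial. field. lra.
Qed.

Lemma exp_2_le_9 : exp 2 <= 9.
Proof.
  replace 2 with (1 + 1) by ring. rewrite exp_plus.
  assert (H := exp_le_3). assert (H1 := exp_pos 1). nra.
Qed.

Lemma exp_le (x y : R) : x <= y -> exp x <= exp y.
Proof. intros [H|H]; [left; now apply exp_increasing|right; now rewrite H]. Qed.

(** Let [t = exp(-2y)]. If [t >= 4/5], the ratio is at most [(1 - 4/5)/(1 + 4/5) = 1/9 <= exp(-2)],
    while [chi2 <= pi^2/8] makes the right side at least -2. If [t < 4/5], replacing [a] by 1 gives
    [tanh y], and [ln (tanh y) <= -2 chi2 y] with [16/pi^2 <= 2]. A zero ratio is excluded since
    [ln 0 = 0]. *)
Lemma ln_ratio_extra (a y : R) : 4 / 5 <= a <= 1 -> 0 <= y -> ratio a (exp (- 2 * y)) <> 0 ->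
  ln (ratio a (exp (- 2 * y))) <= - (16 / PI ^ 2 * chi2 y).
Proof.
  intros Ha Hy Hne.
  assert (Ht : 0 < exp (- 2 * y) <= 1).
  { split; [apply exp_pos|]. rewrite <- exp_0. apply exp_le. lra. }
  assert (HP2 : 3 < PI) by (assert (H := PI2_3_2); lra).
  assert (Hr := ratio_range a (exp (- 2 * y)) ltac:(lra) ltac:(lra)).
  assert (HX := chi2_le y). assert (HX0 := proj1 (chi2_bounds y)).
  assert (Hc : 0 < 16 / PI ^ 2) by (apply Rdiv_lt_0_compat; nra).
  destruct (Rle_lt_dec (4 / 5) (exp (- 2 * y))) as [Hc1|Hc1].
  - assert (H1 : ratio a (exp (-2 * y)) <= / exp 2).
    { apply Rle_trans with (/ 9); [|apply Rinv_le_contravar; [apply exp_pos|apply exp_2_le_9]].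
      unfold ratio. apply Rmult_le_reg_r with (a + exp (- 2 * y)); [lra|].
      unfold Rdiv. rewrite Rmult_assoc, Rinv_l by lra.
      rewrite Rmult_1_r. apply Rabs_le. lra. }
    apply Rle_trans with (ln (/ exp 2)); [apply ln_le; lra|].
    rewrite ln_Rinv, ln_exp by apply exp_pos.
    assert (16 / PI ^ 2 * chi2 y <= 16 / PI ^ 2 * (PI ^ 2 / 8)) by (apply Rmult_le_compat_l; lra).
    replace (16 / PI ^ 2 * (PI ^ 2 / 8)) with 2 in * by (field; lra). lra.
  - assert (Hy0 : 0 < y).
    { destruct Hy as [Hy|Hy]; trivial. subst y. rewrite Rmult_0_r, exp_0 in Hc1. lra. }
    assert (HL := chi2_le_ln_tanh y Hy0).
    apply Rle_trans with (ln (tanh y)).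
    + apply ln_le; [lra|]. rewrite tanh_exp. unfold ratio.
      rewrite Rabs_pos_eq by lra.
      replace (-2 * y) with (- (2 * y)) in * by ring. rewrite exp_Ropp in *.
      set (E := exp (2 * y)) in *.
      assert (HE : 1 < E).
      { unfold E. rewrite <- exp_0. apply exp_increasing. lra. }
      replace ((E - 1) / (E + 1)) with ((1 - / E) / (1 + / E)) by (field; lra).
      apply Rmult_le_reg_r with ((a + / E) * (1 + / E)); [nra|].
      replace ((a - / E) / (a + / E) * ((a + / E) * (1 + / E))) with ((a - / E) * (1 + / E)) by (field; split; nra).
      replace ((1 - / E) / (1 + / E) * ((a + / E) * (1 + / E))) with ((1 - / E) * (a + / E)) by (field; split; nra).
      nra.
    + assert (16 / PI ^ 2 * chi2 y <= 2 * chi2 y); [|lra].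
      apply Rmult_le_compat_r; trivial.
      apply Rmult_le_reg_r with (PI ^ 2); [nra|].
      unfold Rdiv. rewrite Rmult_assoc, Rinv_l by nra. nra.
Qed.

Lemma N0_bounds (r : R) (N : nat) : 0 < r -> (0 < N)%nat ->
  (N0 r N < Z.of_nat N)%Z /\
  PI / 4 * sqrt (INR N * r) <= INR N - IZR (N0 r N) < PI / 4 * sqrt (INR N * r) + 1.
Proof.
  intros Hr HN. assert (HP := PI_RGT_0).
  assert (HN' := lt_0_INR N HN).
  assert (Hpos : 0 < PI / 4 * sqrt (INR N * r)).
  { apply Rmult_lt_0_compat; [lra|]. apply sqrt_lt_R0. nra. }
  unfold N0. set (y := PI / 4 * sqrt (INR N * r)) in *.
  assert (Hy := Zceil_bound y).
  rewrite minus_IZR, <- INR_IZR_INZ.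
  split; [|lra].
  assert (0 < Zceil y)%Z by (apply lt_IZR; lra). lia.
Qed.

(** The shift to indices from 0 makes [j] itself the argument of [phi] at the low points. *)
Definition node_a (r : R) (N j : nat) : R := ganelius r N (Z.of_nat (S j)).

Lemma phi_pos (r x : R) : 0 < phi r x.
Proof. apply exp_pos. Qed.

Lemma phi_lt (r x y : R) : 0 < r -> 0 <= x < y -> phi r x < phi r y.
Proof.
  intros Hr H. unfold phi. apply exp_increasing. apply Rmult_lt_compat_l; [apply PI_RGT_0|].
  assert (Hi := Rinv_0_lt_compat r Hr).
  apply sqrt_lt_1_alt. unfold Rdiv. nra.
Qed.

Lemma node_a_low (r : R) (N n j : nat) : N0 r N = Z.of_nat n -> (j < n)%nat ->
  node_a r N j = phi r (INR j) / phi r (INR n).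
Proof.
  intros E Hj. unfold node_a, ganelius. rewrite E.
  replace (Z.of_nat (S j) <=? Z.of_nat n)%Z with true by (symmetry; apply Z.leb_le; lia).
  replace (Z.of_nat (S j) - 1)%Z with (Z.of_nat j) by lia.
  now rewrite <- !INR_IZR_INZ.
Qed.

Lemma node_a_mid (r : R) (N n : nat) : N0 r N = Z.of_nat n ->
  node_a r N n = phi r (INR n - / 2) / phi r (INR n).
Proof.
  intros E. unfold node_a, ganelius. rewrite E.
  replace (Z.of_nat (S n) <=? Z.of_nat n)%Z with false by (symmetry; apply Z.leb_gt; lia).
  replace (Z.of_nat (S n) =? Z.of_nat n + 1)%Z with true by (symmetry; apply Z.eqb_eq; lia).
  now rewrite <- !INR_IZR_INZ.
Qed.

Lemma node_a_high (r : R) (N n j : nat) : N0 r N = Z.of_nat n -> (n < j < N)%nat ->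
  4 / 5 <= node_a r N j < 1.
Proof.
  intros E Hj. unfold node_a, ganelius. rewrite E.
  replace (Z.of_nat (S j) <=? Z.of_nat n)%Z with false by (symmetry; apply Z.leb_gt; lia).
  replace (Z.of_nat (S j) =? Z.of_nat n + 1)%Z with false by (symmetry; apply Z.eqb_neq; lia).
  set (p := (Z.of_nat (S j) - Z.of_nat n - 1)%Z).
  set (m := (Z.of_nat N - Z.of_nat n - 1)%Z).
  assert (H1 : 1 <= IZR p) by (apply IZR_le; unfold p; lia).
  assert (H2 : IZR p <= IZR m) by (apply IZR_le; unfold p, m; lia).
  assert (H3 : 0 < IZR p / (5 * IZR m)) by (apply Rdiv_lt_0_compat; lra).
  assert (H4 : IZR p / (5 * IZR m) <= 1 / 5).
  { apply Rmult_le_reg_r with (5 * IZR m); [lra|].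
    unfold Rdiv at 1. rewrite Rmult_assoc, Rinv_l by lra. lra. }
  lra.
Qed.

Lemma node_a_range (r : R) (N n j : nat) : 0 < r -> N0 r N = Z.of_nat n -> (0 < n)%nat ->
  (j < N)%nat -> 0 < node_a r N j < 1.
Proof.
  intros Hr E Hn Hj.
  assert (Hq : forall x, 0 <= x < INR n -> 0 < phi r x / phi r (INR n) < 1).
  { intros x Hx. assert (H := phi_lt r x (INR n) Hr Hx). assert (H1 := phi_pos r x).
    split; [apply Rdiv_lt_0_compat; lra|].
    apply Rmult_lt_reg_r with (phi r (INR n)); [lra|].
    unfold Rdiv. rewrite Rmult_assoc, Rinv_l by lra. lra. }
  assert (H1 := le_INR 1 n Hn). simpl in H1.
  destruct (Nat.lt_trichotomy j n) as [H|[H|H]].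
  - rewrite (node_a_low r N n) by trivial. apply Hq. split; [apply pos_INR|now apply lt_INR].
  - subst j. rewrite (node_a_mid r N n) by trivial. apply Hq. lra.
  - assert (H2 := node_a_high r N n j E ltac:(lia)). lra.
Qed.

(** With [x = sqrt N >= 1], [y = sqrt N_0] and [D] the subtracted constant,
    [(x - y)(x + y) = N - N_0 < x D]. Hence replacing [N_0] by [N] in the exponential rate costs a
    constant factor only. *)
Lemma sqrt_N0_lower (r : R) (N n : nat) : 0 < r -> (0 < N)%nat -> N0 r N = Z.of_nat n ->
  sqrt (INR N) - (PI / 4 * sqrt r + 1) <= sqrt (INR n).
Proof.
  intros Hr HN E. destruct (N0_bounds r N Hr HN) as [HlN [_ Hu]].
  rewrite E, <- INR_IZR_INZ in Hu.
  assert (H1 := le_INR 1 N HN). simpl in H1.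
  rewrite sqrt_mult in Hu by lra.
  assert (HN1 : 1 <= sqrt (INR N)) by (rewrite <- sqrt_1; now apply sqrt_le_1_alt).
  assert (Hn0 := sqrt_pos (INR n)).
  assert (S1 := sqrt_sqrt (INR N) ltac:(lra)).
  assert (S2 := sqrt_sqrt (INR n) (pos_INR n)).
  assert (HP := PI_RGT_0). assert (Hr0 := sqrt_pos r).
  set (x := sqrt (INR N)) in *. set (y := sqrt (INR n)) in *.
  set (D := PI / 4 * sqrt r + 1) in *.
  assert (H2 : (x - y) * (x + y) < x * D).
  { replace ((x - y) * (x + y)) with (INR N - INR n) by (rewrite <- S1, <- S2; ring).
    unfold D. lra. }
  assert (HD : 0 < D) by (unfold D; nra).
  apply Rnot_lt_le. intros H3.
  assert (H4 : D * x < (x - y) * x) by (apply Rmult_lt_compat_r; lra).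
  assert (H5 : 0 <= (x - y) * y) by (apply Rmult_le_pos; lra). lra.
Qed.

Lemma ganelius_bound (r : R) : 0 < r -> exists K, 0 < K /\
  forall N : nat, (0 < N)%nat -> (1 <= N0 r N)%Z -> forall t, 0 < t <= 1 ->
  Rpower t r * prod_below (fun j => ratio (node_a r N j) t) N
  <= K * exp (- (PI * sqrt (r * INR N))).
Proof.
  intros Hr. assert (HP := PI_RGT_0). assert (Hsr := sqrt_lt_R0 r Hr).
  assert (Esr := sqrt_sqrt r ltac:(lra)).
  set (c := PI / (2 * sqrt r)).
  assert (Hc : 0 < c) by (apply Rdiv_lt_0_compat; lra).
  destruct (nodes_sum_bound c Hc) as [K HK].
  set (d := PI * sqrt r * (PI / 4 * sqrt r + 1)).
  (* [K] comes from the trapezoidal rule, 2 from a deficit of one point among those in [[4/5, 1)],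
     and [d] from passing from [sqrt N_0] to [sqrt N]. [Rmax 0] serves the case in which the product
     is only bounded by 1. *)
  exists (exp (Rmax 0 K + 2 + d)). split; [apply exp_pos|].
  intros N HN HN0 t Ht.
  destruct (N0_bounds r N Hr HN) as [HlN [Hl _]].
  set (n := Z.to_nat (N0 r N)).
  assert (En : N0 r N = Z.of_nat n) by (unfold n; lia).
  assert (Hn : (0 < n)%nat) by lia.
  assert (Ha : forall j, (j < N)%nat -> 0 < node_a r N j < 1)
    by (intros j Hj; now apply (node_a_range r N n)).
  assert (Hd := sqrt_N0_lower r N n Hr HN En).
  rewrite En, <- INR_IZR_INZ in Hl.
  set (P := prod_below (fun j => ratio (node_a r N j) t) N).
  assert (HP01 : 0 <= P <= 1).
  { apply prod_below_range. intros k Hk. specialize (Ha k Hk). apply ratio_range; lra. }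
  assert (HNr : sqrt (r * INR N) = sqrt r * sqrt (INR N)) by (apply sqrt_mult; [lra|apply pos_INR]).
  assert (Hrate : - (PI * sqrt r * sqrt (INR n)) <= d - PI * sqrt (r * INR N)).
  { rewrite HNr. unfold d.
    assert (H : 0 <= PI * sqrt r) by nra.
    apply (Rmult_le_compat_l _ _ _ H) in Hd. lra. }
  assert (HK0 := Rmax_l 0 K). assert (HKK := Rmax_r 0 K).
  rewrite <- exp_plus. unfold Rpower.
  assert (Hlt : ln t <= 0) by (apply ln_le_0; lra).
  assert (E2c : PI / sqrt r = 2 * c) by (unfold c; field; lra).
  assert (Er2c : r * (2 * c) = PI * sqrt r).
  { rewrite <- E2c. rewrite <- Esr at 1. field. lra. }
  (* Below all sampling points, that is for [t < 1 / phi(N_0)], the factor [t^r] alone is small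
     enough because [2 c r = pi sqrt r]. *)
  destruct (Rlt_le_dec (ln t) (- (2 * c * sqrt (INR n)))) as [Hsmall|Hbig].
  { apply Rle_trans with (exp (r * ln t) * 1).
    - apply Rmult_le_compat_l; [apply Rlt_le, exp_pos|lra].
    - rewrite Rmult_1_r. apply exp_le.
      apply (Rmult_lt_compat_l r) in Hsmall; trivial.
      replace (r * - (2 * c * sqrt (INR n))) with (- (r * (2 * c) * sqrt (INR n))) in Hsmall by ring.
      rewrite Er2c in Hsmall. lra. }
  (* [w] is the square root of the solution [s] of [t = phi(s) / phi(N_0)]. *)
  set (w := sqrt (INR n) + ln t / (2 * c)).
  assert (Hw : 0 <= w <= sqrt (INR n)).
  { unfold w. split.
    - apply Rmult_le_reg_r with (2 * c); [lra|]. rewrite Rmult_plus_distr_r.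
      unfold Rdiv. rewrite Rmult_assoc, Rinv_l by lra. lra.
    - assert (ln t / (2 * c) <= 0); [|lra].
      apply Rmult_le_reg_r with (2 * c); [lra|].
      unfold Rdiv. rewrite Rmult_assoc, Rinv_l by lra. lra. }
  set (s := w ^ 2).
  assert (Hsw : sqrt s = w) by (apply sqrt_pow2; lra).
  assert (Hlnt : ln t = 2 * (c * w) - 2 * (c * sqrt (INR n))) by (unfold w; field; lra).
  assert (Hs : 0 <= s <= INR n).
  { unfold s. split; [apply pow2_ge_0|].
    rewrite <- (sqrt_sqrt (INR n)) by apply pos_INR. nra. }
  set (y0 := c * (sqrt (INR n) - w)).
  assert (Hy0 : 0 <= y0) by (unfold y0; nra).
  assert (Ety0 : t = exp (- 2 * y0)).
  { rewrite <- (exp_ln t) by lra. f_equal. rewrite Hlnt. unfold y0. ring. }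
  assert (Etphi : t = exp (2 * (c * w)) / phi r (INR n)).
  { rewrite <- (exp_ln t) by lra. rewrite Hlnt, phi_exp by (trivial || apply pos_INR).
    fold c. unfold Rminus. rewrite exp_plus, exp_Ropp. reflexivity. }
  assert (Hphi := phi_pos r (INR n)).
  assert (Hratio : forall x, 0 <= x ->
    ratio (phi r x / phi r (INR n)) t = tanh (c * Rabs (sqrt x - sqrt s))).
  { intros x Hx. rewrite Hsw.
    transitivity (ratio (exp (2 * (c * sqrt x))) (exp (2 * (c * w)))).
    - rewrite Etphi. rewrite (phi_exp r x) by trivial. fold c. unfold ratio.
      assert (H1 := exp_pos (2 * (c * sqrt x))). assert (H2 := exp_pos (2 * (c * w))).
      replace (exp (2 * (c * sqrt x)) / phi r (INR n) - exp (2 * (c * w)) / phi r (INR n))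
        with ((exp (2 * (c * sqrt x)) - exp (2 * (c * w))) * / phi r (INR n)) by (field; lra).
      rewrite Rabs_mult, (Rabs_pos_eq (/ phi r (INR n))) by (apply Rlt_le, Rinv_0_lt_compat; lra).
      field. split; lra.
    - rewrite ratio_exp. f_equal.
      replace (c * sqrt x - c * w) with (c * (sqrt x - w)) by ring.
      rewrite Rabs_mult, Rabs_pos_eq by lra. reflexivity. }
  assert (Htarget : 0 <= exp (Rmax 0 K + 2 + d + - (PI * sqrt (r * INR N)))) by (apply Rlt_le, exp_pos).
  (* A vanishing factor makes the product 0; it is split off because [ln 0 = 0] would falsify the
     passage to sums of logarithms. *)
  destruct (Classical_Prop.classic (exists j, (j < N)%nat /\ ratio (node_a r N j) t = 0))
    as [[j [Hj Ej]]|Hnz].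
  { unfold P. rewrite (prod_below_zero _ N j) by trivial. lra. }
  assert (Hpos : forall j, (j < N)%nat -> 0 < ratio (node_a r N j) t).
  { intros j Hj. specialize (Ha j Hj).
    destruct (ratio_range (node_a r N j) t ltac:(lra) ltac:(lra)) as [H1 _].
    destruct H1 as [H1|H1]; trivial. exfalso. apply Hnz. now exists j. }
  unfold P. rewrite prod_below_exp, <- exp_plus by exact Hpos.
  apply exp_le.
  set (u := fun k => ln (ratio (node_a r N k) t)).
  assert (Hzero : forall x, x = s -> tanh (c * Rabs (sqrt x - sqrt s)) = 0).
  { intros x ->. rewrite Rminus_diag, Rabs_R0, Rmult_0_r. apply tanh_0. }
  assert (Hhalf : 0 <= INR n - / 2) by (assert (H := le_INR 1 n Hn); simpl in H; lra).
  assert (Hlow : sum_below u n = sum_below (fun k => log_tanh c s (INR k)) n).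
  { apply sum_below_ext. intros k Hk. unfold u, log_tanh.
    rewrite (node_a_low r N n) by trivial. now rewrite Hratio by apply pos_INR. }
  assert (Hmid : u n = log_tanh c s (INR n - / 2)).
  { unfold u, log_tanh. rewrite (node_a_mid r N n) by trivial. now rewrite Hratio. }
  assert (Hmain : sum_below u n + u n
    <= K - PI ^ 2 / (2 * c) * sqrt s + FR c (sqrt s) (INR n)).
  { rewrite Hlow, Hmid. apply HK; trivial.
    - intros k Hk Ek. assert (H := Hpos k ltac:(lia)).
      rewrite (node_a_low r N n), Hratio, Hzero in H; trivial; [lra|apply pos_INR].
    - intros Ek. assert (H := Hpos n ltac:(lia)).
      rewrite (node_a_mid r N n), Hratio, Hzero in H; trivial; lra. }
  set (p := (N - S n)%nat).
  assert (Hextra : sum_below (fun k => u (S n + k)%nat) p <= INR p * - (16 / PI ^ 2 * chi2 y0)).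
  { rewrite <- sum_below_const. apply sum_below_le. intros k Hk. unfold u.
    assert (H := node_a_high r N n (S n + k) En ltac:(unfold p in Hk; lia)).
    assert (H1 := Hpos (S n + k)%nat ltac:(unfold p in Hk; lia)).
    rewrite Ety0 in *. apply ln_ratio_extra; lra. }
  assert (Hsum : sum_below u N = sum_below u n + u n + sum_below (fun k => u (S n + k)%nat) p).
  { replace N with (S n + p)%nat at 1 by (unfold p; lia). rewrite sum_below_add. reflexivity. }
  rewrite Hsum.
  assert (Hp : PI / 4 * (sqrt r * sqrt (INR N)) - 1 <= INR p).
  { unfold p. rewrite minus_INR, S_INR by lia.
    replace (INR N * r) with (r * INR N) in Hl by ring. rewrite HNr in Hl. lra. }
  assert (HX0 := proj1 (chi2_bounds y0)). assert (HX1 := chi2_le y0).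
  assert (HFR : FR c (sqrt s) (INR n) = 2 / c * sqrt (INR n) * chi2 y0).
  { unfold FR. now rewrite Hsw. }
  assert (HnN' : sqrt (INR n) <= sqrt (INR N)) by (apply sqrt_le_1_alt, le_INR; lia).
  assert (HFR2 : FR c (sqrt s) (INR n) <= 4 / PI * (sqrt r * sqrt (INR N)) * chi2 y0).
  { rewrite HFR. apply Rmult_le_compat_r; trivial.
    replace (2 / c) with (4 / PI * sqrt r) by (unfold c; field; lra).
    rewrite <- Rmult_assoc. apply Rmult_le_compat_l; trivial.
    apply Rmult_le_pos; [|lra]. apply Rlt_le, Rdiv_lt_0_compat; lra. }
  (* The compensation: [(pi/4) (16/pi^2) = 4/pi], and the one point by which [p] may fall short
     costs at most [(16/pi^2) (pi^2/8) = 2]. *)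
  assert (Hex2 : INR p * - (16 / PI ^ 2 * chi2 y0)
    <= - (4 / PI * (sqrt r * sqrt (INR N)) * chi2 y0) + 2).
  { assert (Hk : 0 < 16 / PI ^ 2) by (apply Rdiv_lt_0_compat; nra).
    assert (H1 : (PI / 4 * (sqrt r * sqrt (INR N)) - 1) * (16 / PI ^ 2 * chi2 y0)
      <= INR p * (16 / PI ^ 2 * chi2 y0)) by (apply Rmult_le_compat_r; nra).
    assert (H2 : 16 / PI ^ 2 * chi2 y0 <= 2).
    { replace 2 with (16 / PI ^ 2 * (PI ^ 2 / 8)) by (field; lra).
      apply Rmult_le_compat_l; lra. }
    replace (4 / PI * (sqrt r * sqrt (INR N)) * chi2 y0)
      with (PI / 4 * (sqrt r * sqrt (INR N)) * (16 / PI ^ 2 * chi2 y0)) by (field; lra).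
    lra. }
  assert (Ers : PI ^ 2 / (2 * c) * sqrt s = PI * sqrt r * w).
  { rewrite Hsw. unfold c. field. lra. }
  assert (Ert : r * ln t = PI * sqrt r * w - PI * sqrt r * sqrt (INR n)).
  { rewrite Hlnt, <- Er2c. ring. }
  lra.
Qed.

(** * Complex differentiability *)

Definition ccont (f : C -> C) (z : C) : Prop :=
  forall eps, 0 < eps -> exists del, 0 < del /\
    forall w, Cmod (w - z)%C < del -> Cmod (f w - f z)%C < eps.

(* Caratheodory's form of complex differentiability. *)
Definition cdiff (f : C -> C) (z : C) : Prop :=
  exists (g : C -> C) (del : R), 0 < del /\
    (forall w, Cmod (w - z)%C < del -> (f w - f z = g w * (w - z))%C) /\
    ccont g z.

Lemma Cmod_sub_diag (z : C) : Cmod (z - z)%C = 0.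
Proof. replace (z - z)%C with (RtoC 0) by ring. apply Cmod_0. Qed.

Lemma ccont_const (k z : C) : ccont (fun _ => k) z.
Proof. intros eps H. exists 1. split; [lra|]. intros w _. now rewrite Cmod_sub_diag. Qed.

Lemma ccont_id (z : C) : ccont (fun w => w) z.
Proof. intros eps H. exists eps. split; trivial. Qed.

Lemma ccont_ext_loc (f g : C -> C) (z : C) (del : R) : 0 < del ->
  (forall w, Cmod (w - z)%C < del -> f w = g w) -> ccont f z -> ccont g z.
Proof.
  intros Hdel H Hf eps Heps. destruct (Hf eps Heps) as [d [Hd Hf']].
  exists (Rmin del d). split; [now apply Rmin_glb_lt|].
  intros w Hw. assert (H1 := Rmin_l del d). assert (H2 := Rmin_r del d).
  rewrite <- !H; [|rewrite Cmod_sub_diag; lra|lra]. apply Hf'. lra.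
Qed.

Lemma ccont_plus (f g : C -> C) (z : C) :
  ccont f z -> ccont g z -> ccont (fun w => (f w + g w)%C) z.
Proof.
  intros Hf Hg eps Heps.
  destruct (Hf (eps / 2) ltac:(lra)) as [d1 [Hd1 H1]].
  destruct (Hg (eps / 2) ltac:(lra)) as [d2 [Hd2 H2]].
  exists (Rmin d1 d2). split; [now apply Rmin_glb_lt|].
  intros w Hw. assert (M1 := Rmin_l d1 d2). assert (M2 := Rmin_r d1 d2).
  specialize (H1 w ltac:(lra)). specialize (H2 w ltac:(lra)).
  replace (f w + g w - (f z + g z))%C with ((f w - f z) + (g w - g z))%C by ring.
  apply Rle_lt_trans with (1 := Cmod_triangle _ _). lra.
Qed.

Lemma ccont_mult (f g : C -> C) (z : C) :
  ccont f z -> ccont g z -> ccont (fun w => (f w * g w)%C) z.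
Proof.
  intros Hf Hg eps Heps.
  assert (Pf := Cmod_ge_0 (f z)). assert (Pg := Cmod_ge_0 (g z)).
  set (M := Cmod (f z) + Cmod (g z) + 1).
  set (e := Rmin 1 (eps / (2 * M))).
  assert (HM : 0 < M) by (unfold M; lra).
  assert (He0 : 0 < eps / (2 * M)) by (apply Rdiv_lt_0_compat; lra).
  assert (He : 0 < e) by (apply Rmin_glb_lt; lra).
  destruct (Hf e He) as [d1 [Hd1 H1]].
  destruct (Hg e He) as [d2 [Hd2 H2]].
  exists (Rmin d1 d2). split; [now apply Rmin_glb_lt|].
  intros w Hw. assert (M1 := Rmin_l d1 d2). assert (M2 := Rmin_r d1 d2).
  specialize (H1 w ltac:(lra)). specialize (H2 w ltac:(lra)).
  replace (f w * g w - f z * g z)%C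
    with ((f w - f z) * (g w - g z) + f z * (g w - g z) + (f w - f z) * g z)%C by ring.
  assert (E1 := Rmin_l 1 (eps / (2 * M))). assert (E2 := Rmin_r 1 (eps / (2 * M))). fold e in E1, E2.
  assert (T1 := Cmod_triangle ((f w - f z) * (g w - g z) + f z * (g w - g z)) ((f w - f z) * g z)).
  assert (T2 := Cmod_triangle ((f w - f z) * (g w - g z)) (f z * (g w - g z))).
  rewrite !Cmod_mult in *.
  assert (P1 := Cmod_ge_0 (f w - f z)%C).
  assert (E3 : e * M <= eps / 2).
  { apply Rle_trans with (eps / (2 * M) * M); [apply Rmult_le_compat_r; lra|]. right. field. lra. }
  unfold M in E3. nra.
Qed.

Lemma ccont_opp (f : C -> C) (z : C) : ccont f z -> ccont (fun w => (- f w)%C) z.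
Proof.
  intros Hf. apply ccont_ext_loc with (fun w => (- RtoC 1 * f w)%C) 1; [lra| |].
  - intros w _. ring.
  - apply ccont_mult; trivial. apply ccont_const.
Qed.

Lemma ccont_minus (f g : C -> C) (z : C) :
  ccont f z -> ccont g z -> ccont (fun w => (f w - g w)%C) z.
Proof. intros Hf Hg. apply ccont_plus; trivial. now apply ccont_opp. Qed.

Lemma ccont_neq_0 (f : C -> C) (z : C) : ccont f z -> f z <> 0 ->
  exists del, 0 < del /\ forall w, Cmod (w - z)%C < del -> Cmod (f z) / 2 < Cmod (f w).
Proof.
  intros Hf Hz. apply Cmod_gt_0 in Hz.
  destruct (Hf (Cmod (f z) / 2) ltac:(lra)) as [d [Hd H]].
  exists d. split; trivial. intros w Hw. specialize (H w Hw).
  assert (T := Cmod_triangle (f w) (- (f w - f z))).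
  replace (f w + - (f w - f z))%C with (f z) in T by ring.
  rewrite Cmod_opp in T. lra.
Qed.

Lemma ccont_inv (f : C -> C) (z : C) : ccont f z -> f z <> 0 -> ccont (fun w => (/ f w)%C) z.
Proof.
  intros Hf Hz eps Heps.
  destruct (ccont_neq_0 f z Hf Hz) as [d1 [Hd1 H1]].
  assert (Hz' := proj1 (Cmod_gt_0 _) Hz).
  destruct (Hf (eps * (Cmod (f z) * (Cmod (f z) / 2)))) as [d2 [Hd2 H2]].
  { apply Rmult_lt_0_compat; nra. }
  exists (Rmin d1 d2). split; [now apply Rmin_glb_lt|].
  intros w Hw. assert (M1 := Rmin_l d1 d2). assert (M2 := Rmin_r d1 d2).
  specialize (H1 w ltac:(lra)). specialize (H2 w ltac:(lra)).
  assert (Hw0 : f w <> 0) by (apply Cmod_gt_0; lra).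
  replace (/ f w - / f z)%C with (- (f w - f z) / (f z * f w))%C by (field; auto).
  rewrite Cmod_div, Cmod_opp, Cmod_mult by (apply Cmult_neq_0; trivial).
  apply Rmult_lt_reg_r with (Cmod (f z) * Cmod (f w)); [nra|].
  unfold Rdiv. rewrite Rmult_assoc, Rinv_l by nra. rewrite Rmult_1_r.
  apply Rlt_le_trans with (1 := H2). apply Rmult_le_compat_l; nra.
Qed.

Lemma ccont_comp (f g : C -> C) (z : C) :
  ccont f z -> ccont g (f z) -> ccont (fun w => g (f w)) z.
Proof.
  intros Hf Hg eps Heps. destruct (Hg eps Heps) as [d [Hd H]].
  destruct (Hf d Hd) as [d2 [Hd2 H2]]. exists d2. split; auto.
Qed.

Lemma cdiff_ccont (f : C -> C) (z : C) : cdiff f z -> ccont f z.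
Proof.
  intros [g [del [Hdel [E Hg]]]].
  apply ccont_ext_loc with (fun w => f z + g w * (w - z))%C del; trivial.
  - intros w Hw. rewrite <- E by trivial. ring.
  - apply ccont_plus; [apply ccont_const|]. apply ccont_mult; trivial.
    apply ccont_minus; [apply ccont_id|apply ccont_const].
Qed.

Lemma cdiff_ext_loc (f g : C -> C) (z : C) (del : R) : 0 < del ->
  (forall w, Cmod (w - z)%C < del -> f w = g w) -> cdiff f z -> cdiff g z.
Proof.
  intros Hdel H [h [d [Hd [E Hh]]]].
  exists h, (Rmin del d). split; [now apply Rmin_glb_lt|]. split; trivial.
  intros w Hw. assert (M1 := Rmin_l del d). assert (M2 := Rmin_r del d).
  rewrite <- !H; [|rewrite Cmod_sub_diag; lra|lra]. apply E. lra.
Qed.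

Lemma cdiff_const (k z : C) : cdiff (fun _ => k) z.
Proof.
  exists (fun _ => RtoC 0), 1. split; [lra|]. split; [|apply ccont_const].
  intros w _. ring.
Qed.

Lemma cdiff_id (z : C) : cdiff (fun w => w) z.
Proof.
  exists (fun _ => RtoC 1), 1. split; [lra|]. split; [|apply ccont_const].
  intros w _. ring.
Qed.

Lemma cdiff_plus (f g : C -> C) (z : C) :
  cdiff f z -> cdiff g z -> cdiff (fun w => (f w + g w)%C) z.
Proof.
  intros [h [d [Hd [E Hh]]]] [k [d2 [Hd2 [E2 Hk]]]].
  exists (fun w => (h w + k w)%C), (Rmin d d2). split; [now apply Rmin_glb_lt|].
  split; [|now apply ccont_plus].
  intros w Hw. assert (M1 := Rmin_l d d2). assert (M2 := Rmin_r d d2).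
  rewrite Cmult_plus_distr_r, <- E, <- E2 by lra. ring.
Qed.

Lemma cdiff_mult (f g : C -> C) (z : C) :
  cdiff f z -> cdiff g z -> cdiff (fun w => (f w * g w)%C) z.
Proof.
  intros Df Dg. assert (Cg := cdiff_ccont _ _ Dg).
  destruct Df as [h [d [Hd [E Hh]]]]. destruct Dg as [k [d2 [Hd2 [E2 Hk]]]].
  exists (fun w => (h w * g w + f z * k w)%C), (Rmin d d2).
  split; [now apply Rmin_glb_lt|].
  split; [|apply ccont_plus; apply ccont_mult; trivial; apply ccont_const].
  intros w Hw. assert (M1 := Rmin_l d d2). assert (M2 := Rmin_r d d2).
  transitivity ((h w * (w - z)) * g w + f z * (k w * (w - z)))%C; [|ring].
  rewrite <- E, <- E2 by lra. ring.
Qed.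

Lemma cdiff_opp (f : C -> C) (z : C) : cdiff f z -> cdiff (fun w => (- f w)%C) z.
Proof.
  intros Hf. apply cdiff_ext_loc with (fun w => (- RtoC 1 * f w)%C) 1; [lra| |].
  - intros w _. ring.
  - apply cdiff_mult; trivial. apply cdiff_const.
Qed.

Lemma cdiff_minus (f g : C -> C) (z : C) :
  cdiff f z -> cdiff g z -> cdiff (fun w => (f w - g w)%C) z.
Proof. intros Hf Hg. apply cdiff_plus; trivial. now apply cdiff_opp. Qed.

Lemma cdiff_inv (f : C -> C) (z : C) : cdiff f z -> f z <> 0 -> cdiff (fun w => (/ f w)%C) z.
Proof.
  intros Df Hz. assert (Cf := cdiff_ccont _ _ Df).
  destruct (ccont_neq_0 f z Cf Hz) as [d1 [Hd1 H1]].
  destruct Df as [h [d [Hd [E Hh]]]].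
  exists (fun w => (- h w * / (f w * f z))%C), (Rmin d d1).
  split; [now apply Rmin_glb_lt|]. split.
  - intros w Hw. assert (M1 := Rmin_l d d1). assert (M2 := Rmin_r d d1).
    assert (Hw0 : f w <> 0).
    { apply Cmod_gt_0. specialize (H1 w ltac:(lra)). assert (H2 := Cmod_ge_0 (f z)). lra. }
    transitivity (- (h w * (w - z)) * / (f w * f z))%C; [|ring].
    rewrite <- E by lra. field. auto.
  - apply ccont_mult; [now apply ccont_opp|].
    apply ccont_inv.
    + apply ccont_mult; trivial. apply ccont_const.
    + now apply Cmult_neq_0.
Qed.

Lemma cdiff_div (f g : C -> C) (z : C) :
  cdiff f z -> cdiff g z -> g z <> 0 -> cdiff (fun w => (f w / g w)%C) z.
Proof. intros Hf Hg H. apply cdiff_mult; trivial. now apply cdiff_inv. Qed.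

(** Caratheodory factors multiply, to [k (f w) * h w], with no case distinction for [f w = f z]. *)
Lemma cdiff_comp (f g : C -> C) (z : C) :
  cdiff f z -> cdiff g (f z) -> cdiff (fun w => g (f w)) z.
Proof.
  intros Df Dg. assert (Cf := cdiff_ccont _ _ Df).
  destruct Df as [h [d [Hd [E Hh]]]]. destruct Dg as [k [d2 [Hd2 [E2 Hk]]]].
  destruct (Cf d2 Hd2) as [d3 [Hd3 H3]].
  exists (fun w => (k (f w) * h w)%C), (Rmin d d3). split; [now apply Rmin_glb_lt|]. split.
  - intros w Hw. assert (M1 := Rmin_l d d3). assert (M2 := Rmin_r d d3).
    rewrite E2 by (apply H3; lra). rewrite E by lra. ring.
  - apply ccont_mult; trivial. now apply (ccont_comp f k).
Qed.

Lemma cdiff_approx (f : C -> C) (z : C) : cdiff f z -> exists l : C,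
  forall eps, 0 < eps -> exists del, 0 < del /\
  forall w, Cmod (w - z)%C < del -> Cmod (f w - f z - l * (w - z))%C <= eps * Cmod (w - z)%C.
Proof.
  intros [h [d [Hd [E Hh]]]]. exists (h z). intros eps Heps.
  destruct (Hh eps Heps) as [d2 [Hd2 H2]].
  exists (Rmin d d2). split; [now apply Rmin_glb_lt|].
  intros w Hw. assert (M1 := Rmin_l d d2). assert (M2 := Rmin_r d d2).
  rewrite E by lra. replace (h w * (w - z) - h z * (w - z))%C with ((h w - h z) * (w - z))%C by ring.
  rewrite Cmod_mult. apply Rmult_le_compat_r; [apply Cmod_ge_0|]. left. apply H2. lra.
Qed.

(** The factor is the difference quotient, completed by [l] at [z]. Its equation holds for every
    [w], near [z] or not, so that a logarithm can later be substituted for [w]. *)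
Lemma caratheodory_of_approx (f : C -> C) (z l : C) :
  (forall eps, 0 < eps -> exists del, 0 < del /\
  forall w, Cmod (w - z)%C < del -> Cmod (f w - f z - l * (w - z))%C <= eps * Cmod (w - z)%C) ->
  exists g : C -> C, g z = l /\ (forall w, (f w - f z = g w * (w - z))%C) /\ ccont g z.
Proof.
  intros H.
  exists (fun w => if Ceq_dec w z then l else ((f w - f z) / (w - z))%C).
  repeat split.
  - now destruct (Ceq_dec z z) as [_|Hz]; [|elim Hz].
  - intros w. destruct (Ceq_dec w z) as [->|Hw]; [ring|].
    field. now apply Cminus_eq_contra.
  - intros eps Heps. destruct (H (eps / 2) ltac:(lra)) as [d [Hd H']].
    exists d. split; trivial. intros w Hw.
    destruct (Ceq_dec z z) as [_|Hz]; [|now elim Hz].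
    destruct (Ceq_dec w z) as [->|Hwz]; [now rewrite Cmod_sub_diag|].
    assert (Hne := Cminus_eq_contra _ _ Hwz).
    replace ((f w - f z) / (w - z) - l)%C with ((f w - f z - l * (w - z)) / (w - z))%C by (field; trivial).
    rewrite Cmod_div by trivial. assert (Hp := proj1 (Cmod_gt_0 _) Hne).
    apply Rle_lt_trans with (eps / 2); [|lra].
    apply Rmult_le_reg_r with (Cmod (w - z)%C); trivial.
    unfold Rdiv at 1. rewrite Rmult_assoc, Rinv_l by lra. rewrite Rmult_1_r. now apply H'.
Qed.

Lemma cdiff_of_approx (f : C -> C) (z l : C) :
  (forall eps, 0 < eps -> exists del, 0 < del /\
  forall w, Cmod (w - z)%C < del -> Cmod (f w - f z - l * (w - z))%C <= eps * Cmod (w - z)%C) ->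
  cdiff f z.
Proof.
  intros H. destruct (caratheodory_of_approx f z l H) as [g [_ [E Hg]]].
  exists g, 1. split; [lra|]. auto.
Qed.

Lemma ex_derive_cdiff (f : C -> C) (z : C) :
  ex_derive (K := C_AbsRing) (V := C_NormedModule) f z -> cdiff f z.
Proof.
  intros [l [_ H]]. apply (cdiff_of_approx f z l). intros eps Heps.
  destruct (H z (fun P Hl => Hl) (mkposreal eps Heps)) as [d Hd].
  exists d. split; [apply cond_pos|]. intros w Hw.
  specialize (Hd w Hw). unfold norm, minus, plus, opp, scal in Hd; simpl in Hd.
  unfold mult in Hd; simpl in Hd. rewrite (Cmult_comm l). exact Hd.
Qed.

(** * Goursat's theorem *)

(* Normal forms of [RInt] leave equations typed in [R_CompleteNormedModule], where [ring] fails. *)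
Ltac R_eq := match goal with |- @eq _ ?u ?v => change (@eq R u v) end.

(** The point [s] ranges over all reals near [t], also outside [[a, b]]: existence of the integral
    is derived from two-sided continuity at the endpoints. *)
Definition path_cont (f : R -> C) (a b : R) : Prop :=
  forall t, a <= t <= b -> forall eps, 0 < eps -> exists del, 0 < del /\
    forall s, Rabs (s - t) < del -> Cmod (f s - f t)%C < eps.

(** Componentwise integration stays with real integrals. The price is a factor 2 in the norm bounds,
    which is harmless where only some constant is sought. *)
Definition CI (f : R -> C) (a b : R) : C :=
  (RInt (fun t => Re (f t)) a b, RInt (fun t => Im (f t)) a b).

Lemma Rabs_Im_le (z : C) : Rabs (Im z) <= Cmod z.
Proof.
  apply Rle_trans with (2 := Rmax_Cmod z). apply Rmax_r.
Qed.

Lemma Cmod_le_Re_Im (z : C) : Cmod z <= Rabs (Re z) + Rabs (Im z).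
Proof.
  unfold Cmod, Re, Im. assert (H1 := Rabs_pos (fst z)). assert (H2 := Rabs_pos (snd z)).
  rewrite <- (sqrt_pow2 (Rabs (fst z) + Rabs (snd z))) by lra.
  apply sqrt_le_1_alt. rewrite <- (pow2_abs (fst z)), <- (pow2_abs (snd z)). nra.
Qed.

Lemma path_cont_ex (f : R -> C) (a b : R) : a <= b -> path_cont f a b ->
  ex_RInt (fun t => Re (f t)) a b /\ ex_RInt (fun t => Im (f t)) a b.
Proof.
  intros Hab H.
  split; apply (ex_RInt_continuous (V := R_CompleteNormedModule)); rewrite Rmin_left, Rmax_right by trivial;
    intros t Ht P [eps HP]; destruct (H t Ht eps (cond_pos eps)) as [d [Hd Hd']];
    exists (mkposreal d Hd); intros s Hs; apply HP; specialize (Hd' s Hs).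
  - apply Rle_lt_trans with (2 := Hd').
    exact (re_le_Cmod (f s - f t)%C).
  - apply Rle_lt_trans with (2 := Hd').
    exact (Rabs_Im_le (f s - f t)%C).
Qed.

Lemma CI_ext (f g : R -> C) (a b : R) : a <= b ->
  (forall t, a <= t <= b -> f t = g t) -> CI f a b = CI g a b.
Proof.
  intros Hab H. unfold CI. f_equal; apply RInt_ext; rewrite Rmin_left, Rmax_right by trivial;
    intros t Ht; rewrite H; trivial; lra.
Qed.

Lemma CI_plus (f g : R -> C) (a b : R) : a <= b -> path_cont f a b -> path_cont g a b ->
  CI (fun t => f t + g t)%C a b = (CI f a b + CI g a b)%C.
Proof.
  intros Hab Hf Hg. destruct (path_cont_ex f a b Hab Hf) as [F1 F2].
  destruct (path_cont_ex g a b Hab Hg) as [G1 G2].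
  unfold CI, Cplus. simpl. f_equal.
  - rewrite <- (RInt_plus (V := R_CompleteNormedModule)) by trivial. reflexivity.
  - rewrite <- (RInt_plus (V := R_CompleteNormedModule)) by trivial. reflexivity.
Qed.

Lemma CI_scal (k : C) (f : R -> C) (a b : R) : a <= b -> path_cont f a b ->
  CI (fun t => k * f t)%C a b = (k * CI f a b)%C.
Proof.
  intros Hab Hf. destruct (path_cont_ex f a b Hab Hf) as [F1 F2].
  apply (RInt_correct (V := R_CompleteNormedModule)) in F1.
  apply (RInt_correct (V := R_CompleteNormedModule)) in F2.
  unfold CI, Cmult. simpl. f_equal; apply is_RInt_unique.
  - apply (is_RInt_minus (V := R_NormedModule) (fun t => fst k * Re (f t)) (fun t => snd k * Im (f t)));
      now apply (is_RInt_scal (V := R_NormedModule)).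
  - apply (is_RInt_plus (V := R_NormedModule) (fun t => fst k * Im (f t)) (fun t => snd k * Re (f t)));
      now apply (is_RInt_scal (V := R_NormedModule)).
Qed.

Lemma CI_Chasles (f : R -> C) (a b c : R) : a <= b -> b <= c -> path_cont f a c ->
  CI f a c = (CI f a b + CI f b c)%C.
Proof.
  intros Hab Hbc Hf.
  destruct (path_cont_ex f a b Hab) as [F1 F2]; [intros t Ht; apply Hf; lra|].
  destruct (path_cont_ex f b c Hbc) as [G1 G2]; [intros t Ht; apply Hf; lra|].
  unfold CI, Cplus. simpl. f_equal.
  - now rewrite <- (RInt_Chasles (V := R_CompleteNormedModule) (fun t => Re (f t)) a b c).
  - now rewrite <- (RInt_Chasles (V := R_CompleteNormedModule) (fun t => Im (f t)) a b c).
Qed.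

Lemma is_RInt_primitive (G g : R -> R) (a b : R) : a <= b ->
  (forall t, a <= t <= b -> is_derive G t (g t)) ->
  (forall t, a <= t <= b -> continuity_pt g t) -> is_RInt g a b (G b - G a).
Proof.
  intros Hab HG Hg. apply (is_RInt_derive (V := R_CompleteNormedModule) G g);
    rewrite Rmin_left, Rmax_right by trivial.
  - exact HG.
  - intros t Ht. apply continuity_pt_filterlim. now apply Hg.
Qed.

(** The dominating function comes with a primitive, so that the bound is explicit, and independent
    of the interval when [G] is bounded. *)
Lemma CI_bound (f : R -> C) (G g : R -> R) (a b : R) : a <= b -> path_cont f a b ->
  (forall t, a <= t <= b -> is_derive G t (g t)) ->
  (forall t, a <= t <= b -> continuity_pt g t) ->
  (forall t, a <= t <= b -> Cmod (f t) <= g t) ->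
  Cmod (CI f a b) <= 2 * (G b - G a).
Proof.
  intros Hab Hf HG Hg H. destruct (path_cont_ex f a b Hab Hf) as [F1 F2].
  assert (HI := is_RInt_primitive G g a b Hab HG Hg).
  apply Rle_trans with (1 := Cmod_le_Re_Im _).
  assert (B1 : Rabs (RInt (fun t => Re (f t)) a b) <= G b - G a).
  { apply (norm_RInt_le (V := R_NormedModule) (fun t => Re (f t)) g a b _ _ Hab).
    - intros t Ht. apply Rle_trans with (2 := H t Ht). apply re_le_Cmod.
    - apply (RInt_correct (V := R_CompleteNormedModule)); trivial.
    - exact HI. }
  assert (B2 : Rabs (RInt (fun t => Im (f t)) a b) <= G b - G a).
  { apply (norm_RInt_le (V := R_NormedModule) (fun t => Im (f t)) g a b _ _ Hab).
    - intros t Ht. apply Rle_trans with (2 := H t Ht). apply Rabs_Im_le.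
    - apply (RInt_correct (V := R_CompleteNormedModule)); trivial.
    - exact HI. }
  unfold CI. simpl. lra.
Qed.

Lemma CI_bound_const (f : R -> C) (M a b : R) : a <= b -> path_cont f a b ->
  (forall t, a <= t <= b -> Cmod (f t) <= M) -> Cmod (CI f a b) <= 2 * M * (b - a).
Proof.
  intros Hab Hf H.
  replace (2 * M * (b - a)) with (2 * (M * b - M * a)) by ring.
  apply (CI_bound f (fun t => M * t) (fun _ => M)); trivial.
  - intros t _. auto_derive; trivial. ring.
  - intros t _. apply continuity_pt_const. intros ? ?; reflexivity.
Qed.

Lemma CI_affine (k l : C) (a b : R) : a <= b ->
  CI (fun t => k + l * RtoC t)%C a b
  = (k * RtoC (b - a) + l * RtoC ((b ^ 2 - a ^ 2) / 2))%C.
Proof.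
  intros Hab. unfold CI, Cmult, Cplus, RtoC. simpl.
  assert (H : forall p q : R, RInt (fun t => p + q * t) a b
    = p * (b - a) + q * ((b ^ 2 - a ^ 2) / 2)).
  { intros p q. apply is_RInt_unique.
    replace (p * (b - a) + q * ((b ^ 2 - a ^ 2) / 2))
      with ((p * b + q * (b ^ 2 / 2)) - (p * a + q * (a ^ 2 / 2))) by field.
    apply (is_RInt_primitive (fun t => p * t + q * (t ^ 2 / 2)) (fun t => p + q * t)); trivial.
    - intros t _. auto_derive; trivial. field.
    - intros t _. apply continuity_pt_plus; [apply continuity_pt_const; intros ? ?; reflexivity|].
      apply continuity_pt_scal, continuity_pt_id. }
  f_equal.
  - transitivity (RInt (fun t => fst k + fst l * t) a b).
    + apply RInt_ext. intros t _. R_eq. ring.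
    + rewrite H. R_eq. field.
  - transitivity (RInt (fun t => snd k + snd l * t) a b).
    + apply RInt_ext. intros t _. R_eq. ring.
    + rewrite H. R_eq. field.
Qed.

(* Counterclockwise integral over the boundary of [x1,x2] x [y1,y2]. *)
Definition box (f : C -> C) (x1 x2 y1 y2 : R) : C :=
  (CI (fun x => f (x, y1)) x1 x2 - CI (fun x => f (x, y2)) x1 x2
   + Ci * (CI (fun y => f (x2, y)) y1 y2 - CI (fun y => f (x1, y)) y1 y2))%C.

Lemma Cmod_horizontal (x t y : R) : Cmod ((x, y) - (t, y))%C = Rabs (x - t).
Proof.
  replace ((x, y) - (t, y))%C with (RtoC (x - t)).
  - apply Cmod_R.
  - unfold RtoC, Cminus, Cplus, Copp. simpl. f_equal; ring.
Qed.

Lemma Cmod_vertical (x t y : R) : Cmod ((y, x) - (y, t))%C = Rabs (x - t).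
Proof.
  replace ((y, x) - (y, t))%C with (Ci * RtoC (x - t))%C.
  - rewrite Cmod_mult, Cmod_Ci, Cmod_R. ring.
  - unfold Ci, RtoC, Cminus, Cplus, Copp, Cmult. simpl. f_equal; ring.
Qed.

Lemma path_cont_h (f : C -> C) (y a b : R) :
  (forall x, a <= x <= b -> ccont f (x, y)) -> path_cont (fun x => f (x, y)) a b.
Proof.
  intros H t Ht eps Heps. destruct (H t Ht eps Heps) as [d [Hd Hd']].
  exists d. split; trivial. intros s Hs. apply Hd'. now rewrite Cmod_horizontal.
Qed.

Lemma path_cont_v (f : C -> C) (x a b : R) :
  (forall y, a <= y <= b -> ccont f (x, y)) -> path_cont (fun y => f (x, y)) a b.
Proof.
  intros H t Ht eps Heps. destruct (H t Ht eps Heps) as [d [Hd Hd']].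
  exists d. split; trivial. intros s Hs. apply Hd'. now rewrite Cmod_vertical.
Qed.

Definition boundary (x1 x2 y1 y2 : R) (z : C) : Prop :=
  x1 <= fst z <= x2 /\ y1 <= snd z <= y2 /\
  (fst z = x1 \/ fst z = x2 \/ snd z = y1 \/ snd z = y2).

Ltac in_boundary := unfold boundary; simpl; split; [lra|split; [lra|tauto]].

Lemma boundary_paths (f : C -> C) (x1 x2 y1 y2 : R) : x1 <= x2 -> y1 <= y2 ->
  (forall z, boundary x1 x2 y1 y2 z -> ccont f z) ->
  path_cont (fun x => f (x, y1)) x1 x2 /\ path_cont (fun x => f (x, y2)) x1 x2 /\
  path_cont (fun y => f (x1, y)) y1 y2 /\ path_cont (fun y => f (x2, y)) y1 y2.
Proof.
  intros Hx Hy H. repeat split; (apply path_cont_h || apply path_cont_v);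
    intros t Ht; apply H; in_boundary.
Qed.

Lemma box_ext (f g : C -> C) (x1 x2 y1 y2 : R) : x1 <= x2 -> y1 <= y2 ->
  (forall z, boundary x1 x2 y1 y2 z -> f z = g z) -> box f x1 x2 y1 y2 = box g x1 x2 y1 y2.
Proof.
  intros Hx Hy H. unfold box.
  rewrite (CI_ext (fun x => f (x, y1)) (fun x => g (x, y1))),
    (CI_ext (fun x => f (x, y2)) (fun x => g (x, y2))),
    (CI_ext (fun y => f (x1, y)) (fun y => g (x1, y))),
    (CI_ext (fun y => f (x2, y)) (fun y => g (x2, y)));
    trivial; intros t Ht; apply H; in_boundary.
Qed.

Lemma box_plus (f g : C -> C) (x1 x2 y1 y2 : R) : x1 <= x2 -> y1 <= y2 ->
  (forall z, boundary x1 x2 y1 y2 z -> ccont f z) ->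
  (forall z, boundary x1 x2 y1 y2 z -> ccont g z) ->
  box (fun z => f z + g z)%C x1 x2 y1 y2 = (box f x1 x2 y1 y2 + box g x1 x2 y1 y2)%C.
Proof.
  intros Hx Hy Hf Hg.
  destruct (boundary_paths f x1 x2 y1 y2 Hx Hy Hf) as [F1 [F2 [F3 F4]]].
  destruct (boundary_paths g x1 x2 y1 y2 Hx Hy Hg) as [G1 [G2 [G3 G4]]].
  unfold box.
  rewrite (CI_plus (fun x => f (x, y1)) (fun x => g (x, y1))) by trivial.
  rewrite (CI_plus (fun x => f (x, y2)) (fun x => g (x, y2))) by trivial.
  rewrite (CI_plus (fun x => f (x1, x)) (fun x => g (x1, x))) by trivial.
  rewrite (CI_plus (fun x => f (x2, x)) (fun x => g (x2, x))) by trivial.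
  ring.
Qed.

Lemma box_scal (k : C) (f : C -> C) (x1 x2 y1 y2 : R) : x1 <= x2 -> y1 <= y2 ->
  (forall z, boundary x1 x2 y1 y2 z -> ccont f z) ->
  box (fun z => k * f z)%C x1 x2 y1 y2 = (k * box f x1 x2 y1 y2)%C.
Proof.
  intros Hx Hy Hf.
  destruct (boundary_paths f x1 x2 y1 y2 Hx Hy Hf) as [F1 [F2 [F3 F4]]].
  unfold box.
  rewrite (CI_scal k (fun x => f (x, y1))) by trivial.
  rewrite (CI_scal k (fun x => f (x, y2))) by trivial.
  rewrite (CI_scal k (fun x => f (x1, x))) by trivial.
  rewrite (CI_scal k (fun x => f (x2, x))) by trivial.
  ring.
Qed.

(** Lets the linear approximation at a point be subtracted for free, which is the local step of
    Goursat's argument. *)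
Lemma box_affine (k l : C) (x1 x2 y1 y2 : R) : x1 <= x2 -> y1 <= y2 ->
  box (fun z => k + l * z)%C x1 x2 y1 y2 = 0.
Proof.
  intros Hx Hy. unfold box.
  assert (H : forall y, CI (fun x => (k + l * (x, y))%C) x1 x2
    = CI (fun x => ((k + l * (Ci * RtoC y)) + l * RtoC x)%C) x1 x2).
  { intros y. apply CI_ext; trivial. intros x _.
    replace (x, y) with (RtoC x + Ci * RtoC y)%C.
    - ring.
    - unfold RtoC, Ci, Cplus, Cmult. simpl. f_equal; ring. }
  assert (V : forall x, CI (fun y => (k + l * (x, y))%C) y1 y2
    = CI (fun y => ((k + l * RtoC x) + (l * Ci) * RtoC y)%C) y1 y2).
  { intros x. apply CI_ext; trivial. intros y _.
    replace (x, y) with (RtoC x + Ci * RtoC y)%C.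
    - ring.
    - unfold RtoC, Ci, Cplus, Cmult. simpl. f_equal; ring. }
  rewrite !H, !V, !CI_affine by trivial.
  destruct k as [k1 k2], l as [l1 l2].
  unfold RtoC, Ci, Cminus, Cplus, Copp, Cmult. simpl. f_equal; field.
Qed.

Lemma box_bound (f : C -> C) (M x1 x2 y1 y2 : R) : x1 <= x2 -> y1 <= y2 ->
  (forall z, boundary x1 x2 y1 y2 z -> ccont f z) ->
  (forall z, boundary x1 x2 y1 y2 z -> Cmod (f z) <= M) ->
  Cmod (box f x1 x2 y1 y2) <= 4 * M * (x2 - x1 + (y2 - y1)).
Proof.
  intros Hx Hy Hf HM.
  destruct (boundary_paths f x1 x2 y1 y2 Hx Hy Hf) as [F1 [F2 [F3 F4]]].
  unfold box.
  assert (B1 : Cmod (CI (fun x => f (x, y1)) x1 x2) <= 2 * M * (x2 - x1))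
    by (apply CI_bound_const; trivial; intros t Ht; apply HM; in_boundary).
  assert (B2 : Cmod (CI (fun x => f (x, y2)) x1 x2) <= 2 * M * (x2 - x1))
    by (apply CI_bound_const; trivial; intros t Ht; apply HM; in_boundary).
  assert (B3 : Cmod (CI (fun y => f (x1, y)) y1 y2) <= 2 * M * (y2 - y1))
    by (apply CI_bound_const; trivial; intros t Ht; apply HM; in_boundary).
  assert (B4 : Cmod (CI (fun y => f (x2, y)) y1 y2) <= 2 * M * (y2 - y1))
    by (apply CI_bound_const; trivial; intros t Ht; apply HM; in_boundary).
  eapply Rle_trans; [apply Cmod_triangle|]. rewrite Cmod_mult, Cmod_Ci.
  assert (T1 := Cmod_triangle (CI (fun x => f (x, y1)) x1 x2) (- CI (fun x => f (x, y2)) x1 x2)).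
  assert (T2 := Cmod_triangle (CI (fun y => f (x2, y)) y1 y2) (- CI (fun y => f (x1, y)) y1 y2)).
  rewrite Cmod_opp in T1, T2. unfold Cminus. lra.
Qed.

Lemma box_split_x (f : C -> C) (x1 x2 x3 y1 y2 : R) : x1 <= x2 -> x2 <= x3 ->
  (forall x, x1 <= x <= x3 -> ccont f (x, y1)) ->
  (forall x, x1 <= x <= x3 -> ccont f (x, y2)) ->
  box f x1 x3 y1 y2 = (box f x1 x2 y1 y2 + box f x2 x3 y1 y2)%C.
Proof.
  intros H1 H2 Hf1 Hf2. unfold box.
  rewrite (CI_Chasles (fun x => f (x, y1)) x1 x2 x3) by (trivial; now apply path_cont_h).
  rewrite (CI_Chasles (fun x => f (x, y2)) x1 x2 x3) by (trivial; now apply path_cont_h).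
  ring.
Qed.

Lemma box_split_y (f : C -> C) (x1 x2 y1 y2 y3 : R) : y1 <= y2 -> y2 <= y3 ->
  (forall y, y1 <= y <= y3 -> ccont f (x1, y)) ->
  (forall y, y1 <= y <= y3 -> ccont f (x2, y)) ->
  box f x1 x2 y1 y3 = (box f x1 x2 y1 y2 + box f x1 x2 y2 y3)%C.
Proof.
  intros H1 H2 Hf1 Hf2. unfold box.
  rewrite (CI_Chasles (fun y => f (x1, y)) y1 y2 y3) by (trivial; now apply path_cont_v).
  rewrite (CI_Chasles (fun y => f (x2, y)) y1 y2 y3) by (trivial; now apply path_cont_v).
  ring.
Qed.

(** If [P] failed at scale 1, a quarter would fail at each halving; the lower left corners of these
    nested cells increase to a point common to all of them, where the local hypothesis is
    contradicted. The scale [h] preserves the proportions, and [W] or [H] may be 0. *)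
Lemma bisection_2d (W H : R) (P : R -> R -> R -> Prop) (x0 y0 : R) : 0 <= W -> 0 <= H ->
  (forall x y h, 0 < h -> P x y (h / 2) -> P (x + W * (h / 2)) y (h / 2) ->
     P x (y + H * (h / 2)) (h / 2) -> P (x + W * (h / 2)) (y + H * (h / 2)) (h / 2) -> P x y h) ->
  (forall px py, x0 <= px <= x0 + W -> y0 <= py <= y0 + H -> exists del, 0 < del /\
     forall x y h, 0 < h < del -> x <= px <= x + W * h -> y <= py <= y + H * h -> P x y h) ->
  P x0 y0 1.
Proof.
  intros HW HH Hsplit Hloc. apply NNPP. intros HN.
  (* The fourth quarter is the default: by the splitting hypothesis [P] fails there when it holds on
     the other three. *)
  set (step := fun (n : nat) (p : R * R) =>
    let h := (/ 2) ^ S n in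
    if excluded_middle_informative (~ P (fst p) (snd p) h) then p else
    if excluded_middle_informative (~ P (fst p + W * h) (snd p) h) then (fst p + W * h, snd p) else
    if excluded_middle_informative (~ P (fst p) (snd p + H * h) h) then (fst p, snd p + H * h) else
    (fst p + W * h, snd p + H * h)).
  set (c := nat_rect (fun _ => (R * R)%type) (x0, y0) step).
  assert (Hh : forall n, 0 < (/ 2) ^ n) by (intros n; apply pow_lt; lra).
  assert (Hc : forall n, ~ P (fst (c n)) (snd (c n)) ((/ 2) ^ n)).
  { induction n as [|n IH]; [exact HN|].
    change (c (S n)) with (step n (c n)). unfold step. cbv zeta.
    assert (E : (/ 2) ^ S n = (/ 2) ^ n / 2) by (simpl; field).
    destruct (excluded_middle_informative _) as [H1|H1]; [exact H1|].
    destruct (excluded_middle_informative _) as [H2|H2]; [exact H2|].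
    destruct (excluded_middle_informative _) as [H3|H3]; [exact H3|].
    cbn [fst snd]. intros H4. apply IH. rewrite E in *.
    apply Hsplit; [apply Hh| | | |]; now apply NNPP. }
  assert (Hstep : forall n,
    fst (c n) <= fst (c (S n)) /\ fst (c (S n)) + W * (/ 2) ^ S n <= fst (c n) + W * (/ 2) ^ n /\
    snd (c n) <= snd (c (S n)) /\ snd (c (S n)) + H * (/ 2) ^ S n <= snd (c n) + H * (/ 2) ^ n).
  { intros n. change (c (S n)) with (step n (c n)). unfold step. cbv zeta.
    assert (E : (/ 2) ^ n = 2 * (/ 2) ^ S n) by (simpl; field). rewrite E.
    assert (Hp := Hh (S n)). set (h := (/ 2) ^ S n) in *.
    assert (0 <= W * h) by nra. assert (0 <= H * h) by nra.
    destruct (excluded_middle_informative _); [lra|].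
    destruct (excluded_middle_informative _); [simpl; lra|].
    destruct (excluded_middle_informative _); simpl; lra. }
  assert (Hmon : forall n p,
    fst (c n) <= fst (c (n + p)%nat) /\ fst (c (n + p)%nat) + W * (/ 2) ^ (n + p) <= fst (c n) + W * (/ 2) ^ n /\
    snd (c n) <= snd (c (n + p)%nat) /\ snd (c (n + p)%nat) + H * (/ 2) ^ (n + p) <= snd (c n) + H * (/ 2) ^ n).
  { intros n p. induction p as [|p IH]; [rewrite Nat.add_0_r; lra|].
    rewrite Nat.add_succ_r. specialize (Hstep (n + p)%nat). lra. }
  (* Cell [m + n] lies in cells [m] and [n], so every lower left corner is dominated by every upper
     right one, and the suprema lie in all cells. *)
  assert (Hcross : forall m n, fst (c m) <= fst (c n) + W * (/ 2) ^ n /\ snd (c m) <= snd (c n) + H * (/ 2) ^ n).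
  { intros m n.
    assert (Pm := Hh (m + n)%nat). assert (0 <= W * (/ 2) ^ (m + n)) by nra.
    assert (0 <= H * (/ 2) ^ (m + n)) by nra.
    assert (M1 := Hmon m n). assert (M2 := Hmon n m). rewrite (Nat.add_comm n m) in M2. lra. }
  destruct (completeness (fun x => exists n, x = fst (c n))) as [px [Ux Lx]].
  { exists (x0 + W * (/ 2) ^ 0). intros x [n ->]. apply (Hcross n 0%nat). }
  { exists x0, 0%nat. reflexivity. }
  destruct (completeness (fun y => exists n, y = snd (c n))) as [py [Uy Ly]].
  { exists (y0 + H * (/ 2) ^ 0). intros y [n ->]. apply (Hcross n 0%nat). }
  { exists y0, 0%nat. reflexivity. }
  assert (Bx : forall n, fst (c n) <= px <= fst (c n) + W * (/ 2) ^ n).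
  { intros n. split; [apply Ux; now exists n|]. apply Lx. intros x [m ->]. apply Hcross. }
  assert (By : forall n, snd (c n) <= py <= snd (c n) + H * (/ 2) ^ n).
  { intros n. split; [apply Uy; now exists n|]. apply Ly. intros x [m ->]. apply Hcross. }
  assert (Bx0 := Bx 0%nat). assert (By0 := By 0%nat). simpl in Bx0, By0.
  destruct (Hloc px py ltac:(lra) ltac:(lra)) as [del [Hdel HP]].
  destruct (pow_lt_1_zero (/ 2) ltac:(rewrite Rabs_pos_eq; lra) del Hdel) as [n Hn].
  specialize (Hn n (le_n n)). rewrite Rabs_pos_eq in Hn by (apply Rlt_le, Hh).
  apply (Hc n). apply HP; trivial. split; trivial.
Qed.

Lemma Cmod_pair_le (a b : R) : Cmod (a, b) <= Rabs a + Rabs b.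
Proof. apply (Cmod_le_Re_Im (a, b)). Qed.

Lemma goursat (f : C -> C) (x1 x2 y1 y2 : R) : x1 <= x2 -> y1 <= y2 ->
  (forall x y, x1 <= x <= x2 -> y1 <= y <= y2 -> cdiff f (x, y)) -> box f x1 x2 y1 y2 = 0.
Proof.
  intros Hx Hy Hf. set (W := x2 - x1). set (H := y2 - y1).
  assert (HW : 0 <= W) by (unfold W; lra). assert (HH : 0 <= H) by (unfold H; lra).
  assert (Hc : forall x y, x1 <= x <= x2 -> y1 <= y <= y2 -> ccont f (x, y)).
  { intros x y H1 H2. now apply cdiff_ccont, Hf. }
  apply Cmod_eq_0. apply Rle_antisym; [|apply Cmod_ge_0].
  apply le_epsilon. intros eps Heps. rewrite Rplus_0_l.
  (* A bound proportional to [h^2] adds up exactly over four quarters, [4 (h/2)^2 = h^2], so it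
     passes from the quarters to the whole. *)
  set (P := fun x y h => x1 <= x -> x + W * h <= x2 -> y1 <= y -> y + H * h <= y2 ->
    Cmod (box f x (x + W * h) y (y + H * h)) <= eps * h ^ 2).
  assert (HP : P x1 y1 1).
  { apply (bisection_2d W H P x1 y1 HW HH).
    - intros x y h Hh P1 P2 P3 P4 G1 G2 G3 G4.
      assert (0 <= W * h) by nra. assert (0 <= H * h) by nra.
      unfold P in *.
      replace (x + W * (h / 2) + W * (h / 2)) with (x + W * h) in * by field.
      replace (y + H * (h / 2) + H * (h / 2)) with (y + H * h) in * by field.
      replace (W * (h / 2)) with (W * h / 2) in * by field.
      replace (H * (h / 2)) with (H * h / 2) in * by field.
      specialize (P1 ltac:(lra) ltac:(lra) ltac:(lra) ltac:(lra)).
      specialize (P2 ltac:(lra) ltac:(lra) ltac:(lra) ltac:(lra)).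
      specialize (P3 ltac:(lra) ltac:(lra) ltac:(lra) ltac:(lra)).
      specialize (P4 ltac:(lra) ltac:(lra) ltac:(lra) ltac:(lra)).
      rewrite (box_split_y f x (x + W * h) y (y + H * h / 2) (y + H * h));
        try lra; try (intros; apply Hc; lra).
      rewrite (box_split_x f x (x + W * h / 2) (x + W * h));
        try lra; try (intros; apply Hc; lra).
      rewrite (box_split_x f x (x + W * h / 2) (x + W * h) (y + H * h / 2));
        try lra; try (intros; apply Hc; lra).
      eapply Rle_trans; [apply Cmod_triangle|].
      eapply Rle_trans; [apply Rplus_le_compat; apply Cmod_triangle|].
      replace (eps * (h / 2) ^ 2) with (eps * h ^ 2 / 4) in * by field. lra.
    - intros px py Hpx Hpy.
      assert (D : cdiff f (px, py)) by (apply Hf; unfold W, H in *; lra).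
      destruct (cdiff_approx _ _ D) as [l Hl].
      (* The remainder is at most [e (W + H) h] on the boundary, and [box_bound] multiplies this by
         [4 (W + H) h]. The summand 1 keeps the denominator positive when the rectangle degenerates
         to a point. *)
      set (e := eps / (4 * (W + H) ^ 2 + 1)).
      assert (He0 : 0 < 4 * (W + H) ^ 2 + 1) by (assert (T := pow2_ge_0 (W + H)); lra).
      assert (He : 0 < e) by (apply Rdiv_lt_0_compat; lra).
      destruct (Hl e He) as [d [Hd Hd']].
      assert (Hd0 : 0 < d / (W + H + 1)) by (apply Rdiv_lt_0_compat; lra).
      exists (d / (W + H + 1)). split; trivial.
      intros x y h Hh Bx By G1 G2 G3 G4.
      assert (Hsmall : (W + H) * h < d).
      { apply Rle_lt_trans with ((W + H + 1) * h); [nra|].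
        apply Rlt_le_trans with ((W + H + 1) * (d / (W + H + 1))).
        - apply Rmult_lt_compat_l; lra.
        - right. field. lra. }
      set (k := (f (px, py) - l * (px, py))%C).
      assert (E : box f x (x + W * h) y (y + H * h)
        = box (fun z => f z - f (px, py) - l * (z - (px, py)))%C x (x + W * h) y (y + H * h)).
      { assert (Cf : forall z, boundary x (x + W * h) y (y + H * h) z -> ccont f z).
        { intros [u v] [B1 [B2 _]]. simpl in *. apply Hc; lra. }
        rewrite (box_ext (fun z => f z - f (px, py) - l * (z - (px, py)))%C (fun z => f z + (- k + (- l) * z))%C);
          [|lra|lra|intros z _; unfold k; ring].
        rewrite (box_plus f (fun z => - k + (- l) * z)%C); try lra; trivial.
        - rewrite box_affine by lra. ring.
        - intros z _. apply ccont_plus; [apply ccont_const|].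
          apply ccont_mult; [apply ccont_const|apply ccont_id]. }
      rewrite E.
      assert (B : Cmod (box (fun z => f z - f (px, py) - l * (z - (px, py)))%C x (x + W * h) y (y + H * h))
        <= 4 * (e * ((W + H) * h)) * (x + W * h - x + (y + H * h - y))).
      { apply box_bound; try lra.
        - intros [u v] [B1 [B2 _]]. simpl in *.
          apply ccont_minus; [apply ccont_minus; [apply Hc; lra|apply ccont_const]|].
          apply ccont_mult; [apply ccont_const|]. apply ccont_minus; [apply ccont_id|apply ccont_const].
        - intros [u v] [B1 [B2 _]]. simpl in B1, B2.
          assert (Hdist : Cmod ((u, v) - (px, py))%C <= (W + H) * h).
          { apply Rle_trans with (1 := Cmod_pair_le _ _). simpl.
            assert (Rabs (u + - px) <= W * h) by (apply Rabs_le; lra).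
            assert (Rabs (v + - py) <= H * h) by (apply Rabs_le; lra). lra. }
          apply Rle_trans with (1 := Hd' (u, v) ltac:(lra)).
          apply Rmult_le_compat_l; lra. }
      apply Rle_trans with (1 := B).
      replace (4 * (e * ((W + H) * h)) * (x + W * h - x + (y + H * h - y)))
        with (e * (4 * (W + H) ^ 2) * h ^ 2) by ring.
      apply Rmult_le_compat_r; [apply pow2_ge_0|].
      apply Rle_trans with (e * (4 * (W + H) ^ 2 + 1)); [nra|]. right. unfold e. field. lra. }
  unfold P in HP. rewrite !Rmult_1_r, pow1 in HP.
  replace (x1 + W) with x2 in HP by (unfold W; ring).
  replace (y1 + H) with y2 in HP by (unfold H; ring).
  rewrite Rmult_1_r in HP. apply HP; lra.
Qed.

(** * Cauchy's formula *)

(** Everything outside a square of half-side [e] around [p] is covered by [goursat], and the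
    integral around the square is at most [16 M e], which tends to 0 because [f] is bounded near
    [p]. *)
Lemma goursat_punctured (f : C -> C) (p : C) (x1 x2 y1 y2 M r : R) :
  x1 < fst p < x2 -> y1 < snd p < y2 -> 0 < r ->
  (forall z, x1 <= fst z <= x2 -> y1 <= snd z <= y2 -> z <> p -> cdiff f z) ->
  (forall z, z <> p -> Cmod (z - p)%C < r -> Cmod (f z) <= M) ->
  box f x1 x2 y1 y2 = 0.
Proof.
  destruct p as [px py]. simpl. intros Hx Hy Hr Hf HM.
  assert (HM0 : 0 <= M).
  { apply Rle_trans with (Cmod (f (px + r / 2, py))); [apply Cmod_ge_0|].
    apply HM.
    - intros E. injection E. lra.
    - rewrite Cmod_horizontal, Rabs_pos_eq; lra. }
  assert (Hne : forall x y, x <> px \/ y <> py -> (x, y) <> (px, py)).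
  { intros x y H E. injection E. tauto. }
  assert (Hc : forall x y, x1 <= x <= x2 -> y1 <= y <= y2 -> x <> px \/ y <> py -> ccont f (x, y)).
  { intros x y H1 H2 H3. apply cdiff_ccont, Hf; auto. }
  apply Cmod_eq_0, Rle_antisym; [|apply Cmod_ge_0].
  apply le_epsilon. intros eps Heps. rewrite Rplus_0_l.
  set (e := Rmin (Rmin (Rmin (px - x1) (x2 - px)) (Rmin (py - y1) (y2 - py)))
     (Rmin (r / 4) (eps / (16 * M + 1)))).
  assert (H0 : 0 < eps / (16 * M + 1)) by (apply Rdiv_lt_0_compat; lra).
  assert (He : 0 < e) by (unfold e; repeat apply Rmin_glb_lt; lra).
  assert (He2 : e <= px - x1 /\ e <= x2 - px /\ e <= py - y1 /\ e <= y2 - py /\ e <= r / 4 /\ e <= eps / (16 * M + 1)).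
  { unfold e. repeat split.
    - eapply Rle_trans; [apply Rmin_l|]. eapply Rle_trans; [apply Rmin_l|]. apply Rmin_l.
    - eapply Rle_trans; [apply Rmin_l|]. eapply Rle_trans; [apply Rmin_l|]. apply Rmin_r.
    - eapply Rle_trans; [apply Rmin_l|]. eapply Rle_trans; [apply Rmin_r|]. apply Rmin_l.
    - eapply Rle_trans; [apply Rmin_l|]. eapply Rle_trans; [apply Rmin_r|]. apply Rmin_r.
    - eapply Rle_trans; [apply Rmin_r|]. apply Rmin_l.
    - eapply Rle_trans; [apply Rmin_r|]. apply Rmin_r. }
  clearbody e.
  assert (HG : forall u1 u2 v1 v2, u1 <= u2 -> v1 <= v2 -> x1 <= u1 -> u2 <= x2 -> y1 <= v1 -> v2 <= y2 ->
     (u2 < px \/ px < u1 \/ v2 < py \/ py < v1) -> box f u1 u2 v1 v2 = 0).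
  { intros u1 u2 v1 v2 A1 A2 A3 A4 A5 A6 A7. apply goursat; trivial.
    intros x y Bx By. apply Hf; simpl; try lra. apply Hne. lra. }
  rewrite (box_split_y f x1 x2 y1 (py - e) y2); try lra; try (intros; apply Hc; lra).
  rewrite (box_split_y f x1 x2 (py - e) (py + e) y2); try lra; try (intros; apply Hc; lra).
  rewrite (box_split_x f x1 (px - e) x2 (py - e)); try lra; try (intros; apply Hc; lra).
  rewrite (box_split_x f (px - e) (px + e) x2 (py - e)); try lra; try (intros; apply Hc; lra).
  rewrite (HG x1 x2 y1 (py - e)), (HG x1 (px - e) (py - e) (py + e)),
    (HG (px + e) x2 (py - e) (py + e)), (HG x1 x2 (py + e) y2) by lra.
  rewrite !Cplus_0_l, !Cplus_0_r.
  assert (Hb : forall z, boundary (px - e) (px + e) (py - e) (py + e) z -> z <> (px, py) /\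
     x1 <= fst z <= x2 /\ y1 <= snd z <= y2 /\ Cmod (z - (px, py))%C <= 2 * e).
  { intros [u v] [B1 [B2 B3]]. simpl in *. repeat split; try lra.
    - apply Hne. lra.
    - apply Rle_trans with (1 := Cmod_pair_le _ _). simpl.
      assert (Rabs (u + - px) <= e) by (apply Rabs_le; lra).
      assert (Rabs (v + - py) <= e) by (apply Rabs_le; lra). lra. }
  eapply Rle_trans.
  - apply (box_bound f M); try lra.
    + intros z Hz. destruct (Hb z Hz) as [B1 [B2 [B3 B4]]]. now apply cdiff_ccont, Hf.
    + intros z Hz. destruct (Hb z Hz) as [B1 [B2 [B3 B4]]]. apply HM; trivial. lra.
  - apply Rle_trans with ((16 * M + 1) * e); [lra|].
    apply Rle_trans with ((16 * M + 1) * (eps / (16 * M + 1))).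
    + apply Rmult_le_compat_l; lra.
    + right. field. lra.
Qed.

Lemma Cinv_pair (a b : R) : (/ (a, b))%C = (a / (a ^ 2 + b ^ 2), - b / (a ^ 2 + b ^ 2)).
Proof. reflexivity. Qed.

Lemma CI_pair_eq (f : R -> C) (u v : R -> R) (a b : R) :
  (forall t, f t = (u t, v t)) -> CI f a b = (RInt u a b, RInt v a b).
Proof.
  intros H. unfold CI. f_equal; apply RInt_ext; intros t _; now rewrite H.
Qed.

Lemma RInt_poisson (k a b : R) : 0 < k -> a <= b ->
  RInt (fun t => k / (t ^ 2 + k ^ 2)) a b = atan (b / k) - atan (a / k).
Proof.
  intros Hk Hab. apply is_RInt_unique.
  apply (is_RInt_primitive (fun t => atan (t / k)) (fun t => k / (t ^ 2 + k ^ 2))); trivial.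
  - intros t _. auto_derive; trivial.
    unfold Rsqr. field. simpl in *. split; nra.
  - intros t _. apply continuity_pt_div.
    + apply continuity_pt_const; intros ? ?; reflexivity.
    + apply continuity_pt_plus; [|apply continuity_pt_const; intros ? ?; reflexivity].
      apply derivable_continuous_pt, derivable_pt_pow.
    + nra.
Qed.

Lemma RInt_odd_log (k h : R) : 0 < k -> 0 < h ->
  RInt (fun t => - t / (k ^ 2 + t ^ 2)) (- h) h = 0.
Proof.
  intros Hk Hh. apply is_RInt_unique.
  replace 0 with ((- / 2 * ln (k ^ 2 + h ^ 2)) - (- / 2 * ln (k ^ 2 + (- h) ^ 2))).
  - apply (is_RInt_primitive (fun t => - / 2 * ln (k ^ 2 + t ^ 2)) (fun t => - t / (k ^ 2 + t ^ 2))); [lra| |].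
    + intros t _.
      assert (0 < k ^ 2 + t ^ 2) by nra. simpl in *. auto_derive; [lra|]. field. lra.
    + intros t _. apply continuity_pt_div.
      * apply (continuity_pt_opp (fun t => t)), continuity_pt_id.
      * apply continuity_pt_plus; [apply continuity_pt_const; intros ? ?; reflexivity|].
        apply derivable_continuous_pt, derivable_pt_pow.
      * nra.
  - replace ((- h) ^ 2) with (h ^ 2) by ring. ring.
Qed.

(** All four sides are integrated explicitly. The logarithmic parts cancel by symmetry about the
    real axis; the angles pair off as [atan u + atan (1/u) = pi/2], four times. *)
Lemma box_inv (p X h : R) : 0 < h -> - X < p < X ->
  box (fun z => / (z - RtoC p))%C (- X) X (- h) h = (RtoC (2 * PI) * Ci)%C.
Proof.
  intros Hh Hp. unfold box.
  assert (E : forall x y, (/ ((x, y) - RtoC p))%C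
    = ((x - p) / ((x - p) ^ 2 + y ^ 2), - y / ((x - p) ^ 2 + y ^ 2))).
  { intros x y. rewrite <- Cinv_pair. f_equal. unfold RtoC, Cminus, Cplus, Copp. simpl. f_equal; ring. }
  assert (H1 := CI_pair_eq (fun x => / ((x, Ropp h) - RtoC p))%C
    (fun x => (x - p) / ((x - p) ^ 2 + h ^ 2)) (fun x => h / ((x - p) ^ 2 + h ^ 2)) (- X) X
    ltac:(intros t; cbv beta; rewrite E; replace ((- h) ^ 2) with (h ^ 2) by ring; now rewrite Ropp_involutive)).
  assert (H2 := CI_pair_eq (fun x => / ((x, h) - RtoC p))%C
    (fun x => (x - p) / ((x - p) ^ 2 + h ^ 2)) (fun x => - (h / ((x - p) ^ 2 + h ^ 2))) (- X) X
    ltac:(intros t; cbv beta; rewrite E; f_equal; unfold Rdiv; ring)).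
  assert (H3 := CI_pair_eq (fun y => / ((X, y) - RtoC p))%C
    (fun y => (X - p) / (y ^ 2 + (X - p) ^ 2)) (fun y => - y / ((X - p) ^ 2 + y ^ 2)) (- h) h
    ltac:(intros t; cbv beta; rewrite E; f_equal; f_equal; ring)).
  assert (H4 := CI_pair_eq (fun y => / ((Ropp X, y) - RtoC p))%C
    (fun y => - ((X + p) / (y ^ 2 + (X + p) ^ 2))) (fun y => - y / ((X + p) ^ 2 + y ^ 2)) (- h) h
    ltac:(intros t; cbv beta; rewrite E; replace ((- X - p) ^ 2) with ((X + p) ^ 2) by ring; f_equal;
      rewrite (Rplus_comm (t ^ 2)); unfold Rdiv; ring)).
  rewrite H1, H2, H3, H4.
  assert (EH : RInt (fun x => h / ((x - p) ^ 2 + h ^ 2)) (- X) X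
    = atan ((X - p) / h) + atan ((X + p) / h)).
  { transitivity (atan ((X - p) / h) - atan ((- X - p) / h)).
    - rewrite <- (RInt_poisson h (- X - p) (X - p)) by lra.
      assert (HL := RInt_comp_lin (V := R_CompleteNormedModule)
        (fun t => h / (t ^ 2 + h ^ 2)) 1 (- p) (- X) X).
      replace (1 * - X + - p) with (- X - p) in HL by ring.
      replace (1 * X + - p) with (X - p) in HL by ring.
      rewrite <- HL.
      + apply RInt_ext. intros t _. unfold scal; simpl. unfold mult; simpl.
        rewrite !Rmult_1_l. reflexivity.
      + apply (ex_RInt_continuous (V := R_CompleteNormedModule)). intros t _.
        apply (ex_derive_continuous (fun t => h / (t ^ 2 + h ^ 2))).
        simpl in *. auto_derive. nra.
    - replace ((- X - p) / h) with (- ((X + p) / h)) by (field; lra). rewrite atan_opp. R_eq. ring. }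
  assert (EH' : RInt (fun x => - (h / ((x - p) ^ 2 + h ^ 2))) (- X) X
    = - (atan ((X - p) / h) + atan ((X + p) / h))).
  { rewrite <- EH. apply (RInt_opp (V := R_CompleteNormedModule) (fun x => h / ((x - p) ^ 2 + h ^ 2))).
    apply (ex_RInt_continuous (V := R_CompleteNormedModule)). intros t _.
    apply (ex_derive_continuous (fun t => h / ((t - p) ^ 2 + h ^ 2))).
    assert (0 <= (t - p) ^ 2) by apply pow2_ge_0. unfold Rminus in *. simpl in *. auto_derive. nra. }
  assert (EV : RInt (fun y => (X - p) / (y ^ 2 + (X - p) ^ 2)) (- h) h = 2 * atan (h / (X - p))).
  { rewrite RInt_poisson by lra. unfold Rdiv. rewrite Ropp_mult_distr_l_reverse, atan_opp. R_eq. ring. }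
  assert (EV' : RInt (fun y => - ((X + p) / (y ^ 2 + (X + p) ^ 2))) (- h) h = - (2 * atan (h / (X + p)))).
  { transitivity (- RInt (fun y => (X + p) / (y ^ 2 + (X + p) ^ 2)) (- h) h).
    - apply (RInt_opp (V := R_CompleteNormedModule) (fun y => (X + p) / (y ^ 2 + (X + p) ^ 2))).
      apply (ex_RInt_continuous (V := R_CompleteNormedModule)). intros t _.
      apply (ex_derive_continuous (fun y => (X + p) / (y ^ 2 + (X + p) ^ 2))).
      simpl in *. auto_derive. nra.
    - rewrite RInt_poisson by lra. unfold Rdiv. rewrite Ropp_mult_distr_l_reverse, atan_opp. R_eq. ring. }
  assert (I1 : atan (h / (X - p)) = PI / 2 - atan ((X - p) / h)).
  { rewrite <- (atan_inv ((X - p) / h)) by (apply Rdiv_lt_0_compat; lra). f_equal. field. lra. }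
  assert (I2 : atan (h / (X + p)) = PI / 2 - atan ((X + p) / h)).
  { rewrite <- (atan_inv ((X + p) / h)) by (apply Rdiv_lt_0_compat; lra). f_equal. field. lra. }
  rewrite EH, EH', EV, EV', !RInt_odd_log, I1, I2 by lra.
  unfold RtoC, Ci, Cminus, Cplus, Copp, Cmult. simpl. 
  set (A := RInt _ _ _). change R in (type of A).
  set (u := atan _). set (v := atan _). clearbody A u v.
  f_equal; R_eq; field.
Qed.

(** The slope [(Q z - Q p)/(z - p)] is bounded near [p], so [goursat_punctured] makes its integral
    vanish; what remains is a multiple of [box_inv]. *)
Lemma cauchy_formula (Q : C -> C) (p X h : R) : 0 < h -> - X < p < X ->
  (forall z, - X <= fst z <= X -> - h <= snd z <= h -> cdiff Q z) ->
  box (fun z => Q z / (z - RtoC p))%C (- X) X (- h) h = (RtoC (2 * PI) * Ci * Q (RtoC p))%C.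
Proof.
  intros Hh Hp HQ.
  assert (Hb : forall z, boundary (- X) X (- h) h z ->
     - X <= fst z <= X /\ - h <= snd z <= h /\ (z - RtoC p)%C <> 0).
  { intros [u v] [B1 [B2 B3]]. simpl in *. repeat split; try lra.
    intros E. injection E. intros. lra. }
  assert (Cinvp : forall z, (z - RtoC p)%C <> 0 -> cdiff (fun z => (/ (z - RtoC p))%C) z).
  { intros z Hz. apply cdiff_inv; trivial. apply cdiff_minus; [apply cdiff_id|apply cdiff_const]. }
  set (G := fun z => ((Q z - Q (RtoC p)) / (z - RtoC p))%C).
  assert (HG : box G (- X) X (- h) h = 0).
  { destruct (HQ (RtoC p) ltac:(simpl; lra) ltac:(simpl; lra)) as [g [d [Hd [E Hg]]]].
    destruct (Hg 1 Rlt_0_1) as [d2 [Hd2 H2]].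
    apply (goursat_punctured G (RtoC p) (- X) X (- h) h (Cmod (g (RtoC p)) + 1) (Rmin d d2));
      simpl; try lra.
    - now apply Rmin_glb_lt.
    - intros z B1 B2 Hz. apply cdiff_mult.
      + apply cdiff_minus; [now apply HQ|apply cdiff_const].
      + apply Cinvp. now apply Cminus_eq_contra.
    - intros z Hz Hr. assert (M1 := Rmin_l d d2). assert (M2 := Rmin_r d d2).
      unfold G. rewrite E by lra.
      replace (g z * (z - RtoC p) / (z - RtoC p))%C with (g (RtoC p) + (g z - g (RtoC p)))%C
        by (field; now apply Cminus_eq_contra).
      apply Rle_trans with (1 := Cmod_triangle _ _).
      apply Rplus_le_compat_l. left. apply H2. lra. }
  rewrite (box_ext _ (fun z => G z + Q (RtoC p) * / (z - RtoC p))%C); [|lra|lra|].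
  - rewrite box_plus; try lra.
    + rewrite HG, box_scal, box_inv by (lra || (intros z Hz; apply cdiff_ccont, Cinvp; now apply Hb)).
      ring.
    + intros z Hz. destruct (Hb z Hz) as [B1 [B2 B3]]. apply cdiff_ccont, cdiff_mult; [|now apply Cinvp].
      apply cdiff_minus; [now apply HQ|apply cdiff_const].
    + intros z Hz. destruct (Hb z Hz) as [B1 [B2 B3]]. apply ccont_mult; [apply ccont_const|].
      now apply cdiff_ccont, Cinvp.
  - intros z Hz. destruct (Hb z Hz) as [B1 [B2 B3]]. unfold G. field. exact B3.
Qed.

(** * Residues at simple poles on the real line *)

Definition Cprod_over (l : list Z) (F : Z -> C) : C :=
  fold_right (fun k s => (F k * s)%C) (RtoC 1) l.

Lemma Csum_over_ext (l : list Z) (F G : Z -> C) :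
  (forall k, In k l -> F k = G k) -> Csum_over l F = Csum_over l G.
Proof.
  induction l as [|a l IH]; intros H; trivial. simpl.
  rewrite IH, (H a); auto with datatypes.
Qed.

Lemma Cprod_over_ext (l : list Z) (F G : Z -> C) :
  (forall k, In k l -> F k = G k) -> Cprod_over l F = Cprod_over l G.
Proof.
  induction l as [|a l IH]; intros H; trivial. simpl.
  rewrite IH, (H a); auto with datatypes.
Qed.

Lemma Csum_over_scal (l : list Z) (c : C) (F : Z -> C) :
  Csum_over l (fun k => c * F k)%C = (c * Csum_over l F)%C.
Proof. induction l as [|a l IH]; simpl; [ring|rewrite IH; ring]. Qed.

Lemma Csum_over_plus (l : list Z) (F G : Z -> C) :
  Csum_over l (fun k => F k + G k)%C = (Csum_over l F + Csum_over l G)%C.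
Proof. induction l as [|a l IH]; simpl; [ring|rewrite IH; ring]. Qed.

Lemma Cprod_over_mult (l : list Z) (F G : Z -> C) :
  Cprod_over l (fun k => F k * G k)%C = (Cprod_over l F * Cprod_over l G)%C.
Proof. induction l as [|a l IH]; simpl; [ring|rewrite IH; ring]. Qed.

Lemma Cprod_over_neq_0 (l : list Z) (F : Z -> C) :
  (forall k, In k l -> F k <> 0) -> Cprod_over l F <> 0.
Proof.
  induction l as [|a l IH]; intros H; simpl; [apply C1_nz|].
  apply Cmult_neq_0; [apply H; now left|]. apply IH. intros k Hk. apply H. now right.
Qed.

Lemma Cprod_over_RtoC (l : list Z) (F : Z -> R) :
  Cprod_over l (fun k => RtoC (F k)) = RtoC (Rprod_over l F).
Proof.
  induction l as [|a l IH]; trivial. simpl. rewrite IH. now rewrite <- RtoC_mult.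
Qed.

Lemma cdiff_Cprod_over (l : list Z) (F : Z -> C -> C) (z : C) :
  (forall k, In k l -> cdiff (F k) z) -> cdiff (fun w => Cprod_over l (fun k => F k w)) z.
Proof.
  induction l as [|a l IH]; intros H; simpl; [apply cdiff_const|].
  apply cdiff_mult; [apply H; now left|]. apply IH. intros k Hk. apply H. now right.
Qed.

Lemma remove_cons_neq (a k : Z) (l : list Z) : k <> a ->
  remove Z.eq_dec k (a :: l) = a :: remove Z.eq_dec k l.
Proof. intros H. simpl. now destruct (Z.eq_dec k a). Qed.

(** By induction on the list; the coefficient at the new pole [p a] is the induction hypothesis
    evaluated at [p a]. For the empty list the left side would be 1 and the right side 0. *)
Lemma partial_fractions (p : Z -> C) (l : list Z) (z : C) : l <> nil -> NoDup l ->
  (forall j k, In j l -> In k l -> p j = p k -> j = k) ->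
  (forall k, In k l -> z <> p k) ->
  (/ Cprod_over l (fun k => z - p k))%C = Csum_over l (fun k =>
     / Cprod_over (remove Z.eq_dec k l) (fun j => p k - p j) * / (z - p k))%C.
Proof.
  revert z. induction l as [|a l IH]; intros z Hne Hnd Hinj Hz; [now elim Hne|].
  destruct l as [|b l'].
  - simpl. destruct (Z.eq_dec a a) as [_|H]; [|now elim H]. simpl.
    assert (H : (z - p a)%C <> 0) by (apply Cminus_eq_contra, Hz; now left).
    field. repeat split; trivial.
  - set (l := b :: l') in *.
    inversion_clear Hnd as [|? ? Hni Hnd'].
    assert (Hinj' : forall j k, In j l -> In k l -> p j = p k -> j = k).
    { intros j k Hj Hk. apply Hinj; now right. }
    assert (Hne' : l <> nil) by discriminate.
    assert (Hpa : forall k, In k l -> p a <> p k).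
    { intros k Hk E. apply Hinj in E; [|now left|now right]. now subst k. }
    assert (Hza : (z - p a)%C <> 0) by (apply Cminus_eq_contra, Hz; now left).
    assert (IHz := IH z Hne' Hnd' Hinj' (fun k Hk => Hz k (or_intror Hk))).
    assert (IHa := IH (p a) Hne' Hnd' Hinj' Hpa).
    assert (HPz : Cprod_over l (fun k => z - p k)%C <> 0).
    { apply Cprod_over_neq_0. intros k Hk. apply Cminus_eq_contra, Hz. now right. }
    change (Cprod_over (a :: l) (fun k => z - p k)%C) with
      ((z - p a) * Cprod_over l (fun k => z - p k))%C.
    replace (/ ((z - p a) * Cprod_over l (fun k => (z - p k)%C)))%C
      with (/ (z - p a) * / Cprod_over l (fun k => (z - p k)%C))%C by (field; auto).
    rewrite IHz.
    change (Csum_over (a :: l) ?F) with (F a + Csum_over l F)%C. cbv beta.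
    assert (Er : remove Z.eq_dec a (a :: l) = l).
    { simpl. destruct (Z.eq_dec a a) as [_|H]; [|now elim H].
      destruct (Z.eq_dec a b) as [->|_]; [elim Hni; now left|].
      unfold l. f_equal. apply notin_remove. intros H. apply Hni. now right. }
    rewrite Er, IHa.
    rewrite <- Csum_over_scal.
    rewrite (Cmult_comm (Csum_over l _) (/ (z - p a))), <- Csum_over_scal, <- Csum_over_plus.
    apply Csum_over_ext. intros k Hk.
    assert (Hka : k <> a) by (intros ->; now apply Hni).
    rewrite remove_cons_neq by trivial.
    change (Cprod_over (a :: remove Z.eq_dec k l) (fun j => p k - p j)%C) with
      ((p k - p a) * Cprod_over (remove Z.eq_dec k l) (fun j => p k - p j))%C.
    assert (HD : Cprod_over (remove Z.eq_dec k l) (fun j => (p k - p j)%C) <> 0).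
    { apply Cprod_over_neq_0. intros j Hj. apply in_remove in Hj. destruct Hj as [Hj Hjk].
      apply Cminus_eq_contra. intros E. apply Hjk. symmetry. now apply Hinj'. }
    assert (H1 : (p k - p a)%C <> 0) by (apply Cminus_eq_contra; intros E; now apply (Hpa k)).
    assert (H2 : (p a - p k)%C <> 0) by (apply Cminus_eq_contra; now apply Hpa).
    assert (H3 : (z - p k)%C <> 0) by (apply Cminus_eq_contra, Hz; now right).
    field. repeat split; trivial.
Qed.

Lemma box_sum (l : list Z) (F : Z -> C -> C) (x1 x2 y1 y2 : R) : x1 <= x2 -> y1 <= y2 ->
  (forall k z, In k l -> boundary x1 x2 y1 y2 z -> ccont (F k) z) ->
  box (fun z => Csum_over l (fun k => F k z)) x1 x2 y1 y2
  = Csum_over l (fun k => box (F k) x1 x2 y1 y2).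
Proof.
  intros Hx Hy. induction l as [|a l IH]; intros H; simpl.
  - rewrite (box_ext _ (fun z => 0 + 0 * z)%C) by (trivial; intros; ring).
    now apply box_affine.
  - rewrite box_plus; trivial.
    + rewrite IH; trivial. intros k z Hk. apply H. now right.
    + intros z Hz. apply (H a); [now left|trivial].
    + intros z Hz. assert (H' : forall k, In k l -> ccont (F k) z) by (intros k Hk; apply H; [now right|trivial]).
      clear -H'. induction l as [|b l IH]; simpl; [apply ccont_const|].
      apply ccont_plus; [apply H'; now left|]. apply IH. intros k Hk. apply H'. now right.
Qed.

(** Partial fractions separate the poles, and Cauchy's formula is applied on the same rectangle for
    each of them, so that no contour has to be deformed. *)
Lemma residue_sum (Q : C -> C) (p : Z -> R) (l : list Z) (X h : R) : 0 < h ->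
  l <> nil -> NoDup l ->
  (forall j k, In j l -> In k l -> p j = p k -> j = k) ->
  (forall k, In k l -> - X < p k < X) ->
  (forall z, - X <= fst z <= X -> - h <= snd z <= h -> cdiff Q z) ->
  box (fun z => Q z / Cprod_over l (fun k => z - RtoC (p k)))%C (- X) X (- h) h
  = (RtoC (2 * PI) * Ci * Csum_over l (fun k =>
       Q (RtoC (p k)) / RtoC (Rprod_over (remove Z.eq_dec k l) (fun j => p k - p j)%R)))%C.
Proof.
  intros Hh Hne Hnd Hinj Hp HQ.
  assert (HX : - X < X).
  { destruct l as [|a l]; [now elim Hne|]. specialize (Hp a (or_introl eq_refl)). lra. }
  assert (Hb : forall z k, In k l -> boundary (- X) X (- h) h z ->
     - X <= fst z <= X /\ - h <= snd z <= h /\ z <> RtoC (p k)).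
  { intros [u v] k Hk [B1 [B2 B3]]. simpl in *. specialize (Hp k Hk).
    repeat split; try lra. intros E. injection E. intros. lra. }
  set (D := fun k => Cprod_over (remove Z.eq_dec k l) (fun j => RtoC (p k) - RtoC (p j))%C).
  assert (Hcc : forall k z, In k l -> boundary (- X) X (- h) h z ->
    ccont (fun z => Q z / (z - RtoC (p k)))%C z).
  { intros k z Hk Hz. destruct (Hb z k Hk Hz) as [B1 [B2 B3]].
    apply cdiff_ccont, cdiff_div; [now apply HQ| |now apply Cminus_eq_contra].
    apply cdiff_minus; [apply cdiff_id|apply cdiff_const]. }
  rewrite (box_ext _ (fun z => Csum_over l (fun k => / D k * (Q z / (z - RtoC (p k))))%C)); [|lra|lra|].
  - rewrite (box_sum l (fun k z => / D k * (Q z / (z - RtoC (p k))))%C); [|lra|lra|].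
    + rewrite <- Csum_over_scal. apply Csum_over_ext. intros k Hk.
      rewrite (box_scal (/ D k) (fun z => Q z / (z - RtoC (p k)))%C); [|lra|lra|auto].
      rewrite cauchy_formula by auto. unfold D.
      rewrite (Cprod_over_ext _ _ (fun j => RtoC (p k - p j)))
        by (intros; now rewrite RtoC_minus).
      rewrite Cprod_over_RtoC. unfold Cdiv. ring.
    + intros k z Hk Hz. apply ccont_mult; [apply ccont_const|]. now apply Hcc.
  - intros z Hz. unfold Cdiv. rewrite (partial_fractions (fun k => RtoC (p k))); trivial.
    + rewrite <- Csum_over_scal. apply Csum_over_ext. intros k Hk. unfold D. ring.
    + intros j k Hj Hk E. apply Hinj; trivial. now injection E.
    + intros k Hk. now apply (Hb z k).
Qed.

(** * Exponential, hyperbolic functions and powers *)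

Lemma Cexp_plus (z w : C) : Cexp (z + w)%C = (Cexp z * Cexp w)%C.
Proof.
  destruct z as [a b], w as [u v]. unfold Cexp, Cmult, Cplus, Re, Im. simpl.
  rewrite exp_plus, cos_plus, sin_plus. f_equal; ring.
Qed.

Lemma Cexp_0 : Cexp 0 = 1.
Proof. unfold Cexp, RtoC, Re, Im. simpl. rewrite exp_0, cos_0, sin_0. f_equal; ring. Qed.

Lemma Cmod_Cexp (z : C) : Cmod (Cexp z) = exp (Re z).
Proof.
  unfold Cmod, Cexp. simpl fst. simpl snd.
  replace ((exp (Re z) * cos (Im z)) ^ 2 + (exp (Re z) * sin (Im z)) ^ 2) with (exp (Re z) ^ 2).
  - apply sqrt_pow2. apply Rlt_le, exp_pos.
  - assert (H := sin2_cos2 (Im z)). unfold Rsqr in H.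
    transitivity (exp (Re z) ^ 2 * (sin (Im z) * sin (Im z) + cos (Im z) * cos (Im z)));
      [rewrite H; ring|ring].
Qed.

Lemma Cexp_neq_0 (z : C) : Cexp z <> 0.
Proof. apply Cmod_gt_0. rewrite Cmod_Cexp. apply exp_pos. Qed.

Lemma Cexp_opp (z : C) : Cexp (- z)%C = (/ Cexp z)%C.
Proof.
  assert (H : (Cexp z * Cexp (- z))%C = 1).
  { rewrite <- Cexp_plus, Cplus_opp_r. apply Cexp_0. }
  assert (H0 := Cexp_neq_0 z).
  transitivity (/ Cexp z * (Cexp z * Cexp (- z)))%C; [field; trivial|]. rewrite H. ring.
Qed.

Lemma Cexp_RtoC (x : R) : Cexp (RtoC x) = RtoC (exp x).
Proof. unfold Cexp, RtoC, Re, Im. simpl. rewrite cos_0, sin_0. f_equal; ring. Qed.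

Lemma path_derive_bound (F F' : R -> C) (K : R) :
  (forall t, 0 <= t <= 1 -> is_derive (fun t => Re (F t)) t (Re (F' t))) ->
  (forall t, 0 <= t <= 1 -> is_derive (fun t => Im (F t)) t (Im (F' t))) ->
  (forall t, 0 <= t <= 1 -> Cmod (F' t) <= K) -> F 0 = 0 ->
  forall t, 0 <= t <= 1 -> Cmod (F t) <= 2 * K.
Proof.
  intros HR HI HK H0 t Ht.
  assert (HK0 : 0 <= K) by (apply Rle_trans with (1 := Cmod_ge_0 (F' 0)), HK; lra).
  assert (G : forall g g' : R -> R, (forall t, 0 <= t <= 1 -> is_derive g t (g' t)) ->
    (forall t, 0 <= t <= 1 -> Rabs (g' t) <= K) -> g 0 = 0 -> Rabs (g t) <= K).
  { intros g g' Hg Hb Hg0.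
    assert (L1 : g 0 - K * 0 <= g t + K * t /\ g t - K * t <= g 0 - K * 0).
    { split.
      - assert (g 0 + K * 0 <= g t + K * t); [|lra].
        apply (derive_nonneg_le_closed (fun s => g s + K * s) (fun s => g' s + K)); [lra| |].
        + intros s Hs. apply (is_derive_plus g (fun s => K * s)); [apply Hg; lra|].
          auto_derive; trivial. ring.
        + intros s Hs. specialize (Hb s ltac:(lra)). apply Rabs_le_between in Hb. lra.
      - assert (K * 0 - g 0 <= K * t - g t); [|lra].
        apply (derive_nonneg_le_closed (fun s => K * s - g s) (fun s => K - g' s)); [lra| |].
        + intros s Hs. apply (is_derive_minus (fun s => K * s) g); [|apply Hg; lra].
          auto_derive; trivial. ring.
        + intros s Hs. specialize (Hb s ltac:(lra)). apply Rabs_le_between in Hb. lra. }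
    apply Rabs_le. nra. }
  apply Rle_trans with (1 := Cmod_le_Re_Im _).
  assert (B1 := G _ _ HR ltac:(intros s Hs; apply Rle_trans with (2 := HK s Hs); apply re_le_Cmod)
    ltac:(cbv beta; rewrite H0; reflexivity)).
  assert (B2 := G _ _ HI ltac:(intros s Hs; apply Rle_trans with (2 := HK s Hs); apply Rabs_Im_le)
    ltac:(cbv beta; rewrite H0; reflexivity)).
  simpl in B1, B2. lra.
Qed.

(** Along [t -> t w] the derivative of each remainder is [w] times the preceding one. From
    [|exp| <= 3] on the unit disc, each use of [path_derive_bound] brings a factor [2 |w|], whence
    the constants 6, 12 and 24. *)
Lemma Cexp_taylor (w : C) : Cmod w <= 1 ->
  Cmod (Cexp w - 1 - w)%C <= 12 * Cmod w ^ 2 /\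
  Cmod (Cexp w - 1 - w - w * w / 2)%C <= 24 * Cmod w ^ 3.
Proof.
  intros Hw. assert (Hw0 := Cmod_ge_0 w).
  set (E := fun t => Cexp (t * Re w, t * Im w)).
  assert (EE : forall t, E t = Cexp (RtoC t * w)%C).
  { intros t. unfold E. f_equal. destruct w as [a b].
    unfold Cmult, RtoC, Re, Im. simpl. f_equal; ring. }
  assert (HE : forall t, 0 <= t <= 1 -> Cmod (w * E t)%C <= 3 * Cmod w).
  { intros t Ht. rewrite Cmod_mult, EE, Cmod_Cexp.
    assert (exp (Re (RtoC t * w)%C) <= 3); [|nra].
    apply Rle_trans with (2 := exp_le_3).
    assert (Re (RtoC t * w)%C <= 1).
    { apply Rle_trans with (1 := Rle_abs _). apply Rle_trans with (1 := re_le_Cmod _).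
      rewrite Cmod_mult, Cmod_R, Rabs_pos_eq by lra. nra. }
    destruct (Rle_lt_or_eq_dec _ _ H) as [H1|H1]; [left; now apply exp_increasing|right; now rewrite H1]. }
  assert (E1 : forall t, 0 <= t <= 1 -> Cmod (E t - 1)%C <= 2 * (3 * Cmod w)).
  { apply (path_derive_bound (fun t => (E t - 1)%C) (fun t => (w * E t)%C)); trivial.
    - intros t _. destruct w as [a b]. unfold E, Cexp, Cmult, Cminus, Cplus, Copp, RtoC, Re, Im. simpl.
      auto_derive; trivial. ring.
    - intros t _. destruct w as [a b]. unfold E, Cexp, Cmult, Cminus, Cplus, Copp, RtoC, Re, Im. simpl.
      auto_derive; trivial. ring.
    - rewrite EE, Cmult_0_l, Cexp_0. ring. }
  assert (E2 : forall t, 0 <= t <= 1 -> Cmod (E t - 1 - RtoC t * w)%C <= 2 * (Cmod w * (2 * (3 * Cmod w)))).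
  { apply (path_derive_bound (fun t => (E t - 1 - RtoC t * w)%C) (fun t => (w * (E t - 1))%C)).
    - intros t _. destruct w as [a b]. unfold E, Cexp, Cmult, Cminus, Cplus, Copp, RtoC, Re, Im. simpl.
      auto_derive; trivial. ring.
    - intros t _. destruct w as [a b]. unfold E, Cexp, Cmult, Cminus, Cplus, Copp, RtoC, Re, Im. simpl.
      auto_derive; trivial. ring.
    - intros t Ht. rewrite Cmod_mult. apply Rmult_le_compat_l; auto.
    - rewrite EE, Cmult_0_l, Cexp_0. ring. }
  assert (E3 : forall t, 0 <= t <= 1 -> Cmod (E t - 1 - RtoC t * w - RtoC (t ^ 2 / 2) * (w * w))%C
     <= 2 * (Cmod w * (2 * (Cmod w * (2 * (3 * Cmod w)))))).
  { apply (path_derive_bound (fun t => (E t - 1 - RtoC t * w - RtoC (t ^ 2 / 2) * (w * w))%C)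
      (fun t => (w * (E t - 1 - RtoC t * w))%C)).
    - intros t _. destruct w as [a b]. unfold E, Cexp, Cmult, Cminus, Cplus, Copp, RtoC, Re, Im. simpl.
      auto_derive; trivial. field.
    - intros t _. destruct w as [a b]. unfold E, Cexp, Cmult, Cminus, Cplus, Copp, RtoC, Re, Im. simpl.
      auto_derive; trivial. field.
    - intros t Ht. rewrite Cmod_mult. apply Rmult_le_compat_l; auto.
    - rewrite EE, Cmult_0_l, Cexp_0. replace (0 ^ 2 / 2) with 0 by field. ring. }
  specialize (E2 1 ltac:(lra)). specialize (E3 1 ltac:(lra)).
  rewrite EE, Cmult_1_l in E2, E3. split.
  - apply Rle_trans with (1 := E2). right. ring.
  - replace (w * w / 2)%C with (RtoC (1 ^ 2 / 2) * (w * w))%C.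
    + apply Rle_trans with (1 := E3). right. ring.
    + replace (1 ^ 2 / 2) with (/ 2) by field. rewrite RtoC_inv by lra. unfold Cdiv. ring.
Qed.

(** The value of the factor at [z] is kept, because the logarithm is differentiated by inverting
    this factor and needs it to be nonzero. *)
Lemma Cexp_caratheodory (z : C) : exists g : C -> C, g z = Cexp z /\
  (forall w, (Cexp w - Cexp z = g w * (w - z))%C) /\ ccont g z.
Proof.
  apply caratheodory_of_approx. intros eps Heps.
  assert (Hz := exp_pos (Re z)).
  set (d := Rmin 1 (eps / (12 * exp (Re z)))).
  assert (H0 : 0 < eps / (12 * exp (Re z))) by (apply Rdiv_lt_0_compat; lra).
  exists d. split; [apply Rmin_glb_lt; lra|].
  intros w Hw. assert (M1 := Rmin_l 1 (eps / (12 * exp (Re z)))).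
  assert (M2 := Rmin_r 1 (eps / (12 * exp (Re z)))). fold d in M1, M2.
  replace (Cexp w - Cexp z - Cexp z * (w - z))%C with (Cexp z * (Cexp (w - z) - 1 - (w - z)))%C.
  - rewrite Cmod_mult, Cmod_Cexp.
    assert (T := proj1 (Cexp_taylor (w - z) ltac:(lra))).
    assert (P := Cmod_ge_0 (w - z)%C). set (m := Cmod (w - z)%C) in *.
    apply Rle_trans with (exp (Re z) * (12 * m ^ 2)); [apply Rmult_le_compat_l; lra|].
    replace (exp (Re z) * (12 * m ^ 2)) with (12 * exp (Re z) * m * m) by ring.
    apply Rmult_le_compat_r; trivial.
    apply Rle_trans with (12 * exp (Re z) * (eps / (12 * exp (Re z)))).
    + apply Rmult_le_compat_l; lra.
    + right. field. lra.
  - assert (E : Cexp w = (Cexp z * Cexp (w - z))%C) by (rewrite <- Cexp_plus; f_equal; ring).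
    rewrite E. ring.
Qed.

Lemma cdiff_Cexp (z : C) : cdiff Cexp z.
Proof.
  destruct (Cexp_caratheodory z) as [g [_ [E Hg]]].
  exists g, 1. split; [lra|]. auto.
Qed.

Definition Csinh (z : C) : C := ((Cexp z - Cexp (- z)) / 2)%C.
Definition Ccosh (z : C) : C := ((Cexp z + Cexp (- z)) / 2)%C.

Lemma C2_neq_0 : RtoC 2 <> 0.
Proof. intros E. injection E. lra. Qed.

Lemma Csinh_pair (a b : R) : Csinh (a, b) = (sinh a * cos b, cosh a * sin b).
Proof.
  unfold Csinh, Cexp, sinh, cosh, Cdiv, Cinv, Cmult, Cminus, Cplus, Copp, RtoC, Re, Im. simpl.
  rewrite cos_neg, sin_neg. f_equal; field.
Qed.

Lemma Ccosh_pair (a b : R) : Ccosh (a, b) = (cosh a * cos b, sinh a * sin b).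
Proof.
  unfold Ccosh, Cexp, sinh, cosh, Cdiv, Cinv, Cmult, Cminus, Cplus, Copp, RtoC, Re, Im. simpl.
  rewrite cos_neg, sin_neg. f_equal; field.
Qed.

Lemma Cmod2_Csinh (a b : R) : Cmod (Csinh (a, b)) ^ 2 = sinh a ^ 2 + sin b ^ 2.
Proof.
  rewrite Cmod2_alt, Csinh_pair. simpl Re. simpl Im.
  assert (H := sin2_cos2 b). unfold Rsqr in H. assert (H1 := cosh2_minus_sinh2 a).
  replace ((cosh a * sin b) ^ 2) with ((cosh a ^ 2 - sinh a ^ 2 + sinh a ^ 2) * sin b ^ 2) by ring.
  rewrite H1. replace (sin b ^ 2) with (1 - cos b * cos b) by (rewrite <- H; ring). ring.
Qed.

Lemma Cmod2_Ccosh (a b : R) : Cmod (Ccosh (a, b)) ^ 2 = sinh a ^ 2 + cos b ^ 2.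
Proof.
  rewrite Cmod2_alt, Ccosh_pair. simpl Re. simpl Im.
  assert (H := sin2_cos2 b). unfold Rsqr in H. assert (H1 := cosh2_minus_sinh2 a).
  replace ((cosh a * cos b) ^ 2) with ((cosh a ^ 2 - sinh a ^ 2 + sinh a ^ 2) * cos b ^ 2) by ring.
  rewrite H1. replace ((sinh a * sin b) ^ 2) with (sinh a ^ 2 * (1 - cos b * cos b)) by (rewrite <- H; ring). ring.
Qed.

Lemma Ctanh_eq (z : C) : Ctanh z = (Csinh z / Ccosh z)%C.
Proof.
  unfold Ctanh, Csinh, Ccosh.
  (* Where the denominator vanishes both quotients are 0, as the inverse of 0 is 0. *)
  destruct (Ceq_dec (Cexp z + Cexp (- z))%C 0) as [E|E].
  - rewrite E. unfold Cdiv. replace (0 * / 2)%C with (RtoC 0) by ring.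
    replace (/ 0)%C with (RtoC 0).
    + ring.
    + unfold Cinv, RtoC. simpl. f_equal; unfold Rdiv; ring.
  - field. trivial.
Qed.

Lemma Ccosh2_minus_Csinh2 (z : C) : (Ccosh z * Ccosh z - Csinh z * Csinh z)%C = 1.
Proof.
  unfold Ccosh, Csinh. rewrite Cexp_opp. field. apply Cexp_neq_0.
Qed.

Lemma one_minus_Ctanh2 (z : C) : Ccosh z <> 0 ->
  (1 - Ctanh z * Ctanh z)%C = (/ (Ccosh z * Ccosh z))%C.
Proof.
  intros H. rewrite Ctanh_eq.
  replace (1 - Csinh z / Ccosh z * (Csinh z / Ccosh z))%C
    with ((Ccosh z * Ccosh z - Csinh z * Csinh z) / (Ccosh z * Ccosh z))%C by (field; trivial).
  rewrite Ccosh2_minus_Csinh2. field. trivial.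
Qed.

Lemma Csinh_RtoC (x : R) : Csinh (RtoC x) = RtoC (sinh x).
Proof. unfold RtoC. rewrite Csinh_pair, cos_0, sin_0. f_equal; ring. Qed.

Lemma Ccosh_RtoC (x : R) : Ccosh (RtoC x) = RtoC (cosh x).
Proof. unfold RtoC. rewrite Ccosh_pair, cos_0, sin_0. f_equal; ring. Qed.

Lemma Ctanh_RtoC (x : R) : Ctanh (RtoC x) = RtoC (tanh x).
Proof.
  rewrite Ctanh_eq, Csinh_RtoC, Ccosh_RtoC. unfold tanh.
  rewrite RtoC_div; trivial. apply Rgt_not_eq, cosh_pos.
Qed.

Lemma cdiff_Csinh (z : C) : cdiff Csinh z.
Proof.
  apply cdiff_mult; [|apply cdiff_const].
  apply cdiff_minus; [apply cdiff_Cexp|].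
  apply (cdiff_comp (fun w => (- w)%C) Cexp); [apply cdiff_opp, cdiff_id|apply cdiff_Cexp].
Qed.

Lemma cdiff_Ccosh (z : C) : cdiff Ccosh z.
Proof.
  apply cdiff_mult; [|apply cdiff_const].
  apply cdiff_plus; [apply cdiff_Cexp|].
  apply (cdiff_comp (fun w => (- w)%C) Cexp); [apply cdiff_opp, cdiff_id|apply cdiff_Cexp].
Qed.

(** The entire function [sinh z / z]. It carries what remains of [Csinh] once the zero at the pole
    is split off. *)
Definition sinhc (z : C) : C := if Ceq_dec z 0 then RtoC 1 else (Csinh z / z)%C.

Lemma Csinh_sinhc (z : C) : Csinh z = (z * sinhc z)%C.
Proof.
  unfold sinhc. destruct (Ceq_dec z 0) as [->|H].
  - rewrite Csinh_RtoC, sinh_0. ring.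
  - field. trivial.
Qed.

Lemma sinhc_neq_0 (z : C) : (z <> 0 -> Csinh z <> 0) -> sinhc z <> 0.
Proof.
  intros H E. assert (H1 := Csinh_sinhc z). rewrite E, Cmult_0_r in H1.
  destruct (Ceq_dec z 0) as [->|Hz].
  - unfold sinhc in E. destruct (Ceq_dec 0 0) as [_|N]; [now apply C1_nz|now apply N].
  - now apply H.
Qed.

Lemma cdiff_sinhc (z : C) : cdiff sinhc z.
Proof.
  destruct (Ceq_dec z 0) as [->|Hz].
  - apply (cdiff_of_approx sinhc 0 0). intros eps Heps.
    exists (Rmin 1 (eps / 24)). split; [apply Rmin_glb_lt; lra|].
    intros w Hw. replace (w - 0)%C with w in * by ring.
    assert (M1 := Rmin_l 1 (eps / 24)). assert (M2 := Rmin_r 1 (eps / 24)).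
    assert (P := Cmod_ge_0 w).
    replace (sinhc w - sinhc 0 - 0 * w)%C with (sinhc w - 1)%C
      by (unfold sinhc; destruct (Ceq_dec 0 0) as [_|N]; [ring|now elim N]).
    destruct (Ceq_dec w 0) as [->|Hw0].
    + unfold sinhc. destruct (Ceq_dec 0 0) as [_|N]; [|now elim N].
      rewrite Cmod_sub_diag. nra.
    + assert (P0 := proj1 (Cmod_gt_0 _) Hw0).
      apply Rmult_le_reg_l with (Cmod w); trivial. rewrite <- Cmod_mult.
      replace (w * (sinhc w - 1))%C with (Csinh w - w)%C by (rewrite Csinh_sinhc; ring).
      (* The quadratic Taylor terms of [exp w] and [exp (-w)] cancel, so the difference is of third
         order and the derivative of [sinhc] at 0 is 0. *)
      replace (Csinh w - w)%C with
        (((Cexp w - 1 - w - w * w / 2) + - (Cexp (- w) - 1 - (- w) - (- w) * (- w) / 2)) / 2)%C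
        by (unfold Csinh; field).
      rewrite Cmod_div, Cmod_R, Rabs_pos_eq by (try apply C2_neq_0; lra).
      assert (T1 := proj2 (Cexp_taylor w ltac:(lra))).
      assert (T2 := proj2 (Cexp_taylor (- w) ltac:(rewrite Cmod_opp; lra))).
      assert (T := Cmod_triangle (Cexp w - 1 - w - w * w / 2) (- (Cexp (- w) - 1 - (- w) - (- w) * (- w) / 2))).
      rewrite !Cmod_opp in *.
      apply Rle_trans with (24 * Cmod w ^ 3); [lra|].
      replace (24 * Cmod w ^ 3) with (Cmod w * (24 * Cmod w * Cmod w)) by ring.
      apply Rmult_le_compat_l; [lra|]. apply Rmult_le_compat_r; lra.
  - assert (P0 := proj1 (Cmod_gt_0 _) Hz).
    apply cdiff_ext_loc with (fun w => Csinh w / w)%C (Cmod z); trivial.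
    + intros w Hw. unfold sinhc. destruct (Ceq_dec w 0) as [->|N]; trivial.
      exfalso. replace (0 - z)%C with (- z)%C in Hw by ring. rewrite Cmod_opp in Hw. lra.
    + apply cdiff_div; trivial; [apply cdiff_Csinh|apply cdiff_id].
Qed.

(* The principal logarithm, for [Re z > 0] only. *)
Definition Clog (z : C) : C := (ln (Cmod z), atan (Im z / Re z)).

Lemma Cexp_Clog (z : C) : 0 < Re z -> Cexp (Clog z) = z.
Proof.
  destruct z as [a b]. unfold Clog, Cexp, Re, Im. simpl. intros Ha.
  assert (Hm : 0 < Cmod (a, b)) by (apply Cmod_gt_0; intros E; injection E; intros; lra).
  rewrite exp_ln by trivial. rewrite cos_atan, sin_atan.
  assert (E : Cmod (a, b) = a * sqrt (1 + (b / a)²)).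
  { unfold Cmod. simpl fst. simpl snd. 
    rewrite <- (sqrt_pow2 a) at 2 by lra. rewrite <- sqrt_mult.
    - f_equal. unfold Rsqr. field. lra.
    - apply pow2_ge_0.
    - assert (H := Rle_0_sqr (b / a)). lra. }
  rewrite E. assert (0 < sqrt (1 + (b / a)²)).
  { apply sqrt_lt_R0. assert (H := Rle_0_sqr (b / a)). lra. }
  f_equal; field; lra.
Qed.

Lemma ccont_RtoC_comp (g : C -> R) (phi : R -> R) (z : C) :
  ccont (fun w => RtoC (g w)) z -> continuity_pt phi (g z) -> ccont (fun w => RtoC (phi (g w))) z.
Proof.
  intros Hg Hp eps Heps. destruct (Hp eps Heps) as [d [Hd H]].
  destruct (Hg d Hd) as [d2 [Hd2 H2]]. exists d2. split; trivial. intros w Hw.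
  specialize (H2 w Hw). rewrite <- RtoC_minus, Cmod_R in *.
  destruct (Req_dec (g w) (g z)) as [E|E].
  - rewrite E, Rminus_diag, Rabs_R0. exact Heps.
  - apply (H (g w)). split; [split; [exact I|congruence]|exact H2].
Qed.

Lemma ccont_lipschitz (g : C -> R) (z : C) :
  (forall w, Rabs (g w - g z) <= Cmod (w - z)%C) -> ccont (fun w => RtoC (g w)) z.
Proof.
  intros H eps Heps. exists eps. split; trivial. intros w Hw.
  rewrite <- RtoC_minus, Cmod_R. apply Rle_lt_trans with (1 := H w). exact Hw.
Qed.

Lemma ccont_Clog (z : C) : 0 < Re z -> ccont Clog z.
Proof.
  intros Hz.
  assert (Hm : 0 < Cmod z) by (apply Rlt_le_trans with (1 := Hz); apply Rle_trans with (1 := Rle_abs _); apply re_le_Cmod).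
  apply ccont_ext_loc with
    (fun w => RtoC (ln (Cmod w)) + Ci * RtoC (atan (Im w / Re w)))%C 1; [lra| |].
  - intros w _. unfold Clog, Ci, RtoC, Cplus, Cmult. simpl. f_equal; ring.
  - apply ccont_plus.
    + apply (ccont_RtoC_comp Cmod ln).
      * apply ccont_lipschitz. intros w.
        assert (T1 := Cmod_triangle (w - z) z). replace (w - z + z)%C with w in T1 by ring.
        assert (T2 := Cmod_triangle (- (w - z)) w). replace (- (w - z) + w)%C with z in T2 by ring.
        rewrite Cmod_opp in T2. apply Rabs_le. lra.
      * apply derivable_continuous_pt. eexists. now apply derivable_pt_lim_ln.
    + apply ccont_mult; [apply ccont_const|].
      apply (ccont_RtoC_comp (fun w => Im w / Re w) atan).
      * assert (CR : ccont (fun w => RtoC (Re w)) z).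
        { apply ccont_lipschitz. intros w. exact (re_le_Cmod (w - z)%C). }
        assert (CM : ccont (fun w => RtoC (Im w)) z).
        { apply ccont_lipschitz. intros w. exact (Rabs_Im_le (w - z)%C). }
        apply ccont_ext_loc with (fun w => RtoC (Im w) * / RtoC (Re w))%C (Re z); trivial.
        -- intros w Hw. assert (H := re_le_Cmod (w - z)%C).
           unfold Cminus, Cplus, Copp, Re in *. simpl in *.
           assert (H1 := Rle_lt_trans _ _ _ H Hw). apply Rabs_def2 in H1.
           rewrite <- RtoC_inv, <- RtoC_mult by lra. reflexivity.
        -- apply ccont_mult; trivial. apply ccont_inv; trivial.
           intros E. injection E. lra.
      * apply derivable_continuous_pt, derivable_pt_atan.
Qed.

(** Inverse function rule in Caratheodory's form: the factor of [Cexp], composed with the continuous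
    [Clog], is nonzero near [z], and its inverse is the factor of [Clog]. *)
Lemma cdiff_Clog (z : C) : 0 < Re z -> cdiff Clog z.
Proof.
  intros Hz. assert (Cl := ccont_Clog z Hz).
  destruct (Cexp_caratheodory (Clog z)) as [g [Eg [E Hg]]].
  assert (Hgl : ccont (fun w => g (Clog w)) z) by (now apply (ccont_comp Clog g)).
  assert (Hg0 : g (Clog z) <> 0) by (rewrite Eg; apply Cexp_neq_0).
  destruct (ccont_neq_0 _ z Hgl Hg0) as [d [Hd Hnz]].
  exists (fun w => (/ g (Clog w))%C), (Rmin d (Re z)).
  split; [now apply Rmin_glb_lt|]. split; [|now apply ccont_inv].
  intros w Hw. assert (M1 := Rmin_l d (Re z)). assert (M2 := Rmin_r d (Re z)).
  assert (Hw0 : 0 < Re w).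
  { assert (H := re_le_Cmod (w - z)%C). unfold Cminus, Cplus, Copp, Re in *. simpl in *.
    assert (H1 : Rabs (fst w + - fst z) < fst z) by lra. apply Rabs_def2 in H1. lra. }
  assert (H1 : g (Clog w) <> 0).
  { apply Cmod_gt_0. specialize (Hnz w ltac:(lra)). assert (P := Cmod_ge_0 (g (Clog z))). lra. }
  specialize (E (Clog w)). rewrite !Cexp_Clog in E by trivial. rewrite E. field. trivial.
Qed.

Definition Cpower (z : C) (s : R) : C := Cexp (RtoC s * Clog z)%C.

Lemma cdiff_Cpower (z : C) (s : R) : 0 < Re z -> cdiff (fun w => Cpower w s) z.
Proof.
  intros Hz. apply (cdiff_comp (fun w => RtoC s * Clog w)%C Cexp); [|apply cdiff_Cexp].
  apply cdiff_mult; [apply cdiff_const|now apply cdiff_Clog].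
Qed.

Lemma Cmod_Cpower (z : C) (s : R) : Cmod (Cpower z s) = Rpower (Cmod z) s.
Proof.
  unfold Cpower, Rpower. rewrite Cmod_Cexp. f_equal.
  unfold Clog, Cmult, RtoC, Re. simpl. ring.
Qed.

Lemma Cpower_RtoC (x s : R) : 0 < x -> Cpower (RtoC x) s = RtoC (Rpower x s).
Proof.
  intros Hx. unfold Cpower, Rpower.
  replace (Clog (RtoC x)) with (RtoC (ln x)).
  - now rewrite <- RtoC_mult, Cexp_RtoC.
  - unfold Clog. rewrite Cmod_R, Rabs_pos_eq by lra. unfold RtoC, Re, Im. simpl.
    replace (0 / x) with 0 by (field; lra). now rewrite atan_0.
Qed.

(** * The contour estimate *)

Definition scaled (c x : R) (z : C) : C := (RtoC c * (z - RtoC x))%C.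

Lemma scaled_pair (c x u v : R) : scaled c x (u, v) = (c * (u - x), c * v).
Proof. unfold scaled, Cmult, Cminus, Cplus, Copp, RtoC. simpl. f_equal; ring. Qed.

Lemma scaled_RtoC (c x y : R) : scaled c x (RtoC y) = RtoC (c * (y - x)).
Proof. unfold RtoC at 1. rewrite scaled_pair. unfold RtoC. f_equal. ring. Qed.

Lemma cdiff_scaled (F : C -> C) (c x : R) (z : C) :
  cdiff F (scaled c x z) -> cdiff (fun w => F (scaled c x w)) z.
Proof.
  apply (cdiff_comp (scaled c x) F). apply cdiff_mult; [apply cdiff_const|].
  apply cdiff_minus; [apply cdiff_id|apply cdiff_const].
Qed.

Lemma Csinh_scaled (c x : R) (z : C) :
  Csinh (scaled c x z) = (RtoC c * (z - RtoC x) * sinhc (scaled c x z))%C.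
Proof. rewrite Csinh_sinhc. reflexivity. Qed.

Lemma sinh_sq_pos (x : R) : x <> 0 -> 0 < sinh x ^ 2.
Proof.
  intros H. destruct (Rtotal_order x 0) as [H1|[H1|H1]]; [|lra|].
  - assert (H2 := sinh_pos (- x) ltac:(lra)).
    replace (sinh x) with (- sinh (- x)) by (unfold sinh; rewrite Ropp_involutive; field). nra.
  - assert (H2 := sinh_pos x H1). nra.
Qed.

Lemma Csinh_neq_0 (a b : R) : Rabs b < PI -> (a, b) <> RtoC 0 -> Csinh (a, b) <> 0.
Proof.
  intros Hb Hne E.
  assert (H := Cmod2_Csinh a b). rewrite E, Cmod_0 in H.
  assert (H2 := pow2_ge_0 (sin b)).
  destruct (Req_dec a 0) as [Ha|Ha].
  - subst a. assert (Hb0 : b <> 0) by (intros ->; now apply Hne).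
    apply Rabs_def2 in Hb.
    destruct (Rtotal_order b 0) as [H3|[H3|H3]]; [|lra|].
    + assert (H4 := sin_gt_0 (- b) ltac:(lra) ltac:(lra)). rewrite sin_neg in H4. nra.
    + assert (H4 := sin_gt_0 b ltac:(lra) ltac:(lra)). nra.
  - assert (H3 := sinh_sq_pos a Ha). lra.
Qed.

Lemma Re_Ccosh_pos (a b : R) : Rabs b < PI / 2 -> 0 < Re (Ccosh (a, b)).
Proof.
  intros Hb. apply Rabs_def2 in Hb. rewrite Ccosh_pair. simpl.
  apply Rmult_lt_0_compat; [apply cosh_pos|apply cos_gt_0; lra].
Qed.

Lemma cosh_le_exp (x y : R) : cosh x <= cosh y * exp (Rabs (x - y)).
Proof.
  unfold cosh.
  assert (H1 : exp x <= exp y * exp (Rabs (x - y))).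
  { rewrite <- exp_plus. apply exp_le. assert (H := Rle_abs (x - y)). lra. }
  assert (H2 : exp (- x) <= exp (- y) * exp (Rabs (x - y))).
  { rewrite <- exp_plus. apply exp_le. assert (H := Rle_abs (- (x - y))).
    rewrite Rabs_Ropp in H. lra. }
  lra.
Qed.

(** [ln cosh] is Lipschitz with constant 1, so moving the base point costs [exp (|e| |x - y|)] for
    either sign of [e]. *)
Lemma Rpower_cosh_le (e x y : R) :
  Rpower (cosh x) e <= Rpower (cosh y) e * exp (Rabs e * Rabs (x - y)).
Proof.
  unfold Rpower. rewrite <- exp_plus. apply exp_le.
  assert (L : forall u v, ln (cosh u) <= ln (cosh v) + Rabs (u - v)).
  { intros u v. rewrite <- (ln_exp (Rabs (u - v))).
    rewrite <- ln_mult by (apply cosh_pos || apply exp_pos).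
    apply ln_le; [apply cosh_pos|apply cosh_le_exp]. }
  assert (L1 := L x y). assert (L2 := L y x). rewrite (Rabs_minus_sym y x) in L2.
  destruct (Rle_lt_dec 0 e) as [He|He].
  - rewrite (Rabs_pos_eq e) by trivial. nra.
  - rewrite (Rabs_left e) by trivial. nra.
Qed.

Lemma cosh_ge_1 (x : R) : 1 <= cosh x.
Proof.
  assert (H := cosh2_minus_sinh2 x).
  assert (H2 := cosh_pos x). nra.
Qed.

Lemma Cmod_Ccosh_bounds (a b c : R) : 0 < c -> c <= Rabs (cos b) ->
  c * cosh a <= Cmod (Ccosh (a, b)) <= cosh a.
Proof.
  intros Hc Hb. assert (H := Cmod2_Ccosh a b). assert (H1 := cosh2_minus_sinh2 a).
  assert (H2 := cosh_pos a). assert (H3 := Cmod_ge_0 (Ccosh (a, b))).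
  assert (H4 : cos b ^ 2 <= 1).
  { assert (S := sin2_cos2 b). unfold Rsqr in S. nra. }
  assert (H5 : c ^ 2 <= cos b ^ 2) by (rewrite <- (pow2_abs (cos b)); apply pow_incr; lra).
  split; apply Rsqr_incr_0_var; try nra; unfold Rsqr; nra.
Qed.

Lemma Rpower_Cmod_Ccosh_le (a b c e : R) : 0 < c <= 1 -> c <= Rabs (cos b) -> Rabs e <= 1 ->
  Rpower (Cmod (Ccosh (a, b))) e <= / c * Rpower (cosh a) e.
Proof.
  intros Hc Hb He. destruct (Cmod_Ccosh_bounds a b c ltac:(lra) Hb) as [B1 B2].
  assert (H := cosh_pos a). set (m := Cmod (Ccosh (a, b))) in *.
  assert (Hm : 0 < m) by nra.
  assert (L1 : ln c + ln (cosh a) <= ln m).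
  { rewrite <- ln_mult by lra. apply ln_le; nra. }
  assert (L2 : ln m <= ln (cosh a)) by (apply ln_le; lra).
  rewrite <- (exp_ln (/ c)) by (apply Rinv_0_lt_compat; lra).
  rewrite ln_Rinv by lra. unfold Rpower. rewrite <- exp_plus. apply exp_le.
  apply Rabs_le_between in He.
  destruct (Rle_lt_dec 0 e); nra.
Qed.

(** [|sinh|^2 = sinh^2 p + sin^2 q], [|cosh|^2 = sinh^2 p + cos^2 q] and [|tan q| = s], so the claim
    reduces to [s^2 sinh^2 p <= sinh^2 p]. It bounds [1/tanh] on the horizontal sides. *)
Lemma Cmod_Ctanh_inv_le_imag (p q s : R) : 0 < s -> Rabs (sin q) = s * Rabs (cos q) -> s <= 1 -> cos q <> 0 ->
  s * Cmod (Ccosh (p, q)) <= Cmod (Csinh (p, q)).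
Proof.
  intros Hs E Hs1 Hc.
  apply Rsqr_incr_0_var; [|apply Cmod_ge_0]. rewrite !Rsqr_pow2, Rpow_mult_distr.
  rewrite Cmod2_Csinh, Cmod2_Ccosh.
  rewrite <- (pow2_abs (sin q)), E, Rpow_mult_distr, pow2_abs.
  assert (s ^ 2 <= 1) by nra. nra.
Qed.

Lemma Cmod_Ctanh_inv_le_real (p q s : R) : 0 <= s -> s <= Rabs (tanh p) ->
  s * Cmod (Ccosh (p, q)) <= Cmod (Csinh (p, q)).
Proof.
  intros Hs E.
  apply Rsqr_incr_0_var; [|apply Cmod_ge_0]. rewrite !Rsqr_pow2, Rpow_mult_distr.
  rewrite Cmod2_Csinh, Cmod2_Ccosh.
  assert (H := cosh2_minus_sinh2 p). assert (Hp := cosh_pos p).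
  assert (E2 : s ^ 2 <= tanh p ^ 2) by (rewrite <- (pow2_abs (tanh p)); apply pow_incr; lra).
  assert (E3 : sinh p ^ 2 = tanh p ^ 2 * cosh p ^ 2) by (unfold tanh; field; lra).
  assert (S := sin2_cos2 q). unfold Rsqr in S.
  apply Rle_trans with (s ^ 2 * cosh p ^ 2); [|nra].
  apply Rmult_le_compat_l; nra.
Qed.

Lemma inv_cosh_le (x : R) : / cosh x <= 2 * exp (- Rabs x).
Proof.
  assert (H := cosh_pos x).
  apply Rmult_le_reg_l with (cosh x); trivial. rewrite Rinv_r by lra.
  assert (E : exp (Rabs x) <= 2 * cosh x).
  { unfold cosh. assert (P1 := exp_pos x). assert (P2 := exp_pos (- x)).
    unfold Rabs. destruct (Rcase_abs x); lra. }
  assert (P := exp_pos (- Rabs x)).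
  assert (E2 : exp (Rabs x) * exp (- Rabs x) = 1) by (rewrite <- exp_plus, <- exp_0; f_equal; ring).
  nra.
Qed.

Lemma exp_neg_abs_le (x : R) : exp (- Rabs x) <= / cosh x.
Proof.
  assert (H := cosh_pos x).
  apply Rmult_le_reg_l with (cosh x); trivial. rewrite Rinv_r by lra.
  assert (E : cosh x <= exp (Rabs x)).
  { unfold cosh. assert (P1 : exp x <= exp (Rabs x)) by (apply exp_le, Rle_abs).
    assert (P2 : exp (- x) <= exp (Rabs x)) by (apply exp_le; rewrite <- Rabs_Ropp; apply Rle_abs). lra. }
  assert (E2 : exp (Rabs x) * exp (- Rabs x) = 1) by (rewrite <- exp_plus, <- exp_0; f_equal; ring).
  nra.
Qed.

Lemma cos_Rabs (x : R) : cos (Rabs x) = cos x.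
Proof. unfold Rabs. destruct (Rcase_abs x); trivial. apply cos_neg. Qed.

Lemma tanh_opp (x : R) : tanh (- x) = - tanh x.
Proof.
  unfold tanh, sinh, cosh. rewrite Ropp_involutive.
  assert (H1 := exp_pos x). assert (H2 := exp_pos (- x)). field. lra.
Qed.

Lemma tanh_Rabs (x : R) : tanh (Rabs x) = Rabs (tanh x).
Proof.
  unfold Rabs at 1. destruct (Rcase_abs x) as [H|H].
  - rewrite tanh_opp. assert (P := tanh_pos (- x) ltac:(lra)). rewrite tanh_opp in P.
    rewrite Rabs_left; lra.
  - assert (P := tanh_le 0 x ltac:(lra)). rewrite tanh_0 in P. rewrite Rabs_pos_eq; lra.
Qed.

Lemma Cmod_Csinh_ge_real (w b s : R) : 0 <= s -> s <= Rabs (tanh w) ->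
  s * cosh w <= Cmod (Csinh (w, b)).
Proof.
  intros Hs H. assert (Hw := cosh_pos w).
  apply Rsqr_incr_0_var; [|apply Cmod_ge_0]. rewrite !Rsqr_pow2, Rpow_mult_distr, Cmod2_Csinh.
  assert (E2 : s ^ 2 <= tanh w ^ 2) by (rewrite <- (pow2_abs (tanh w)); apply pow_incr; lra).
  assert (E3 : sinh w ^ 2 = tanh w ^ 2 * cosh w ^ 2) by (unfold tanh; field; lra).
  rewrite E3.
  nra.
Qed.

Lemma Cmod_Csinh_ge_imag (w b s : R) : 0 <= s <= 1 -> s <= Rabs (sin b) ->
  s * cosh w <= Cmod (Csinh (w, b)).
Proof.
  intros Hs H.
  apply Rsqr_incr_0_var; [|apply Cmod_ge_0]. rewrite !Rsqr_pow2, Rpow_mult_distr, Cmod2_Csinh.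
  assert (E := cosh2_minus_sinh2 w).
  assert (E2 : s ^ 2 <= sin b ^ 2) by (rewrite <- (pow2_abs (sin b)); apply pow_incr; lra).
  assert (s ^ 2 <= 1) by nra. nra.
Qed.

Lemma list_bounded (q : Z -> R) (l : list Z) : exists B, 0 <= B /\ forall k, In k l -> Rabs (q k) <= B.
Proof.
  induction l as [|b l [B [HB H]]].
  - exists 0. split; [lra|]. intros k [].
  - exists (B + Rabs (q b)). assert (P := Rabs_pos (q b)). split; [lra|].
    intros k [<-|Hk]; [lra|]. specialize (H k Hk). lra.
Qed.

Section Contour.

Variables (d mu nu : R).
Hypothesis hd : 0 < d < PI.
Hypothesis hmunu : mu / 2 < nu < mu / 2 + 1.

Variables (G : C -> C) (l : list Z) (p : Z -> R).
Hypothesis hG : forall z, Rabs (snd z) < d -> cdiff G z.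
Hypothesis hGb : forall z, Rabs (snd z) < d ->
  Cmod (G z) <= Rpower (Cmod (Ccosh (scaled (/ 2) 0 z))) (- mu).
Hypothesis hl : NoDup (0%Z :: l).
Hypothesis hp : forall j k, In j (0%Z :: l) -> In k (0%Z :: l) -> p j = p k -> j = k.

Let a : R := PI / (4 * d).
(** Primed sums omit the index 0, so it is free to denote the evaluation point, and all poles form
    the single list [0 :: l]. *)
Let xi : R := p 0%Z.

(* The integrand of the header times [(z - xi) prod_k (z - zeta_k)], the poles being
   divided out through [sinhc]; it is analytic in the strip. *)
Definition contour_num (z : C) : C :=
  (G z * Cpower (Ccosh (scaled (/ 2) 0 z)) (2 * nu - 1) * RtoC (cosh (xi / 2))
   / sinhc (scaled (/ 2) xi z)
   * Cprod_over l (fun k => Ccosh (scaled a (p k) z) / (RtoC a * sinhc (scaled a (p k) z))))%C.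

Definition contour_sum : C :=
  Csum_over (0%Z :: l) (fun k => contour_num (RtoC (p k))
    / RtoC (Rprod_over (remove Z.eq_dec k (0%Z :: l)) (fun j => p k - p j)%R))%C.

Let integrand (z : C) : C :=
  (contour_num z / Cprod_over (0%Z :: l) (fun k => z - RtoC (p k)))%C.

Lemma a_pos : 0 < a.
Proof. apply Rdiv_lt_0_compat; lra. Qed.

Lemma a_d : a * d = PI / 4.
Proof. unfold a. field. lra. Qed.

Lemma sinhc_scaled_neq_0 (c x : R) (z : C) : 0 < c -> Rabs (c * snd z) < PI ->
  sinhc (scaled c x z) <> 0.
Proof.
  intros Hc Hz. apply sinhc_neq_0. destruct z as [u v]. rewrite scaled_pair.
  intros H. now apply Csinh_neq_0.
Qed.

Lemma half_lt (v : R) : Rabs v < d -> Rabs (/ 2 * v) < PI / 2.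
Proof. intros H. rewrite Rabs_mult, Rabs_pos_eq by lra. lra. Qed.

Lemma a_lt (v : R) : Rabs v < d -> Rabs (a * v) < PI / 4.
Proof.
  intros H. assert (Ha := a_pos). rewrite Rabs_mult, Rabs_pos_eq by lra.
  rewrite <- a_d. now apply Rmult_lt_compat_l.
Qed.

Lemma cdiff_contour_num (z : C) : Rabs (snd z) < d -> cdiff contour_num z.
Proof.
  intros Hz. assert (Ha := a_pos).
  assert (Hv := half_lt _ Hz). assert (Hav := a_lt _ Hz).
  unfold contour_num. apply cdiff_mult.
  - apply cdiff_div.
    + apply cdiff_mult; [|apply cdiff_const]. apply cdiff_mult; [now apply hG|].
      apply (cdiff_comp (fun z => Ccosh (scaled (/ 2) 0 z)) (fun w => Cpower w (2 * nu - 1))).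
      * apply cdiff_scaled, cdiff_Ccosh.
      * apply cdiff_Cpower. destruct z as [u v]. rewrite scaled_pair. now apply Re_Ccosh_pos.
    + apply cdiff_scaled, cdiff_sinhc.
    + apply sinhc_scaled_neq_0; lra.
  - apply (cdiff_Cprod_over l (fun k z => Ccosh (scaled a (p k) z) / (RtoC a * sinhc (scaled a (p k) z)))%C).
    intros k _. apply cdiff_div.
    + apply cdiff_scaled, cdiff_Ccosh.
    + apply cdiff_mult; [apply cdiff_const|]. apply cdiff_scaled, cdiff_sinhc.
    + apply Cmult_neq_0; [|apply sinhc_scaled_neq_0; lra].
      intros E. injection E. lra.
Qed.

(** Origin of the exponent, with [z = tanh (zeta/2)]: [(1 - z^2)^(-nu)] gives [cosh(zeta/2)^(2 nu)],
    [z'(zeta)] gives [1/(2 cosh(zeta/2)^2)], and [1/(z - x)] gives [cosh(zeta/2) cosh(xi/2) /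
    sinh((zeta - xi)/2)]. *)
Lemma integrand_eq (z : C) : Rabs (snd z) < d -> (forall k, In k (0%Z :: l) -> z <> RtoC (p k)) ->
  integrand z = (G z * Cpower (Ccosh (scaled (/ 2) 0 z)) (2 * nu - 1) * RtoC (cosh (xi / 2))
   / (2 * Csinh (scaled (/ 2) xi z))
   * Cprod_over l (fun k => Ccosh (scaled a (p k) z) / Csinh (scaled a (p k) z)))%C.
Proof.
  intros Hz Hne. assert (Ha := a_pos).
  assert (Hv := half_lt _ Hz). assert (Hav := a_lt _ Hz).
  unfold integrand, contour_num.
  change (Cprod_over (0%Z :: l) (fun k => (z - RtoC (p k))%C))
    with ((z - RtoC xi) * Cprod_over l (fun k => (z - RtoC (p k))%C))%C.
  assert (H0 : (z - RtoC xi)%C <> 0) by (apply Cminus_eq_contra, Hne; now left).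
  assert (H1 : Cprod_over l (fun k => (z - RtoC (p k))%C) <> 0).
  { apply Cprod_over_neq_0. intros k Hk. apply Cminus_eq_contra, Hne. now right. }
  assert (H2 : sinhc (scaled (/ 2) xi z) <> 0) by (apply sinhc_scaled_neq_0; lra).
  rewrite (Cprod_over_ext l (fun k => Ccosh (scaled a (p k) z) / (RtoC a * sinhc (scaled a (p k) z)))%C
    (fun k => (Ccosh (scaled a (p k) z) / Csinh (scaled a (p k) z)) * (z - RtoC (p k)))%C).
  - rewrite (Cprod_over_mult l (fun k => Ccosh (scaled a (p k) z) / Csinh (scaled a (p k) z))%C).
    rewrite (Csinh_scaled (/ 2) xi z), RtoC_inv by lra.
    set (P := Cprod_over l (fun k => Ccosh (scaled a (p k) z) / Csinh (scaled a (p k) z))%C).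
    set (D := Cprod_over l (fun k => z - RtoC (p k))%C) in *. clearbody P D.
    field. repeat split; trivial.
  - intros k Hk. rewrite Csinh_scaled.
    assert (H3 : (z - RtoC (p k))%C <> 0) by (apply Cminus_eq_contra, Hne; now right).
    assert (H4 : sinhc (scaled a (p k) z) <> 0) by (apply sinhc_scaled_neq_0; lra).
    assert (H5 : RtoC a <> 0) by (intros E; injection E; lra).
    field. repeat split; trivial.
Qed.

(** The power of [|cosh(zeta/2)|] left after [|G| <= |cosh(zeta/2)|^(-mu)]. The hypothesis on [nu]
    says [|e| < 1]; the factor [1/sinh((zeta - xi)/2)] then wins by the exponential rate [kappa]. *)
Let e : R := 2 * nu - mu - 1.
Let kappa : R := (1 - Rabs e) / 2.
Let growth : R := Rpower (cosh (xi / 2)) (2 * nu - mu).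

Lemma kappa_pos : 0 < kappa.
Proof.
  assert (Rabs e < 1) by (apply Rabs_def1; unfold e; lra). unfold kappa. lra.
Qed.

Lemma cos_half_d : 0 < cos (d / 2) <= 1.
Proof. split; [apply cos_gt_0; lra|]. apply COS_bound. Qed.

(** The power [cosh(u/2)^e] is moved to [xi/2] at the cost [exp(|e| |u - xi|/2)], which [1/sinh]
    absorbs; the numerator [cosh(xi/2)] completes [growth]. The parameters [s] and [T] take
    different values on horizontal and vertical sides. *)
Lemma integrand_bound (u v s T : R) : Rabs v < d -> 0 < s -> 0 < T ->
  (forall k, In k (0%Z :: l) -> (u, v) <> RtoC (p k)) ->
  s * cosh (/ 2 * (u - xi)) <= Cmod (Csinh (scaled (/ 2) xi (u, v))) ->
  (forall k, In k l ->
     Cmod (Ccosh (scaled a (p k) (u, v))) <= T * Cmod (Csinh (scaled a (p k) (u, v)))) ->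
  Cmod (integrand (u, v))
  <= / cos (d / 2) * / s * T ^ length l * growth * / cosh (kappa * (u - xi)).
Proof.
  intros Hv Hs HT Hne Hsinh Htanh. assert (Ha := a_pos).
  assert (Hv2 := half_lt _ Hv). assert (Hav := a_lt _ Hv).
  rewrite (integrand_eq (u, v)) by trivial.
  assert (Hc1 := cosh_pos (/ 2 * (u - xi))).
  assert (Hs0 : 0 < Cmod (Csinh (scaled (/ 2) xi (u, v)))) by nra.
  assert (Hs1 : Csinh (scaled (/ 2) xi (u, v)) <> 0) by now apply Cmod_gt_0.
  rewrite Cmod_mult, Cmod_div, !Cmod_mult, Cmod_Cpower, !Cmod_R, (Rabs_pos_eq 2), (Rabs_pos_eq (cosh (xi / 2)));
    [|apply Rlt_le, cosh_pos|lra|apply Cmult_neq_0; [apply C2_neq_0|trivial]].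
  set (m := Cmod (Ccosh (scaled (/ 2) 0 (u, v)))).
  assert (HG : Cmod (G (u, v)) <= Rpower m (- mu)) by (apply hGb; exact Hv).
  assert (Hcos := cos_half_d).
  assert (Hm : Rpower m e <= / cos (d / 2) * Rpower (cosh (/ 2 * (u - 0))) e).
  { unfold m. rewrite scaled_pair. apply Rpower_Cmod_Ccosh_le; trivial.
    - rewrite <- (cos_Rabs (/ 2 * v)). apply Rle_trans with (2 := Rle_abs _).
      apply cos_decr_1; try lra; try apply Rabs_pos. rewrite Rabs_mult, Rabs_pos_eq; lra.
    - assert (Hk := kappa_pos). unfold kappa in Hk. lra. }
  assert (He := Rpower_cosh_le e (/ 2 * (u - 0)) (xi / 2)).
  replace (/ 2 * (u - 0) - xi / 2) with (/ 2 * (u - xi)) in He by field.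
  assert (Hprod : Cmod (Cprod_over l (fun k => Ccosh (scaled a (p k) (u, v)) / Csinh (scaled a (p k) (u, v)))%C)
    <= T ^ length l).
  { assert (Hk : forall k, In k l ->
      Cmod (Ccosh (scaled a (p k) (u, v)) / Csinh (scaled a (p k) (u, v)))%C <= T).
    { intros k Hk. assert (H := Htanh k Hk).
      assert (Hne' : Csinh (scaled a (p k) (u, v)) <> 0).
      { rewrite scaled_pair. apply Csinh_neq_0; [lra|]. intros E. injection E. intros E1 E2.
        apply (Hne k (or_intror Hk)). unfold RtoC. f_equal; nra. }
      rewrite Cmod_div by trivial. apply Cmod_gt_0 in Hne'.
      apply Rmult_le_reg_r with (1 := Hne'). unfold Rdiv. rewrite Rmult_assoc, Rinv_l by lra. lra. }
    clear -Hk HT. induction l as [|b q IH]; simpl; [rewrite Cmod_1; lra|].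
    rewrite Cmod_mult. apply Rmult_le_compat; try apply Cmod_ge_0.
    - apply Hk. now left.
    - apply IH. intros k H. apply Hk. now right. }
  assert (Hinv : / Cmod (Csinh (scaled (/ 2) xi (u, v))) <= / s * (2 * exp (- Rabs (/ 2 * (u - xi))))).
  { apply Rle_trans with (/ (s * cosh (/ 2 * (u - xi)))).
    - apply Rinv_le_contravar; nra.
    - rewrite Rinv_mult. apply Rmult_le_compat_l; [apply Rlt_le, Rinv_0_lt_compat; lra|apply inv_cosh_le]. }
  assert (Hgr : Rpower (cosh (xi / 2)) e * cosh (xi / 2) = growth).
  { unfold growth. replace (2 * nu - mu) with (e + 1) by (unfold e; ring).
    rewrite Rpower_plus, Rpower_1 by apply cosh_pos. reflexivity. }
  assert (Hpe : Rpower m (- mu) * Rpower m (2 * nu - 1) = Rpower m e).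
  { rewrite <- Rpower_plus. f_equal. unfold e. ring. }
  assert (Hex : exp (Rabs e * Rabs (/ 2 * (u - xi))) * exp (- Rabs (/ 2 * (u - xi)))
    <= / cosh (kappa * (u - xi))).
  { rewrite <- exp_plus.
    replace (Rabs e * Rabs (/ 2 * (u - xi)) + - Rabs (/ 2 * (u - xi))) with (- Rabs (kappa * (u - xi))).
    - apply exp_neg_abs_le.
    - rewrite !Rabs_mult, (Rabs_pos_eq (/ 2)), (Rabs_pos_eq kappa) by (assert (H := kappa_pos); lra).
      unfold kappa. field. }
  assert (Hcx := cosh_pos (xi / 2)).
  assert (P1 : forall x y, 0 < Rpower x y) by (intros; apply exp_pos).
  set (W := Rpower (cosh (xi / 2)) e) in *.
  set (A := exp (Rabs e * Rabs (/ 2 * (u - xi)))) in *.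
  set (B := exp (- Rabs (/ 2 * (u - xi)))) in *.
  set (S := Cmod (Csinh (scaled (/ 2) xi (u, v)))) in *.
  assert (Hci : 0 < / cos (d / 2)) by (apply Rinv_0_lt_compat; lra).
  assert (Hsi : 0 < / s) by (apply Rinv_0_lt_compat; lra).
  assert (Hnum : Cmod (G (u, v)) * Rpower m (2 * nu - 1) <= / cos (d / 2) * (W * A)).
  { apply Rle_trans with (Rpower m (- mu) * Rpower m (2 * nu - 1)).
    - apply Rmult_le_compat_r; [apply Rlt_le, P1|trivial].
    - rewrite Hpe. apply Rle_trans with (1 := Hm). apply Rmult_le_compat_l; lra. }
  assert (HT' : 0 <= T ^ length l) by (apply pow_le; lra).
  apply Rle_trans with (/ cos (d / 2) * (W * A) * cosh (xi / 2) * (/ 2 * (/ s * (2 * B))) * T ^ length l).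
  - apply Rmult_le_compat; trivial; try apply Cmod_ge_0.
    + apply Rmult_le_pos.
      * apply Rmult_le_pos; [|lra]. apply Rmult_le_pos; [apply Cmod_ge_0|apply Rlt_le, P1].
      * apply Rlt_le, Rinv_0_lt_compat. lra.
    + unfold Rdiv. rewrite Rinv_mult. apply Rmult_le_compat; trivial.
      * apply Rmult_le_pos; [|lra]. apply Rmult_le_pos; [apply Cmod_ge_0|apply Rlt_le, P1].
      * apply Rmult_le_pos; [lra|]. apply Rlt_le, Rinv_0_lt_compat. lra.
      * apply Rmult_le_compat_r; lra.
      * apply Rmult_le_compat_l; lra.
  - replace (/ cos (d / 2) * (W * A) * cosh (xi / 2) * (/ 2 * (/ s * (2 * B))) * T ^ length l)
      with (/ cos (d / 2) * / s * T ^ length l * (W * cosh (xi / 2)) * (A * B)) by (field; lra).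
    rewrite Hgr. apply Rmult_le_compat_l; trivial.
    assert (0 < growth) by apply P1.
    repeat apply Rmult_le_pos; lra.
Qed.

Lemma integrand_ccont (z : C) : Rabs (snd z) < d ->
  (forall k, In k (0%Z :: l) -> z <> RtoC (p k)) -> ccont integrand z.
Proof.
  intros Hz Hne. apply cdiff_ccont. unfold integrand. apply cdiff_div.
  - now apply cdiff_contour_num.
  - apply (cdiff_Cprod_over (0%Z :: l) (fun k z => z - RtoC (p k))%C).
    intros k _. apply cdiff_minus; [apply cdiff_id|apply cdiff_const].
  - apply Cprod_over_neq_0. intros k Hk. now apply Cminus_eq_contra, Hne.
Qed.

(** [(2/kappa) atan (exp (kappa u))] is a primitive of [1 / cosh (kappa u)] with total variation
    [pi / kappa], so the bound is independent of [X]. *)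
Lemma CI_horizontal_bound (v K X : R) : 0 <= K -> 0 < X -> v <> 0 -> Rabs v < d ->
  (forall u, Cmod (integrand (u, v)) <= K * / cosh (kappa * (u - xi))) ->
  Cmod (CI (fun u => integrand (u, v)) (- X) X) <= 2 * PI * K / kappa.
Proof.
  intros HK HX Hv Hvd Hb. assert (Hk := kappa_pos).
  assert (Hcosh : forall u, cosh (kappa * (u - xi)) <> 0).
  { intros u. apply Rgt_not_eq, cosh_pos. }
  set (H := fun u => K * (2 / kappa * atan (exp (kappa * (u - xi))))).
  apply Rle_trans with (2 * (H X - H (- X))).
  - apply (CI_bound (fun u => integrand (u, v)) H (fun u => K * / cosh (kappa * (u - xi)))); [lra| | | |].
    + apply path_cont_h. intros u _. apply integrand_ccont; trivial.
      intros k _ E. injection E. intros. lra.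
    + intros u _. unfold H. assert (P := exp_pos (kappa * (u - xi))).
      auto_derive; trivial. unfold cosh. rewrite exp_Ropp. unfold Rsqr, Rminus in *.
      field. repeat split; nra.
    + intros u _. apply continuity_pt_scal.
      apply (continuity_pt_inv (fun u => cosh (kappa * (u - xi)))); [|apply Hcosh].
      apply (continuity_pt_comp (fun u => kappa * (u - xi)) cosh).
      * apply continuity_pt_scal. apply continuity_pt_minus; [apply continuity_pt_id|].
        apply continuity_pt_const. intros ? ?; reflexivity.
      * apply derivable_continuous_pt. eexists. apply derivable_pt_lim_cosh.
    + intros u _. apply Hb.
  - assert (B1 := atan_bound (exp (kappa * (X - xi)))).
    assert (B2 : 0 < atan (exp (kappa * (- X - xi)))).
    { rewrite <- atan_0. apply atan_increasing, exp_pos. }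
    unfold H.
    replace (2 * PI * K / kappa) with (2 * (K * (2 / kappa * (PI / 2)))) by (field; lra).
    rewrite <- Rmult_minus_distr_l, <- Rmult_minus_distr_l.
    apply Rmult_le_compat_l; [lra|]. apply Rmult_le_compat_l; [lra|].
    apply Rmult_le_compat_l; [apply Rlt_le, Rdiv_lt_0_compat; lra|]. lra.
Qed.

Lemma contour_sum_bound_at (h : R) : d / 2 <= h < d ->
  Cmod contour_sum <= 2 / kappa *
    (/ cos (d / 2) * / sin (d / 4) * (/ tan (a * h)) ^ length l * growth).
Proof.
  intros Hh. assert (Ha := a_pos). assert (Had := a_d).
  assert (Hk := kappa_pos). assert (Hcos := cos_half_d).
  assert (Hgr : 0 < growth) by apply exp_pos.
  assert (Hsd : 0 < sin (d / 4) <= 1) by (split; [apply sin_gt_0; lra|apply SIN_bound]).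
  assert (Hah : 0 < a * h < PI / 4) by (split; [apply Rmult_lt_0_compat; lra|rewrite <- Had; apply Rmult_lt_compat_l; lra]).
  assert (Hca : 0 < cos (a * h)) by (apply cos_gt_0; lra).
  assert (Ht : 0 < tan (a * h) <= 1).
  { split; [apply tan_gt_0; lra|]. rewrite <- tan_PI4. left. apply tan_increasing; lra. }
  set (n := length l). set (T1 := / tan (a * h)).
  assert (HT1 : 0 < T1) by (apply Rinv_0_lt_compat; lra).
  assert (HT1n : 0 < T1 ^ n) by now apply pow_lt.
  set (C1 := / cos (d / 2) * / sin (d / 4) * T1 ^ n * growth).
  assert (HC1 : 0 < C1) by (unfold C1; repeat apply Rmult_lt_0_compat; trivial; apply Rinv_0_lt_compat; lra).
  assert (Hta : 0 < tanh a) by now apply tanh_pos.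
  assert (Ht1 : 0 < tanh 1) by (apply tanh_pos; lra).
  set (C2 := / cos (d / 2) * / tanh 1 * (/ tanh a) ^ n * growth).
  assert (HC2 : 0 < C2).
  { unfold C2; repeat apply Rmult_lt_0_compat; trivial; try (apply Rinv_0_lt_compat; lra).
    apply pow_lt, Rinv_0_lt_compat; lra. }
  apply le_epsilon. intros eps Heps.
  destruct (list_bounded p (0%Z :: l)) as [B [HB0 HB]].
  assert (Hxi : Rabs xi <= B) by (apply HB; now left).
  (* Each vertical side contributes at most [4 eta d]; with this value the two together give
     [2 pi eps], that is [eps] after division by [2 pi]. *)
  set (eta := eps * PI / (4 * d)).
  assert (Heta : 0 < eta) by (apply Rdiv_lt_0_compat; nra).
  (* Distance 2 from all poles yields the lower bounds [tanh 1] and [tanh a]. The last summand,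
     through [exp (-y) <= 1/y], pushes the integrand on the vertical sides below [eta]. *)
  set (X := B + 2 + 2 * C2 / (eta * kappa)).
  assert (HX : 0 < 2 * C2 / (eta * kappa)) by (apply Rdiv_lt_0_compat; nra).
  assert (HX0 : B + 2 < X) by (unfold X; lra).
  assert (Hside_dist : forall u x, u = X \/ u = - X -> Rabs x <= B -> X - B <= Rabs (u - x)).
  { intros u x Hu Hx. apply Rabs_le_between in Hx.
    destruct Hu as [-> | ->]; [rewrite Rabs_pos_eq; lra|rewrite Rabs_left; lra]. }
  assert (Hres := residue_sum contour_num p (0%Z :: l) X h ltac:(lra) ltac:(discriminate) hl hp
    ltac:(intros k Hk'; specialize (HB k Hk'); apply Rabs_le_between in HB; lra)
    ltac:(intros z _ Hz; apply cdiff_contour_num; apply Rabs_def1; lra)).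
  change (box integrand (- X) X (- h) h = (RtoC (2 * PI) * Ci * contour_sum)%C) in Hres.
  assert (Htop : forall v, Rabs v = h -> Cmod (CI (fun u => integrand (u, v)) (- X) X) <= 2 * PI * C1 / kappa).
  { intros v Hv.
    assert (Hv0 : v <> 0) by (intros ->; rewrite Rabs_R0 in Hv; lra).
    apply CI_horizontal_bound; try lra.
    intros u. apply integrand_bound; try lra.
    - intros k _ E. injection E. intros. lra.
    (* Because [h >= d/2], [sin (d/4)] is a lower bound that does not depend on [h]. *)
    - rewrite scaled_pair. apply Cmod_Csinh_ge_imag; [lra|].
      assert (E : Rabs (sin (/ 2 * v)) = sin (h / 2)).
      { rewrite <- Hv. unfold Rabs at 2. destruct (Rcase_abs v) as [H1|H1].
        - unfold Rabs in Hv. destruct (Rcase_abs v); [|lra].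
          replace (/ 2 * v) with (- (- v / 2)) by field. rewrite sin_neg, Rabs_Ropp.
          apply Rabs_pos_eq. apply sin_ge_0; lra.
        - unfold Rabs in Hv. destruct (Rcase_abs v); [lra|].
          replace (/ 2 * v) with (v / 2) by field. apply Rabs_pos_eq. apply sin_ge_0; lra. }
      rewrite E. apply sin_incr_1; lra.
    - intros k Hk'. rewrite scaled_pair.
      assert (H := Cmod_Ctanh_inv_le_imag (a * (u - p k)) (a * v) (tan (a * h)) ltac:(lra)).
      assert (Eabs : Rabs (a * v) = a * h) by (rewrite Rabs_mult, Rabs_pos_eq, Hv by lra; reflexivity).
      assert (Ec : cos (a * v) = cos (a * h)) by (rewrite <- Eabs; symmetry; apply cos_Rabs).
      assert (Es : Rabs (sin (a * v)) = sin (a * h)).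
      { rewrite <- Eabs. unfold Rabs at 2. unfold Rabs in Eabs. destruct (Rcase_abs (a * v)) as [H1|H1].
        - rewrite sin_neg. rewrite Rabs_left; trivial.
          assert (0 < sin (- (a * v))) by (apply sin_gt_0; lra). rewrite sin_neg in H0. lra.
        - apply Rabs_pos_eq. apply sin_ge_0; lra. }
      specialize (H ltac:(rewrite Es, Ec, (Rabs_pos_eq (cos (a * h))) by lra; unfold tan; field; lra)
        ltac:(lra) ltac:(rewrite Ec; lra)).
      unfold T1. apply Rmult_le_reg_l with (tan (a * h)); [lra|].
      rewrite <- Rmult_assoc, Rinv_r by lra. lra. }
  assert (Hside : forall u v, u = X \/ u = - X -> - h <= v <= h -> Cmod (integrand (u, v)) <= eta).
  { intros u v Hu Hv.
    assert (Hux := Hside_dist u xi Hu Hxi).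
    apply Rle_trans with (C2 * / cosh (kappa * (u - xi))).
    - apply integrand_bound; try lra.
      + apply Rabs_def1; lra.
      + apply Rinv_0_lt_compat; lra.
      + intros k Hk' E. injection E. intros _ E1. assert (H := Hside_dist u (p k) Hu (HB k Hk')).
        rewrite E1, Rminus_diag, Rabs_R0 in H. lra.
      + rewrite scaled_pair. apply Cmod_Csinh_ge_real; [lra|].
        rewrite <- tanh_Rabs. apply tanh_le. rewrite Rabs_mult, Rabs_pos_eq by lra. lra.
      + intros k Hk'. rewrite scaled_pair.
        assert (H := Hside_dist u (p k) Hu (HB k (or_intror Hk'))).
        assert (H1 := Cmod_Ctanh_inv_le_real (a * (u - p k)) (a * v) (tanh a) ltac:(lra)).
        assert (H2 : tanh a <= Rabs (tanh (a * (u - p k)))).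
        { rewrite <- tanh_Rabs. apply tanh_le. rewrite Rabs_mult, Rabs_pos_eq by lra. nra. }
        specialize (H1 H2).
        apply Rmult_le_reg_l with (tanh a); trivial.
        rewrite <- Rmult_assoc, Rinv_r by lra. lra.
    - assert (HI := inv_cosh_le (kappa * (u - xi))).
      set (y := Rabs (kappa * (u - xi))) in *.
      assert (Hy : 2 * C2 / eta <= y).
      { unfold y. rewrite Rabs_mult, (Rabs_pos_eq kappa) by lra.
        apply Rle_trans with (kappa * (X - B)); [|apply Rmult_le_compat_l; lra].
        apply Rle_trans with (kappa * (2 * C2 / (eta * kappa))).
        - right. field. lra.
        - apply Rmult_le_compat_l; unfold X; lra. }
      assert (Hy0 : 0 < 2 * C2 / eta) by (apply Rdiv_lt_0_compat; lra).
      assert (Hexp : exp (- y) <= / y).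
      { rewrite exp_Ropp. apply Rinv_le_contravar; [lra|]. assert (H := exp_ineq1_le y). lra. }
      assert (Hyi : / y <= / (2 * C2 / eta)) by (apply Rinv_le_contravar; lra).
      apply Rle_trans with (C2 * (2 * / (2 * C2 / eta))).
      + apply Rmult_le_compat_l; lra.
      + right. field. lra. }
  assert (Hccs : forall u, u = X \/ u = - X -> path_cont (fun v => integrand (u, v)) (- h) h).
  { intros u Hu. apply path_cont_v. intros v Hv. apply integrand_ccont.
    - apply Rabs_def1; simpl; lra.
    - intros k Hk' E. injection E. intros _ E1. assert (H := Hside_dist u (p k) Hu (HB k Hk')).
      rewrite E1, Rminus_diag, Rabs_R0 in H. lra. }
  assert (Hsides : forall u, u = X \/ u = - X -> Cmod (CI (fun v => integrand (u, v)) (- h) h) <= 4 * eta * d).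
  { intros u Hu. apply Rle_trans with (2 * eta * (h - - h)).
    - apply CI_bound_const; [lra|now apply Hccs|]. intros v Hv. now apply Hside.
    - nra. }
  assert (Hbox : 2 * PI * Cmod contour_sum <= 4 * PI * C1 / kappa + 8 * eta * d).
  { replace (2 * PI * Cmod contour_sum) with (Cmod (box integrand (- X) X (- h) h)).
    - unfold box.
      assert (B1 := Htop (- h) ltac:(rewrite Rabs_Ropp, Rabs_pos_eq; lra)).
      assert (B2 := Htop h ltac:(rewrite Rabs_pos_eq; lra)).
      assert (B3 := Hsides X (or_introl eq_refl)).
      assert (B4 := Hsides (- X) (or_intror eq_refl)).
      eapply Rle_trans; [apply Cmod_triangle|]. rewrite Cmod_mult, Cmod_Ci.
      assert (U1 := Cmod_triangle (CI (fun u => integrand (u, - h)) (- X) X) (- CI (fun u => integrand (u, h)) (- X) X)).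
      assert (U2 := Cmod_triangle (CI (fun v => integrand (X, v)) (- h) h) (- CI (fun v => integrand (- X, v)) (- h) h)).
      rewrite Cmod_opp in U1, U2. unfold Cminus. 
      replace (4 * PI * C1 / kappa) with (2 * PI * C1 / kappa + 2 * PI * C1 / kappa) by (field; lra).
      lra.
    - rewrite Hres, !Cmod_mult, Cmod_Ci, Cmod_R, Rabs_pos_eq by lra. ring. }
  apply Rmult_le_reg_l with (2 * PI); [lra|].
  apply Rle_trans with (1 := Hbox). fold n T1. fold C1. right. unfold eta. field. lra.
Qed.

(** As [h -> d], [tan (a h)] tends to [tan (pi/4) = 1], so the only factor involving the number of
    nodes disappears: this is why the final constant is independent of [N]. *)
Lemma contour_sum_bound :
  Cmod contour_sum <= 2 / (kappa * cos (d / 2) * sin (d / 4)) * growth.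
Proof.
  assert (Ha := a_pos). assert (Had := a_d).
  assert (Hk := kappa_pos). assert (Hcos := cos_half_d).
  assert (Hsd : 0 < sin (d / 4)) by (apply sin_gt_0; lra).
  set (n := length l). set (S := Cmod contour_sum).
  set (M := 2 / (kappa * cos (d / 2) * sin (d / 4)) * growth).
  assert (Hh : forall h, d / 2 <= h < d -> S * tan (a * h) ^ n <= M).
  { intros h Hh. assert (H := contour_sum_bound_at h Hh). fold S n in H.
    assert (Hah : 0 < a * h < PI / 2).
    { split; [apply Rmult_lt_0_compat; lra|].
      apply Rlt_trans with (a * d); [apply Rmult_lt_compat_l; lra|lra]. }
    assert (Ht : 0 < tan (a * h)) by (apply tan_gt_0; lra).
    assert (Htn := pow_lt _ n Ht).
    apply Rle_trans with (2 / kappa *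
      (/ cos (d / 2) * / sin (d / 4) * (/ tan (a * h)) ^ n * growth) * tan (a * h) ^ n).
    - apply Rmult_le_compat_r; lra.
    - right. unfold M. rewrite pow_inv. field. repeat split; lra. }
  apply Rnot_lt_le. intros Hlt.
  assert (Hcont : continuity_pt (fun h => S * tan (a * h) ^ n) d).
  { apply continuity_pt_scal.
    apply (continuity_pt_comp (fun h => tan (a * h)) (fun y => y ^ n)).
    - apply (continuity_pt_comp (fun h => a * h) tan).
      + apply continuity_pt_scal, continuity_pt_id.
      + apply derivable_continuous_pt, derivable_pt_tan. rewrite Had. lra.
    - apply derivable_continuous_pt, derivable_pt_pow. }
  destruct (Hcont (S - M) ltac:(lra)) as [del [Hdel H]].
  set (h := Rmax (d / 2) (d - del / 2)).
  assert (H1 := Rmax_l (d / 2) (d - del / 2)). assert (H2 := Rmax_r (d / 2) (d - del / 2)).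
  assert (H3 : h < d) by (apply Rmax_lub_lt; lra). fold h in H1, H2.
  specialize (Hh h ltac:(lra)).
  assert (H4 : Rabs (S * tan (a * h) ^ n - S * tan (a * d) ^ n) < S - M).
  { apply (H h). split; [split; [exact I|lra]|]. simpl. unfold Rdist. rewrite Rabs_left; lra. }
  rewrite Had, tan_PI4, pow1 in H4. apply Rabs_def2 in H4. lra.
Qed.

End Contour.

(** * Index sets and hyperbolic identities *)

Lemma tanh_arctanh (x : R) : -1 < x < 1 -> tanh (arctanh x) = x.
Proof.
  intros Hx. rewrite tanh_exp. unfold arctanh.
  replace (2 * (/ 2 * ln ((1 + x) / (1 - x)))) with (ln ((1 + x) / (1 - x))) by field.
  rewrite exp_ln by (apply Rdiv_lt_0_compat; lra). field. lra.
Qed.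

Lemma tanh_range (y : R) : -1 < tanh y < 1.
Proof.
  split; [|apply tanh_lt_1]. assert (H := tanh_lt_1 (- y)). rewrite tanh_opp in H. lra.
Qed.

Lemma tanh_inj (x y : R) : tanh x = tanh y -> x = y.
Proof.
  rewrite !tanh_exp. intros H.
  assert (Hx := exp_pos (2 * x)). assert (Hy := exp_pos (2 * y)).
  assert (E : exp (2 * x) = exp (2 * y)).
  { apply Rmult_eq_compat_r with (r := (exp (2 * x) + 1) * (exp (2 * y) + 1)) in H.
    replace ((exp (2 * x) - 1) / (exp (2 * x) + 1) * ((exp (2 * x) + 1) * (exp (2 * y) + 1)))
      with ((exp (2 * x) - 1) * (exp (2 * y) + 1)) in H by (field; lra).
    replace ((exp (2 * y) - 1) / (exp (2 * y) + 1) * ((exp (2 * x) + 1) * (exp (2 * y) + 1)))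
      with ((exp (2 * y) - 1) * (exp (2 * x) + 1)) in H by (field; lra).
    lra. }
  apply exp_inv in E. lra.
Qed.

Lemma arctanh_tanh (y : R) : arctanh (tanh y) = y.
Proof. apply tanh_inj. apply tanh_arctanh, tanh_range. Qed.

Lemma arctanh_opp (x : R) : -1 < x < 1 -> arctanh (- x) = - arctanh x.
Proof. intros Hx. apply tanh_inj. rewrite tanh_opp, !tanh_arctanh; lra. Qed.

Lemma sinh_minus (x y : R) : sinh (x - y) = sinh x * cosh y - cosh x * sinh y.
Proof.
  unfold sinh, cosh, Rminus. rewrite !Ropp_plus_distr, Ropp_involutive, !exp_plus. field.
Qed.

Lemma cosh_minus (x y : R) : cosh (x - y) = cosh x * cosh y - sinh x * sinh y.
Proof.
  unfold sinh, cosh, Rminus. rewrite !Ropp_plus_distr, Ropp_involutive, !exp_plus. field.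
Qed.

Lemma tanh_minus (x y : R) : tanh (x - y) = (tanh x - tanh y) / (1 - tanh x * tanh y).
Proof.
  assert (Hx := cosh_pos x). assert (Hy := cosh_pos y). assert (Hxy := cosh_pos (x - y)).
  unfold tanh. rewrite sinh_minus, cosh_minus in *. field. repeat split; lra.
Qed.

Lemma tanh_sub (x y : R) : tanh x - tanh y = sinh (x - y) / (cosh x * cosh y).
Proof.
  assert (Hx := cosh_pos x). assert (Hy := cosh_pos y).
  unfold tanh. rewrite sinh_minus. field. lra.
Qed.

Lemma one_minus_tanh_sq (x : R) : 1 - tanh x ^ 2 = / cosh x ^ 2.
Proof.
  assert (Hx := cosh_pos x). assert (H := cosh2_minus_sinh2 x). unfold tanh.
  transitivity ((cosh x ^ 2 - sinh x ^ 2) / cosh x ^ 2); [field; lra|].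
  rewrite H. field. lra.
Qed.

Lemma Rpower_one_minus_tanh_sq (x s : R) : Rpower (1 - tanh x ^ 2) s = Rpower (cosh x) (- (2 * s)).
Proof.
  assert (Hx := cosh_pos x). rewrite one_minus_tanh_sq. unfold Rpower. f_equal.
  rewrite ln_Rinv by (apply pow_lt; lra). simpl. rewrite Rmult_1_r, ln_mult by lra. ring.
Qed.

Lemma Rprod_over_ext (l : list Z) (F G : Z -> R) :
  (forall k, In k l -> F k = G k) -> Rprod_over l F = Rprod_over l G.
Proof.
  induction l as [|a l IH]; intros H; trivial. simpl.
  rewrite IH, (H a); auto with datatypes.
Qed.

Lemma Rprod_over_mult (l : list Z) (F G : Z -> R) :
  Rprod_over l (fun k => F k * G k) = Rprod_over l F * Rprod_over l G.
Proof. induction l as [|a l IH]; simpl; [ring|rewrite IH; ring]. Qed.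

Lemma Rprod_over_neq_0 (l : list Z) (F : Z -> R) :
  (forall k, In k l -> F k <> 0) -> Rprod_over l F <> 0.
Proof.
  induction l as [|a l IH]; intros H; simpl; [lra|].
  apply Rmult_integral_contrapositive_currified; [apply H; now left|].
  apply IH. intros k Hk. apply H. now right.
Qed.

Lemma Rprod_over_inv (l : list Z) (F : Z -> R) :
  Rprod_over l (fun k => / F k) = / Rprod_over l F.
Proof. induction l as [|a l IH]; simpl; [now rewrite Rinv_1|now rewrite IH, Rinv_mult]. Qed.

Lemma Rprod_over_Permutation (l m : list Z) (F : Z -> R) :
  Permutation l m -> Rprod_over l F = Rprod_over m F.
Proof.
  induction 1; simpl; trivial.
  - now rewrite IHPermutation.
  - ring.
  - now rewrite IHPermutation1.
Qed.

Lemma Permutation_remove (l : list Z) (k : Z) : NoDup l -> In k l ->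
  Permutation l (k :: remove Z.eq_dec k l).
Proof.
  induction l as [|a l IH]; intros Hnd Hk; [now elim Hk|].
  inversion_clear Hnd as [|? ? Hni Hnd']. simpl.
  destruct (Z.eq_dec k a) as [->|Hka].
  - rewrite notin_remove by trivial. apply Permutation_refl.
  - destruct Hk as [Hk|Hk]; [now elim Hka|].
    apply perm_trans with (a :: k :: remove Z.eq_dec k l); [|apply perm_swap].
    apply perm_skip. now apply IH.
Qed.

Lemma Rprod_over_remove (l : list Z) (k : Z) (F : Z -> R) : NoDup l -> In k l ->
  Rprod_over l F = F k * Rprod_over (remove Z.eq_dec k l) F.
Proof.
  intros Hnd Hk. now rewrite (Rprod_over_Permutation _ _ F (Permutation_remove l k Hnd Hk)).
Qed.

Lemma NoDup_remove_eq (l : list Z) (k : Z) : NoDup l -> NoDup (remove Z.eq_dec k l).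
Proof.
  induction l as [|a l IH]; intros Hnd; trivial.
  inversion_clear Hnd as [|? ? Hni Hnd']. simpl.
  destruct (Z.eq_dec k a); auto. constructor; auto.
  intros H. apply in_remove in H. tauto.
Qed.

Lemma NoDup_indices (N : nat) : NoDup (indices N).
Proof.
  apply NoDup_remove_eq. apply FinFun.Injective_map_NoDup; [|apply seq_NoDup].
  intros i j H. lia.
Qed.

Lemma In_indices (N : nat) (k : Z) :
  In k (indices N) <-> (k <> 0 /\ - Z.of_nat N <= k <= Z.of_nat N)%Z.
Proof.
  unfold indices. split.
  - intros H. apply in_remove in H. destruct H as [H Hk]. split; trivial.
    apply in_map_iff in H. destruct H as [i [Hi Hs]]. apply in_seq in Hs. lia.
  - intros [H0 H]. apply in_in_remove; trivial. apply in_map_iff.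
    exists (Z.to_nat (k + Z.of_nat N)). split; [lia|]. apply in_seq. lia.
Qed.

(** The order that puts [k] next to [-k], since one Ganelius factor arises from such a pair. *)
Fixpoint paired_indices (N : nat) : list Z :=
  match N with
  | O => nil
  | S n => Z.of_nat (S n) :: (- Z.of_nat (S n))%Z :: paired_indices n
  end.

Lemma In_paired_indices (N : nat) (k : Z) :
  In k (paired_indices N) <-> (k <> 0 /\ - Z.of_nat N <= k <= Z.of_nat N)%Z.
Proof.
  induction N as [|n IH]; cbn [paired_indices In]; [lia|]. rewrite IH. lia.
Qed.

Lemma NoDup_paired_indices (N : nat) : NoDup (paired_indices N).
Proof.
  induction N as [|n IH]; cbn [paired_indices]; [constructor|].
  constructor; [|constructor; trivial].
  - intros [H|H]; [lia|]. apply In_paired_indices in H. lia.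
  - intros H. apply In_paired_indices in H. lia.
Qed.

Lemma Rprod_over_indices (N : nat) (F : Z -> R) : Rprod_over (indices N) F
  = prod_below (fun j => F (Z.of_nat (S j)) * F (- Z.of_nat (S j))%Z) N.
Proof.
  rewrite (Rprod_over_Permutation _ (paired_indices N)).
  - induction N as [|n IH]; trivial. cbn [paired_indices prod_below].
    cbn [Rprod_over fold_right]. fold (Rprod_over (paired_indices n) F). rewrite IH. ring.
  - apply NoDup_Permutation; [apply NoDup_indices|apply NoDup_paired_indices|].
    intros k. now rewrite In_indices, In_paired_indices.
Qed.

Lemma Csum_over_single (l : list Z) (k : Z) (F : Z -> C) : NoDup l -> In k l ->
  (forall j, In j l -> j <> k -> F j = 0) -> Csum_over l F = F k.
Proof.
  induction l as [|a l IH]; intros Hnd Hk HF; [now elim Hk|].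
  inversion_clear Hnd as [|? ? Hni Hnd']. simpl.
  destruct Hk as [->|Hk].
  - rewrite (Csum_over_ext l F (fun _ => RtoC 0 * RtoC 0)%C).
    + rewrite Csum_over_scal. ring.
    + intros j Hj. rewrite HF; [ring|now right|]. intros ->. now apply Hni.
  - rewrite (HF a), IH; trivial; [ring| |now left|].
    + intros j Hj. apply HF. now right.
    + intros ->. now apply Hni.
Qed.

(** * The error as a sum of residues *)

Definition Rsinhc (y : R) : R := if Req_EM_T y 0 then 1 else sinh y / y.

Lemma Rsinhc_0 : Rsinhc 0 = 1.
Proof. unfold Rsinhc. now destruct (Req_EM_T 0 0) as [_|[]]. Qed.

Lemma Rsinhc_neq (y : R) : y <> 0 -> Rsinhc y = sinh y / y.
Proof. intros H. unfold Rsinhc. now destruct (Req_EM_T y 0). Qed.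

Lemma sinh_neq_0 (y : R) : y <> 0 -> sinh y <> 0.
Proof. intros H E. assert (P := sinh_sq_pos y H). rewrite E in P. nra. Qed.

Lemma Rsinhc_neq_0 (y : R) : Rsinhc y <> 0.
Proof.
  destruct (Req_dec y 0) as [->|H]; [rewrite Rsinhc_0; lra|].
  rewrite Rsinhc_neq by trivial.
  apply Rmult_integral_contrapositive_currified; [now apply sinh_neq_0|].
  now apply Rinv_neq_0_compat.
Qed.

Lemma sinhc_RtoC (y : R) : sinhc (RtoC y) = RtoC (Rsinhc y).
Proof.
  unfold sinhc. destruct (Ceq_dec (RtoC y) 0) as [E|E].
  - injection E. intros ->. now rewrite Rsinhc_0.
  - assert (Hy : y <> 0) by (intros ->; now apply E).
    rewrite Rsinhc_neq, Csinh_RtoC, RtoC_div; trivial.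
Qed.

Lemma tanh_neq_0 (y : R) : y <> 0 -> tanh y <> 0.
Proof. intros H E. apply H, tanh_inj. now rewrite tanh_0. Qed.

Section Formula.

Variables (d mu nu : R) (N : nat).
Hypothesis hd : 0 < d < PI.
Hypothesis hmu : 0 < mu.
Hypothesis hN : (0 < N)%nat.

Let r : R := d * mu / PI.
Hypothesis hdef : approx_defined r N.

Let a : R := PI / (4 * d).
Let b (k : Z) : R := node_b r N k.
Let l : list Z := indices N.

Definition zeta_node (k : Z) : R := 4 * d / PI * arctanh (b k).

Let a_pos' : 0 < a := a_pos d hd.

Lemma r_pos : 0 < r.
Proof. apply Rdiv_lt_0_compat; nra. Qed.

Lemma ganelius_range (k : Z) : (1 <= k <= Z.of_nat N)%Z -> 0 < ganelius r N k < 1.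
Proof.
  intros Hk. destruct hdef as [H0 _].
  assert (H := node_a_range r N (Z.to_nat (N0 r N)) (Z.to_nat (k - 1)) r_pos ltac:(lia) ltac:(lia) ltac:(lia)).
  unfold node_a in H. replace (Z.of_nat (S (Z.to_nat (k - 1)))) with k in H by lia. exact H.
Qed.

Lemma b_opp (k : Z) : (0 < k)%Z -> b (- k) = - b k.
Proof.
  intros Hk. unfold b, node_b.
  replace (0 <? - k)%Z with false by (symmetry; apply Z.ltb_ge; lia).
  replace (0 <? k)%Z with true by (symmetry; apply Z.ltb_lt; lia).
  now rewrite Z.opp_involutive.
Qed.

(** Solving for [a_k] shows that distinct [a_k] have distinct [b_k], hence that the poles are
    simple. *)
Lemma b_sq (k : Z) : (1 <= k <= Z.of_nat N)%Z ->
  0 < b k < 1 /\ ganelius r N k = (1 - b k ^ 2) / (1 + b k ^ 2).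
Proof.
  intros Hk. assert (Ha := ganelius_range k Hk).
  unfold b, node_b. replace (0 <? k)%Z with true by (symmetry; apply Z.ltb_lt; lia).
  set (x := ganelius r N k) in *.
  assert (Hx : 0 < (1 - x) / (1 + x)) by (apply Rdiv_lt_0_compat; lra).
  rewrite pow2_sqrt by lra. repeat split.
  - now apply sqrt_lt_R0.
  - apply Rlt_le_trans with (sqrt 1); [|rewrite sqrt_1; lra]. apply sqrt_lt_1_alt. split; [lra|].
    apply Rmult_lt_reg_r with (1 + x); [lra|]. unfold Rdiv. rewrite Rmult_assoc, Rinv_l; lra.
  - field. lra.
Qed.

Lemma b_range (k : Z) : In k l -> -1 < b k < 1.
Proof.
  intros Hk. apply In_indices in Hk. destruct (Z_lt_le_dec 0 k) as [H|H].
  - destruct (b_sq k ltac:(lia)). lra.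
  - destruct (b_sq (- k) ltac:(lia)) as [H1 _].
    assert (E := b_opp (- k) ltac:(lia)). rewrite Z.opp_involutive in E. lra.
Qed.

Lemma b_inj (j k : Z) : In j l -> In k l -> b j = b k -> j = k.
Proof.
  assert (Hpos : forall j k, (1 <= j <= Z.of_nat N)%Z -> (1 <= k <= Z.of_nat N)%Z -> b j = b k -> j = k).
  { intros i m Hi Hm E. apply (proj2 hdef); trivial.
    rewrite (proj2 (b_sq i Hi)), (proj2 (b_sq m Hm)), E. reflexivity. }
  intros Hj Hk E. apply In_indices in Hj. apply In_indices in Hk.
  destruct (Z_lt_le_dec 0 j) as [H1|H1]; destruct (Z_lt_le_dec 0 k) as [H2|H2].
  - apply Hpos; lia || trivial.
  - destruct (b_sq j ltac:(lia)) as [B1 _]. destruct (b_sq (- k) ltac:(lia)) as [B2 _].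
    assert (E2 := b_opp (- k) ltac:(lia)). rewrite Z.opp_involutive in E2. lra.
  - destruct (b_sq k ltac:(lia)) as [B1 _]. destruct (b_sq (- j) ltac:(lia)) as [B2 _].
    assert (E2 := b_opp (- j) ltac:(lia)). rewrite Z.opp_involutive in E2. lra.
  - assert (E1 := b_opp (- j) ltac:(lia)). assert (E2 := b_opp (- k) ltac:(lia)).
    rewrite Z.opp_involutive in E1, E2.
    assert (H := Hpos (- j)%Z (- k)%Z ltac:(lia) ltac:(lia) ltac:(lra)). lia.
Qed.

Lemma a_zeta (k : Z) : a * zeta_node k = arctanh (b k).
Proof. unfold a, zeta_node. field. lra. Qed.

Lemma beta_zeta (k : Z) : node_beta d r N k = tanh (zeta_node k / 2).
Proof.
  unfold node_beta, zeta_node. fold (b k). f_equal.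
  field. lra.
Qed.

Lemma zeta_inj (j k : Z) : In j l -> In k l -> zeta_node j = zeta_node k -> j = k.
Proof.
  intros Hj Hk E. apply b_inj; trivial.
  rewrite <- (tanh_arctanh (b j)), <- (tanh_arctanh (b k)) by now apply b_range.
  now rewrite <- !a_zeta, E.
Qed.

Lemma zeta_opp (k : Z) : (1 <= k <= Z.of_nat N)%Z -> zeta_node (- k) = - zeta_node k.
Proof.
  intros Hk. unfold zeta_node. rewrite b_opp, arctanh_opp by (destruct (b_sq k Hk); lia || lra). ring.
Qed.

Lemma blaschke_zeta (xi : R) : blaschke d r N (tanh (xi / 2))
  = Rprod_over l (fun k => tanh (a * (xi - zeta_node k))).
Proof.
  unfold blaschke. apply Rprod_over_ext. intros k _.
  rewrite beta_zeta, !arctanh_tanh. f_equal. unfold a. field. lra.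
Qed.

(** By the subtraction formula [(1 - b_l b_k)/(b_k - b_l)] is [1/tanh] of a difference of arctanh
    values. So [sigma_k] is the inverse of the Blaschke product at the node, without its vanishing
    factor. *)
Lemma sigma_zeta (k : Z) : In k l -> sigma r N k
  = Rprod_over (remove Z.eq_dec k l) (fun j => / tanh (a * (zeta_node k - zeta_node j))).
Proof.
  intros Hk. unfold sigma. apply Rprod_over_ext. intros j Hj. apply in_remove in Hj.
  destruct Hj as [Hj Hjk]. fold (b k) (b j).
  assert (Bk := b_range k Hk). assert (Bj := b_range j Hj).
  rewrite Rmult_minus_distr_l, !a_zeta, tanh_minus, !tanh_arctanh by trivial.
  assert (Hne : b k - b j <> 0) by (intros E; apply Hjk, b_inj; trivial; lra).
  assert (b k * b j < 1) by nra.
  field. split; lra.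
Qed.

(** With [w = tanh (a xi)], the factors of [k] and [-k] multiply to [(w^2 - b^2)/(1 - w^2 b^2)].
    Substituting [a_k = (1 - b^2)/(1 + b^2)] and [t = (1 - w^2)/(1 + w^2) = 1/cosh(2 a xi)] turns
    this into [(a_k - t)/(a_k + t)]. *)
Lemma abs_blaschke (xi : R) : Rabs (blaschke d r N (tanh (xi / 2)))
  = prod_below (fun j => ratio (node_a r N j) (/ cosh (2 * (a * xi)))) N.
Proof.
  rewrite blaschke_zeta. unfold l. rewrite Rprod_over_indices.
  assert (H : forall j, (j < N)%nat ->
    Rabs (tanh (a * (xi - zeta_node (Z.of_nat (S j)))) * tanh (a * (xi - zeta_node (- Z.of_nat (S j)))))
    = ratio (node_a r N j) (/ cosh (2 * (a * xi)))).
  { intros j Hj. assert (Hk : (1 <= Z.of_nat (S j) <= Z.of_nat N)%Z) by lia.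
    unfold node_a. set (k := Z.of_nat (S j)) in *.
    destruct (b_sq k Hk) as [Hb Ea].
    rewrite zeta_opp by trivial.
    replace (a * (xi - - zeta_node k)) with (a * xi - - (a * zeta_node k)) by ring.
    rewrite Rmult_minus_distr_l, a_zeta, !tanh_minus, tanh_opp, tanh_arctanh by lra.
    assert (Et : / cosh (2 * (a * xi)) = (1 - tanh (a * xi) ^ 2) / (1 + tanh (a * xi) ^ 2)).
    { assert (H2 := cosh2_minus_sinh2 (a * xi)).
      replace (cosh (2 * (a * xi))) with (cosh (a * xi) ^ 2 + sinh (a * xi) ^ 2).
      - unfold tanh.
        transitivity ((cosh (a * xi) ^ 2 - sinh (a * xi) ^ 2) / (cosh (a * xi) ^ 2 + sinh (a * xi) ^ 2)).
        + rewrite H2. field. nra.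
        + field. repeat split; nra.
      - replace (2 * (a * xi)) with (a * xi - - (a * xi)) by ring. rewrite cosh_minus.
        replace (cosh (- (a * xi))) with (cosh (a * xi)) by (unfold cosh; rewrite Ropp_involutive; field).
        replace (sinh (- (a * xi))) with (- sinh (a * xi)) by (unfold sinh; rewrite Ropp_involutive; field).
        ring. }
    rewrite Et, Ea. assert (Hw := tanh_range (a * xi)).
    set (w := tanh (a * xi)) in *. set (bk := b k) in *. unfold ratio.
    assert (P1 : 0 < 1 - w * bk) by nra. assert (P2 : 0 < 1 + w * bk) by nra.
    assert (P3 : 0 < 1 + w ^ 2) by nra. assert (P4 : 0 < 1 + bk ^ 2) by nra.
    replace ((w - bk) / (1 - w * bk) * ((w - - bk) / (1 - w * - bk)))
      with ((w ^ 2 - bk ^ 2) * / ((1 - w * bk) * (1 + w * bk))) by (field; lra).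
    replace ((1 - bk ^ 2) / (1 + bk ^ 2) - (1 - w ^ 2) / (1 + w ^ 2))
      with ((w ^ 2 - bk ^ 2) * (2 / ((1 + bk ^ 2) * (1 + w ^ 2)))) by (field; lra).
    rewrite !Rabs_mult, (Rabs_pos_eq (/ _)), (Rabs_pos_eq (2 / _)).
    - field. repeat split; try lra.
      replace ((1 - bk ^ 2) * (1 + w ^ 2) + (1 - w ^ 2) * (1 + bk ^ 2))
        with (2 * ((1 - w * bk) * (1 + w * bk))) by ring.
      apply Rgt_not_eq. nra.
    - apply Rlt_le, Rdiv_lt_0_compat; nra.
    - apply Rlt_le, Rinv_0_lt_compat. nra. }
  clear -H. assert (G : forall n, (n <= N)%nat ->
    Rabs (prod_below (fun j => tanh (a * (xi - zeta_node (Z.of_nat (S j))))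
       * tanh (a * (xi - zeta_node (- Z.of_nat (S j))))) n)
    = prod_below (fun j => ratio (node_a r N j) (/ cosh (2 * (a * xi)))) n).
  { induction n as [|n IH]; intros Hn; cbn [prod_below]; [apply Rabs_R1|].
    rewrite Rabs_mult, IH by lia. f_equal. apply H. lia. }
  apply G. lia.
Qed.

Section Evaluation.

Variables (f : C -> C) (xi : R).

Definition pole (k : Z) : R := if Z.eq_dec k 0 then xi else zeta_node k.

Definition strip_fun (z : C) : C := f (Ctanh (scaled (/ 2) 0 z)).

Lemma pole_index (k : Z) : In k l -> pole k = zeta_node k.
Proof.
  intros Hk. apply In_indices in Hk. unfold pole. destruct (Z.eq_dec k 0) as [E|_]; trivial. lia.
Qed.

Lemma contour_num_RtoC (t : R) : contour_num d nu strip_fun l pole (RtoC t)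
  = (f (RtoC (tanh (t / 2))) * RtoC (Rpower (cosh (t / 2)) (2 * nu - 1) * cosh (xi / 2)
      / Rsinhc ((t - xi) / 2)
      * Rprod_over l (fun k => (cosh (a * (t - zeta_node k)) / (a * Rsinhc (a * (t - zeta_node k))))%R)))%C.
Proof.
  unfold contour_num, strip_fun.
  rewrite !scaled_RtoC, Ccosh_RtoC, Ctanh_RtoC.
  replace (/ 2 * (t - 0)) with (t / 2) by field.
  rewrite Cpower_RtoC by apply cosh_pos.
  replace (pole 0%Z) with xi by reflexivity.
  replace (/ 2 * (t - xi)) with ((t - xi) / 2) by field.
  rewrite sinhc_RtoC.
  rewrite (Cprod_over_ext l _ (fun k => RtoC (cosh (a * (t - zeta_node k)) / (a * Rsinhc (a * (t - zeta_node k)))))).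
  - rewrite Cprod_over_RtoC, RtoC_mult, RtoC_div, RtoC_mult by apply Rsinhc_neq_0.
    unfold Cdiv. ring.
  - intros k Hk. rewrite scaled_RtoC, Ccosh_RtoC, sinhc_RtoC, pole_index by trivial.
    fold a. rewrite <- RtoC_mult, <- RtoC_div; trivial.
    apply Rmult_integral_contrapositive_currified; [lra|apply Rsinhc_neq_0].
Qed.

(** Away from its own centre a factor of [contour_num] is [1/tanh] times [t - s]; the latter cancels
    against the denominators of the residues. *)
Lemma pole_factor (t s : R) : t <> s ->
  cosh (a * (t - s)) / (a * Rsinhc (a * (t - s))) = (t - s) * / tanh (a * (t - s)).
Proof.
  intros H. assert (Hy : a * (t - s) <> 0) by (apply Rmult_integral_contrapositive_currified; lra).
  assert (Hs := sinh_neq_0 _ Hy). rewrite Rsinhc_neq by trivial.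
  assert (Hc := cosh_pos (a * (t - s))). unfold tanh. field. repeat split; lra.
Qed.

Hypothesis hxi : forall k, In k l -> xi <> zeta_node k.

Let x : R := tanh (xi / 2).
Let Bl : R := Rprod_over l (fun k => tanh (a * (xi - zeta_node k))).

Lemma Bl_neq_0 : Bl <> 0.
Proof.
  apply Rprod_over_neq_0. intros k Hk. apply tanh_neq_0.
  apply Rmult_integral_contrapositive_currified; [lra|]. assert (H := hxi k Hk). lra.
Qed.

Lemma indices_no_0 : ~ In 0%Z l.
Proof. intros H. apply In_indices in H. tauto. Qed.

(** The residue contains [1/B_N(x)], cancelled by [Bl], and the powers of [cosh(xi/2)] have
    exponents [-2 nu], [2 nu - 1] and 1, with sum 0. *)
Lemma eval_at_xi :
  (RtoC (Bl * Rpower (1 - x ^ 2) nu) * (contour_num d nu strip_fun l pole (RtoC (pole 0))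
   / RtoC (Rprod_over (remove Z.eq_dec 0%Z (0%Z :: l)) (fun j => pole 0 - pole j)%R)))%C
  = f (RtoC x).
Proof.
  assert (Er : remove Z.eq_dec 0%Z (0%Z :: l) = l).
  { simpl. apply notin_remove, indices_no_0. }
  rewrite Er, contour_num_RtoC. change (pole 0) with xi.
  rewrite (Rprod_over_ext l (fun j => xi - pole j) (fun j => xi - zeta_node j))
    by (intros j Hj; now rewrite pole_index).
  rewrite (Rprod_over_ext l (fun k => cosh (a * (xi - zeta_node k)) / (a * Rsinhc (a * (xi - zeta_node k))))
    (fun k => (xi - zeta_node k) * / tanh (a * (xi - zeta_node k))))
    by (intros k Hk; apply pole_factor; now apply hxi).
  rewrite Rprod_over_mult, Rprod_over_inv. fold Bl.
  set (D := Rprod_over l (fun k => xi - zeta_node k)).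
  assert (HD : D <> 0).
  { apply Rprod_over_neq_0. intros k Hk. assert (H := hxi k Hk). lra. }
  replace ((xi - xi) / 2) with 0 by field. rewrite Rsinhc_0.
  unfold Cdiv. rewrite <- RtoC_inv by trivial.
  assert (HB := Bl_neq_0). assert (Hc := cosh_pos (xi / 2)).
  fold x.
  transitivity (f (RtoC x) * RtoC (Bl * Rpower (1 - x ^ 2) nu
    * (Rpower (cosh (xi / 2)) (2 * nu - 1) * cosh (xi / 2) / 1 * (D * / Bl)) * / D))%C.
  - rewrite !RtoC_mult. ring.
  - replace (Bl * Rpower (1 - x ^ 2) nu
      * (Rpower (cosh (xi / 2)) (2 * nu - 1) * cosh (xi / 2) / 1 * (D * / Bl)) * / D) with 1; [ring|].
    unfold x. rewrite Rpower_one_minus_tanh_sq.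
    rewrite <- (Rpower_1 (cosh (xi / 2))) at 3 by trivial.
    transitivity (Rpower (cosh (xi / 2)) (- (2 * nu)) * Rpower (cosh (xi / 2)) (2 * nu - 1)
      * Rpower (cosh (xi / 2)) 1).
    + rewrite <- !Rpower_plus. replace (- (2 * nu) + (2 * nu - 1) + 1) with 0 by ring.
      now rewrite Rpower_O.
    + field. split; trivial.
Qed.

(** The coefficient [2 d / pi] is [1/(2 a)]: the derivative of [tanh (a zeta)] at its zero is [a],
    and [z'] brings 1/2. The opposite signs come from [beta_k - x] in the residue against
    [x - beta_k] in the formula. *)
Lemma eval_at_node (k : Z) : In k l ->
  (RtoC (Bl * Rpower (1 - x ^ 2) nu) * (contour_num d nu strip_fun l pole (RtoC (pole k))
   / RtoC (Rprod_over (remove Z.eq_dec k (0%Z :: l)) (fun j => pole k - pole j)%R))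
   + f (RtoC (node_beta d r N k)) *
     RtoC (2 * d * sigma r N k / PI
           * (Rpower (1 - x ^ 2) nu / Rpower (1 - node_beta d r N k ^ 2) (nu - 1))
           * blaschke_quot d r N k x))%C = 0.
Proof.
  intros Hk.
  assert (Hk0 : k <> 0%Z) by (intros ->; now apply indices_no_0).
  rewrite remove_cons_neq by trivial. rewrite pole_index by trivial.
  assert (Hx := hxi k Hk).
  assert (Hxb : x <> node_beta d r N k).
  { rewrite beta_zeta. intros E. apply tanh_inj in E. lra. }
  unfold blaschke_quot. destruct (Req_EM_T x (node_beta d r N k)) as [E|_]; [now elim Hxb|].
  cbv zeta. replace (blaschke d r N x) with Bl by (symmetry; apply blaschke_zeta).
  change (Rprod_over (0%Z :: remove Z.eq_dec k l) (fun j => zeta_node k - pole j))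
    with ((zeta_node k - xi) * Rprod_over (remove Z.eq_dec k l) (fun j => zeta_node k - pole j)).
  rewrite (Rprod_over_ext (remove Z.eq_dec k l) (fun j => zeta_node k - pole j) (fun j => zeta_node k - zeta_node j))
    by (intros j Hj; apply in_remove in Hj; now rewrite pole_index).
  rewrite contour_num_RtoC.
  rewrite (Rprod_over_remove l k) by (trivial; apply NoDup_indices).
  replace (a * (zeta_node k - zeta_node k)) with 0 by ring.
  rewrite Rsinhc_0, cosh_0.
  assert (Hne : forall j, In j (remove Z.eq_dec k l) -> zeta_node k <> zeta_node j).
  { intros j Hj E. apply in_remove in Hj. destruct Hj as [Hj Hjk].
    apply Hjk. symmetry. now apply zeta_inj. }
  rewrite (Rprod_over_ext (remove Z.eq_dec k l)
    (fun j => cosh (a * (zeta_node k - zeta_node j)) / (a * Rsinhc (a * (zeta_node k - zeta_node j))))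
    (fun j => (zeta_node k - zeta_node j) * / tanh (a * (zeta_node k - zeta_node j))))
    by (intros j Hj; apply pole_factor; now apply Hne).
  rewrite Rprod_over_mult, <- sigma_zeta by trivial.
  set (D := Rprod_over (remove Z.eq_dec k l) (fun j => zeta_node k - zeta_node j)).
  assert (HD : D <> 0).
  { apply Rprod_over_neq_0. intros j Hj. assert (H := Hne j Hj). lra. }
  rewrite beta_zeta.
  set (zk := zeta_node k) in *. set (s := sigma r N k).
  assert (Hy : (zk - xi) / 2 <> 0) by lra.
  assert (Hsh := sinh_neq_0 _ Hy). rewrite Rsinhc_neq by trivial.
  unfold Cdiv. rewrite <- RtoC_inv by (apply Rmult_integral_contrapositive_currified; trivial; lra).
  set (V := Rpower (1 - x ^ 2) nu).
  set (A1 := Bl * V * (Rpower (cosh (zk / 2)) (2 * nu - 1) * cosh (xi / 2)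
    / (sinh ((zk - xi) / 2) / ((zk - xi) / 2)) * (1 / (a * 1) * (D * s))) * / ((zk - xi) * D)).
  set (A2 := 2 * d * s / PI * (V / Rpower (1 - tanh (zk / 2) ^ 2) (nu - 1)) * (Bl / (x - tanh (zk / 2)))).
  transitivity (f (RtoC (tanh (zk / 2))) * RtoC (A1 + A2))%C.
  - unfold A1 at 1. rewrite RtoC_plus, !RtoC_mult. ring.
  - replace (A1 + A2) with 0; [ring|]. unfold A1, A2.
    rewrite Rpower_one_minus_tanh_sq.
    unfold x. rewrite tanh_sub.
    assert (Hc1 := cosh_pos (xi / 2)). assert (Hc2 := cosh_pos (zk / 2)).
    assert (E1 : sinh (xi / 2 - zk / 2) = - sinh ((zk - xi) / 2)).
    { replace (xi / 2 - zk / 2) with (- ((zk - xi) / 2)) by field.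
      unfold sinh. rewrite Ropp_involutive. field. }
    rewrite E1.
    assert (E2 : Rpower (cosh (zk / 2)) (2 * nu - 1)
      = / Rpower (cosh (zk / 2)) (- (2 * (nu - 1))) * cosh (zk / 2)).
    { rewrite <- Rpower_Ropp. rewrite <- (Rpower_1 (cosh (zk / 2))) at 3 by trivial.
      rewrite <- Rpower_plus. f_equal. ring. }
    rewrite E2.
    assert (P := exp_pos (- (2 * (nu - 1)) * ln (cosh (zk / 2)))).
    fold (Rpower (cosh (zk / 2)) (- (2 * (nu - 1)))) in P.
    unfold a. field. repeat split; try lra.
Qed.

Lemma error_eq_contour_sum :
  (f (RtoC x) - approx d nu r N f x)%C
  = (RtoC (Bl * Rpower (1 - x ^ 2) nu) * contour_sum d nu strip_fun l pole)%C.
Proof.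
  unfold contour_sum, approx.
  change (Csum_over (0%Z :: l) ?F) with (F 0%Z + Csum_over l F)%C. cbv beta.
  rewrite Cmult_plus_distr_l, eval_at_xi. unfold Cminus. f_equal.
  rewrite <- Csum_over_scal. fold l.
  transitivity (- (1) * Csum_over l (fun k =>
    (f (RtoC (node_beta d r N k)) *
     RtoC (2 * d * sigma r N k / PI
           * (Rpower (1 - x ^ 2) nu / Rpower (1 - node_beta d r N k ^ 2) (nu - 1))
           * blaschke_quot d r N k x)))%C)%C; [ring|].
  rewrite <- Csum_over_scal. apply Csum_over_ext. intros k Hk.
  assert (H := eval_at_node k Hk).
  cbv beta. match type of H with (?v + ?u)%C = _ =>
    transitivity (v + u + - u)%C; [rewrite H|]; ring end.
Qed.

End Evaluation.

End Formula.

(** * The error estimate *)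

Lemma is_derive_is_lim_quot (g : R -> R) (x l : R) : is_derive g x l -> g x = 0 ->
  is_lim (fun t => g t / (t - x)) x l.
Proof.
  intros H H0. apply is_derive_Reals in H. apply is_lim_spec. intros eps.
  destruct (H eps (cond_pos eps)) as [del Hdel]. exists del. intros y Hy Hne.
  change (Rabs (y - x) < del) in Hy.
  assert (Hne' : y - x <> 0) by (intros E; apply Hne; lra).
  specialize (Hdel (y - x) Hne' Hy).
  rewrite Rplus_minus in Hdel. rewrite H0, Rminus_0_r in Hdel. exact Hdel.
Qed.

Lemma ex_derive_Rprod_over (l : list Z) (F : Z -> R -> R) (x : R) :
  (forall k, In k l -> ex_derive (F k) x) -> ex_derive (fun t => Rprod_over l (fun k => F k t)) x.
Proof.
  induction l as [|b l IH]; intros H; simpl; [apply ex_derive_const|].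
  apply (ex_derive_mult (F b) (fun t => Rprod_over l (fun k => F k t))).
  - apply H. now left.
  - apply IH. intros k Hk. apply H. now right.
Qed.

Lemma is_derive_tanh_arctanh (c y x : R) : -1 < x < 1 ->
  is_derive (fun t => tanh (c * (arctanh t - y))) x
    (c / (1 - x ^ 2) * / cosh (c * (arctanh x - y)) ^ 2).
Proof.
  intros Hx. 
  assert (H : is_derive (fun t => c * (arctanh t - y)) x (c / (1 - x ^ 2))).
  { unfold arctanh. assert (Hq : 0 < (1 + x) / (1 - x)) by (apply Rdiv_lt_0_compat; lra).
    auto_derive.
    - unfold Rdiv, Rminus in Hq. repeat split; trivial; lra.
    - field. repeat split; nra. }
  exact (is_derive_comp tanh _ x _ _ (is_derive_tanh _) H).
Qed.

Section NodeCase.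

Variables (d mu nu : R) (N : nat).
Hypothesis hd : 0 < d < PI.
Hypothesis hmu : 0 < mu.
Hypothesis hN : (0 < N)%nat.
Let r : R := d * mu / PI.
Hypothesis hdef : approx_defined r N.
Let l : list Z := indices N.

(** All other terms vanish with [B_N]; in the remaining one the limit is [B_N'(beta_k)], whose
    product with [sigma_k] and the weights is 1. The residue argument does not reach this case,
    since two of its poles would coincide. *)
Lemma approx_at_node (f : C -> C) (k : Z) : In k l ->
  approx d nu r N f (node_beta d r N k) = f (RtoC (node_beta d r N k)).
Proof.
  intros Hk.
  set (beta := node_beta d r N). set (x := beta k).
  assert (Hbeta : forall j, beta j = tanh (zeta_node d mu N j / 2)) by (intros j; now apply beta_zeta).
  assert (Hx : -1 < x < 1) by (unfold x; rewrite Hbeta; apply tanh_range).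
  set (F := fun j t => tanh (PI / (2 * d) * (arctanh t - arctanh (beta j)))).
  assert (Fk : F k x = 0) by (unfold F, x; rewrite Rminus_diag, Rmult_0_r; apply tanh_0).
  assert (Hbl : forall t, blaschke d r N t
    = F k t * Rprod_over (remove Z.eq_dec k l) (fun j => F j t)).
  { intros t. unfold blaschke. apply (Rprod_over_remove l k (fun j => F j t)); trivial. apply NoDup_indices. }
  assert (Hbl0 : blaschke d r N x = 0) by (rewrite Hbl, Fk; ring).
  assert (Hne : forall j, In j l -> j <> k -> x <> beta j).
  { intros j Hj Hjk E. unfold x in E. rewrite !Hbeta in E. apply tanh_inj in E.
    apply Hjk. apply (zeta_inj d mu N hd hmu hN hdef); trivial. lra. }
  set (D := PI / (2 * d) / (1 - x ^ 2) * Rprod_over (remove Z.eq_dec k l) (fun j => F j x)).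
  assert (HD : is_derive (blaschke d r N) x D).
  { apply is_derive_ext with (fun t => F k t * Rprod_over (remove Z.eq_dec k l) (fun j => F j t));
      [intros t; symmetry; apply Hbl|].
    assert (HR : ex_derive (fun t => Rprod_over (remove Z.eq_dec k l) (fun j => F j t)) x).
    { apply (ex_derive_Rprod_over _ F). intros j _. eexists. now apply is_derive_tanh_arctanh. }
    destruct HR as [R' HR].
    evar_last.
    - apply (is_derive_mult (F k) (fun t => Rprod_over (remove Z.eq_dec k l) (fun j => F j t))).
      + now apply is_derive_tanh_arctanh.
      + exact HR.
      + intros; apply Rmult_comm.
    - unfold plus, mult; simpl. unfold mult; simpl.
      rewrite Fk. fold (beta k). fold x. rewrite Rminus_diag, Rmult_0_r, cosh_0.
      unfold D. simpl. unfold Rdiv. field_simplify_eq; [ring|]. nra. }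
  assert (Hlim : real (Lim (fun t => blaschke d r N t / (t - x)) x) = D).
  { rewrite (is_lim_unique _ _ D); trivial. now apply is_derive_is_lim_quot. }
  unfold approx. fold l. fold beta.
  rewrite (Csum_over_single l k); trivial; [|apply NoDup_indices|].
  - fold x. unfold blaschke_quot. fold (beta k). fold x.
    destruct (Req_EM_T x x) as [_|E]; [|now elim E]. cbv zeta. rewrite Hlim.
    assert (Hx2 : 0 < 1 - x ^ 2) by nra.
    replace (2 * d * sigma r N k / PI * (Rpower (1 - x ^ 2) nu / Rpower (1 - x ^ 2) (nu - 1)) * D) with 1; [ring|].
    assert (EP : Rpower (1 - x ^ 2) nu = Rpower (1 - x ^ 2) (nu - 1) * (1 - x ^ 2)).
    { rewrite <- (Rpower_1 (1 - x ^ 2)) at 3 by trivial. rewrite <- Rpower_plus. f_equal. ring. }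
    rewrite EP. unfold D.
    rewrite (Rprod_over_ext (remove Z.eq_dec k l) (fun j => F j x)
      (fun j => tanh (PI / (4 * d) * (zeta_node d mu N k - zeta_node d mu N j)))).
    + unfold r. rewrite (sigma_zeta d mu N hd hmu hN hdef k Hk), Rprod_over_inv.
      set (S := Rprod_over _ _).
      assert (HS : S <> 0).
      { apply Rprod_over_neq_0. intros j Hj. apply in_remove in Hj. destruct Hj as [Hj Hjk].
        apply tanh_neq_0. apply Rmult_integral_contrapositive_currified.
        - apply Rgt_not_eq, Rdiv_lt_0_compat; lra.
        - intros E. apply Hjk. symmetry. apply (zeta_inj d mu N hd hmu hN hdef); trivial. lra. }
      assert (P := exp_pos ((nu - 1) * ln (1 - x ^ 2))). fold (Rpower (1 - x ^ 2) (nu - 1)) in P.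
      field. repeat split; lra.
    + intros j _. unfold F, x. rewrite !Hbeta, !arctanh_tanh. f_equal. field. lra.
  - intros j Hj Hjk. unfold blaschke_quot. fold (beta j). fold x.
    destruct (Req_EM_T x (beta j)) as [E|_]; [now elim (Hne j Hj Hjk)|].
    cbv zeta. rewrite Hbl0. unfold Rdiv. rewrite Rmult_0_l, Rmult_0_r. ring.
Qed.

End NodeCase.

(** [1 - tanh^2 = 1/cosh^2], and the modulus of a real power is determined by the modulus of its
    base. *)
Lemma Cmod_weight (mu : R) (z : C) : Ccosh z <> 0 ->
  Cmod (weight mu (Ctanh z)) = Rpower (Cmod (Ccosh z)) (- mu).
Proof.
  intros H. assert (Hm := proj1 (Cmod_gt_0 _) H).
  unfold weight, Crpower. rewrite Cmod_Cexp, one_minus_Ctanh2 by trivial.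
  unfold Rpower. f_equal.
  replace (Re (RtoC (mu / 2) * Cln (/ (Ccosh z * Ccosh z)))%C)
    with (mu / 2 * ln (Cmod (/ (Ccosh z * Ccosh z))%C))
    by (unfold Cln, Cmult, RtoC, Re; simpl; ring).
  rewrite Cmod_inv, Cmod_mult by now apply Cmult_neq_0.
  rewrite ln_Rinv, ln_mult by nra. field.
Qed.

Lemma scaled_half (z : C) : scaled (/ 2) 0 z = (z / RtoC 2)%C.
Proof. unfold scaled. rewrite RtoC_inv by lra. unfold Cdiv. ring. Qed.

Lemma Ccosh_half_neq_0 (d : R) (z : C) : d < PI -> Rabs (snd z) < d -> Ccosh (scaled (/ 2) 0 z) <> 0.
Proof.
  intros Hd Hz E. destruct z as [u v]. simpl in Hz. rewrite scaled_pair in E.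
  assert (H := Re_Ccosh_pos (/ 2 * (u - 0)) (/ 2 * v)).
  rewrite E in H. simpl in H.
  assert (0 < 0); [|lra]. apply H. rewrite Rabs_mult, Rabs_pos_eq by lra. lra.
Qed.

Lemma strip_fun_cdiff (d mu : R) (f : C -> C) (z : C) : d < PI -> Hinf d mu f ->
  Rabs (snd z) < d -> cdiff (strip_fun f) z.
Proof.
  intros Hd [Hf _] Hz. unfold strip_fun.
  apply (cdiff_comp (fun w => Ctanh (scaled (/ 2) 0 w)) f).
  - apply cdiff_ext_loc with (fun w => Csinh (scaled (/ 2) 0 w) / Ccosh (scaled (/ 2) 0 w))%C 1; [lra| |].
    + intros w _. now rewrite Ctanh_eq.
    + apply cdiff_div.
      * apply cdiff_scaled, cdiff_Csinh.
      * apply cdiff_scaled, cdiff_Ccosh.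
      * now apply (Ccosh_half_neq_0 d).
  - apply ex_derive_cdiff, Hf. exists z. split; [exact Hz|]. now rewrite scaled_half.
Qed.

Lemma strip_fun_bound (d mu : R) (f : C -> C) (z : C) : d < PI ->
  Rbar_le (Hinf_norm d mu f) 1 -> Rabs (snd z) < d ->
  Cmod (strip_fun f z) <= Rpower (Cmod (Ccosh (scaled (/ 2) 0 z))) (- mu).
Proof.
  intros Hd Hf Hz. unfold strip_fun. set (w := Ctanh (scaled (/ 2) 0 z)).
  assert (Hc := Ccosh_half_neq_0 d z Hd Hz).
  assert (Ew : Cmod (weight mu w) = Rpower (Cmod (Ccosh (scaled (/ 2) 0 z))) (- mu)) by now apply Cmod_weight.
  assert (Hp : 0 < Cmod (weight mu w)) by (rewrite Ew; apply exp_pos).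
  assert (H : Rbar_le (Finite (Cmod (f w / weight mu w)%C)) (Hinf_norm d mu f)).
  { unfold Hinf_norm. apply (proj1 (Lub_Rbar_correct _)). exists w. split; trivial.
    exists z. split; [exact Hz|]. unfold w. now rewrite scaled_half. }
  assert (H1 := Rbar_le_trans _ _ _ H Hf). simpl in H1.
  rewrite Cmod_div in H1 by now apply Cmod_gt_0.
  rewrite <- Ew. apply Rmult_le_reg_r with (/ Cmod (weight mu w)); [now apply Rinv_0_lt_compat|].
  rewrite Rinv_r by lra. exact H1.
Qed.

Lemma ln_cosh_le (x : R) : ln (cosh x) <= Rabs x.
Proof.
  rewrite <- (ln_exp (Rabs x)). apply ln_le; [apply cosh_pos|].
  assert (H := cosh_le_exp x 0). rewrite cosh_0, Rminus_0_r in H. lra.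
Qed.

Lemma ln_cosh_ge (x : R) : Rabs x - ln 2 <= ln (cosh x).
Proof.
  assert (H := inv_cosh_le x). assert (Hc := cosh_pos x).
  apply ln_le in H; [|now apply Rinv_0_lt_compat].
  rewrite ln_Rinv, ln_mult, ln_exp in H by (lra || apply exp_pos). lra.
Qed.

(** This is where [r = d mu / pi] comes from: [cosh(xi/2)^(-mu)] decays like [exp(-mu |xi|/2)], and
    [t] like [exp(-pi |xi|/(2d))]. The factor [2^mu] stems from [ln cosh x >= |x| - ln 2]. *)
Lemma cosh_decay (d mu xi : R) : 0 < d -> 0 < mu ->
  Rpower (cosh (xi / 2)) (- mu)
  <= Rpower 2 mu * Rpower (/ cosh (2 * (PI / (4 * d) * xi))) (d * mu / PI).
Proof.
  intros Hd Hmu. assert (HP := PI_RGT_0). unfold Rpower. rewrite <- exp_plus. apply exp_le.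
  rewrite ln_Rinv by apply cosh_pos.
  assert (H1 := ln_cosh_ge (xi / 2)). assert (H2 := ln_cosh_le (2 * (PI / (4 * d) * xi))).
  replace (2 * (PI / (4 * d) * xi)) with (PI / d * (xi / 2)) in * by (field; lra).
  assert (Hpd : 0 < PI / d) by (apply Rdiv_lt_0_compat; lra).
  rewrite Rabs_mult, (Rabs_pos_eq (PI / d)) in H2 by lra.
  assert (Hr : 0 < d * mu / PI) by (apply Rdiv_lt_0_compat; nra).
  assert (H3 : d * mu / PI * ln (cosh (PI / d * (xi / 2))) <= mu * Rabs (xi / 2)).
  { apply Rle_trans with (d * mu / PI * (PI / d * Rabs (xi / 2))).
    - apply Rmult_le_compat_l; lra.
    - right. field. lra. }
  assert (H4 : mu * (Rabs (xi / 2) - ln 2) <= mu * ln (cosh (xi / 2))) by (apply Rmult_le_compat_l; lra).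
  lra.
Qed.

Theorem theorem3p3 (d mu nu : R)
  (hd : 0 < d < PI) (hmu : 0 < mu) (hnu : 0 < nu)
  (hmunu : mu / 2 < nu < mu / 2 + 1) :
  exists K : R, 0 < K /\
    forall N : nat, (0 < N)%nat -> approx_defined (d * mu / PI) N ->
      Rbar_le (worst_error d mu nu (d * mu / PI) N)
              (K * exp (- sqrt (PI * d * mu * INR N))).
Proof.
  set (r := d * mu / PI).
  assert (Hr : 0 < r) by (apply Rdiv_lt_0_compat; nra).
  destruct (ganelius_bound r Hr) as [Kg [HKg Hg]].
  (* The constant of [contour_sum_bound] with [kappa] unfolded; it involves [d], [mu] and [nu]
     only. *)
  set (Kc := 2 / ((1 - Rabs (2 * nu - mu - 1)) / 2 * cos (d / 2) * sin (d / 4))).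
  assert (HKc : 0 < Kc).
  { assert (H1 := kappa_pos mu nu hmunu). assert (H2 := cos_half_d d hd).
    assert (H3 : 0 < sin (d / 4)) by (apply sin_gt_0; lra).
    apply Rdiv_lt_0_compat; [lra|]. repeat apply Rmult_lt_0_compat; lra. }
  assert (H2mu : 0 < Rpower 2 mu) by apply exp_pos.
  exists (Kc * Rpower 2 mu * Kg). split; [now apply Rmult_lt_0_compat; [apply Rmult_lt_0_compat|]|].
  intros N HN Hdef.
  assert (Erate : sqrt (PI * d * mu * INR N) = PI * sqrt (r * INR N)).
  { rewrite <- (sqrt_pow2 PI) at 2 by lra. rewrite <- sqrt_mult.
    - f_equal. unfold r. field. lra.
    - apply pow2_ge_0.
    - apply Rmult_le_pos; [lra|apply pos_INR]. }
  rewrite Erate. set (E := exp (- (PI * sqrt (r * INR N)))).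
  assert (HE : 0 < E) by apply exp_pos.
  assert (HKE : 0 < Kc * Rpower 2 mu * Kg * E) by (apply Rmult_lt_0_compat; trivial; now apply Rmult_lt_0_compat; [apply Rmult_lt_0_compat|]).
  unfold worst_error, Rbar_lub. destruct (Rbar_ex_lub _) as [L HL]. simpl proj1_sig.
  apply (proj2 HL). intros S [f [Hf [Hf1 ->]]].
  unfold sup_error. apply (proj2 (Lub_Rbar_correct _)). intros v [x [Hx ->]]. simpl.
  set (xi := 2 * arctanh x).
  assert (Ex : x = tanh (xi / 2)).
  { unfold xi. replace (2 * arctanh x / 2) with (arctanh x) by field. now rewrite tanh_arctanh. }
  (* At a node the error is 0 by interpolation; elsewhere all poles are distinct and the residue
     identity applies. *)
  destruct (Classical_Prop.classic (exists k, In k (indices N) /\ xi = zeta_node d mu N k)) as [[k [Hk Exi]]|Hno].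
  - assert (Exk : x = node_beta d r N k).
    { rewrite Ex, Exi. symmetry. now apply beta_zeta. }
    assert (HA := approx_at_node d mu nu N hd hmu HN Hdef f k Hk). fold r in HA.
    rewrite Exk, HA, Cmod_sub_diag. lra.
  - assert (Hne : forall k, In k (indices N) -> xi <> zeta_node d mu N k).
    { intros k Hk E1. apply Hno. now exists k. }
    assert (HA := error_eq_contour_sum d mu nu N hd hmu HN Hdef f xi Hne).
    rewrite <- (blaschke_zeta d mu N hd xi), <- Ex in HA. fold r in HA. rewrite HA. clear HA.
    assert (Hl0 : ~ In 0%Z (indices N)) by (intros H; apply In_indices in H; tauto).
    assert (HS : Cmod (contour_sum d nu (strip_fun f) (indices N) (pole d mu N xi))
      <= Kc * Rpower (cosh (xi / 2)) (2 * nu - mu)).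
    { apply (contour_sum_bound d mu nu hd hmunu (strip_fun f) (indices N) (pole d mu N xi)).
      - intros z Hz. apply (strip_fun_cdiff d mu); trivial. lra.
      - intros z Hz. apply (strip_fun_bound d mu); trivial. lra.
      - constructor; [trivial|apply NoDup_indices].
      - intros j k [<-|Hj] [<-|Hk]; trivial.
        + rewrite (pole_index d mu N HN xi k Hk). intros E1. now elim (Hne k Hk).
        + rewrite (pole_index d mu N HN xi j Hj). intros E1. now elim (Hne j Hj).
        + rewrite (pole_index d mu N HN xi k Hk), (pole_index d mu N HN xi j Hj).
          now apply (zeta_inj d mu N hd hmu HN Hdef). }
    assert (HB := abs_blaschke d mu N hd hmu HN Hdef xi). rewrite <- Ex in HB. fold r in HB.
    rewrite Cmod_mult, Cmod_R, Rabs_mult, HB.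
    rewrite Ex, Rpower_one_minus_tanh_sq, (Rabs_pos_eq (Rpower _ _)) by apply Rlt_le, exp_pos.
    destruct Hdef as [HN0 _].
    assert (Hc1 := cosh_ge_1 (2 * (PI / (4 * d) * xi))).
    assert (Ht : 0 < / cosh (2 * (PI / (4 * d) * xi)) <= 1).
    { split; [apply Rinv_0_lt_compat; lra|]. rewrite <- Rinv_1. apply Rinv_le_contravar; lra. }
    assert (HG := Hg N HN HN0 _ Ht). fold E in HG. fold r.
    set (P := prod_below _ N) in *.
    assert (HP01 : 0 <= P).
    { apply prod_below_range. intros j Hj. apply ratio_range; [|lra].
      apply (node_a_range r N (Z.to_nat (N0 r N))); trivial; lia. }
    assert (HD := cosh_decay d mu xi (proj1 hd) hmu). fold r in HD.
    apply Rle_trans with (P * Rpower (cosh (xi / 2)) (- (2 * nu)) * (Kc * Rpower (cosh (xi / 2)) (2 * nu - mu))).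
    { apply Rmult_le_compat_l; trivial. apply Rmult_le_pos; trivial. apply Rlt_le, exp_pos. }
    (* The weight [(1 - x^2)^nu] and the growth of the contour integral combine to
       [cosh(xi/2)^(-mu)], in which [nu] cancels. *)
    replace (P * Rpower (cosh (xi / 2)) (- (2 * nu)) * (Kc * Rpower (cosh (xi / 2)) (2 * nu - mu)))
      with (Kc * (P * (Rpower (cosh (xi / 2)) (- (2 * nu)) * Rpower (cosh (xi / 2)) (2 * nu - mu)))) by ring.
    rewrite <- Rpower_plus. replace (- (2 * nu) + (2 * nu - mu)) with (- mu) by ring.
    rewrite !Rmult_assoc. apply Rmult_le_compat_l; [lra|].
    apply Rle_trans with (P * (Rpower 2 mu * Rpower (/ cosh (2 * (PI / (4 * d) * xi))) r)).
    { now apply Rmult_le_compat_l. }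
    replace (P * (Rpower 2 mu * Rpower (/ cosh (2 * (PI / (4 * d) * xi))) r))
      with (Rpower 2 mu * (Rpower (/ cosh (2 * (PI / (4 * d) * xi))) r * P)) by ring.
    apply Rmult_le_compat_l; lra.
Qed.
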